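(* Let $\kappa\in\mathcal{B}^2$ be a bivariate Bernstein function and let $W_\kappa$ be its bivariate Bernstein-gamma function. Then for $(\zeta,z)\in\mathbb{C}_{[0,\infty)}\times\mathbb{C}_{(0,\infty)}$, $$W_\kappa(\zeta,z)=\frac{\kappa^{1/2}(\zeta,1)}{\kappa(\zeta,z)\,\kappa^{1/2}(\zeta,1+z)}\,e^{L_\kappa(\zeta,z)}e^{-E_\kappa(\zeta,z)}.$$ Moreover, $$\sup_{\kappa\in\mathcal{B}^2}\ \sup_{(\zeta,z)\in\mathbb{C}_{[0,\infty)}\times\mathbb{C}_{(0,\infty)}}|E_\kappa(\zeta,z)|\le 2,$$ $$\lim_{\Re(z)\to\infty}E_\kappa(\zeta,z)=\frac12\int_1^\infty \mathrm{P}(u)\left(\Big(\frac{\kappa'_z(\zeta,u)}{\kappa(\zeta,u)}\Big)^2-\frac{\kappa''_z(\zeta,u)}{\kappa(\zeta,u)}\right)du=:T_\kappa(\zeta),$$ and for each fixed $z\in\mathbb{C}_{(0,\infty)}$, $$\lim_{\Re(\zeta)\to\infty}E_\kappa(\Re(\zeta),z)=0.$$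
   Context: Notation: $\mathbb{C}_{(0,\infty)}=\{z\in\mathbb{C}:\Re z>0\}$, $\mathbb{C}_{[0,\infty)}=\{z\in\mathbb{C}:\Re z\ge 0\}$; $\log_0$ is the principal branch of the logarithm on $\mathbb{C}\setminus(-\infty,0]$, and $w^{1/2}=e^{\frac12\log_0 w}$; $\kappa'_z,\kappa''_z$ denote derivatives in the second argument. A function $\kappa$ is a bivariate Bernstein function, $\kappa\in\mathcal{B}^2$, if for all $\zeta,z\in\mathbb{C}_{[0,\infty)}$, $$\kappa(\zeta,z)=\kappa(0,0)+d_1\zeta+d_2z+\int_0^\infty\int_0^\infty\big(1-e^{-\zeta x_1-zx_2}\big)\mu(dx_1,dx_2),$$ where $\kappa(0,0),d_1,d_2\in[0,\infty)$ and $\mu$ is a measure on $(0,\infty)\times(0,\infty)$ such that $\int_0^\infty\int_0^\infty\min\{x_1,1\}\min\{x_2,1\}\,\mu(dx_1,dx_2)<\infty$. The class $\mathcal{B}^2$ is identified with the class of bivariate Laplace exponents of possibly killed bivariate subordinators. $W_\kappa$ is the bivariate Bernstein-gamma function associated with $\kappa$ if: (i) $W_\kappa(\zeta,z+1)=\kappa(\zeta,z)W_\kappa(\zeta,z)$ for all $\zeta\in\mathbb{C}_{[0,\infty)}$, $z\in\mathbb{C}_{(0,\infty)}$; (ii) $W_\kappa(\zeta,1)=1$ for each $\zeta\in\mathbb{C}_{[0,\infty)}$; (iii) $W_\kappa$ is holomorphic as a function of two variables on $\mathbb{C}_{(0,\infty)}\times\mathbb{C}_{(0,\infty)}$; (iv)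 for any $q\in[0,\infty)$ the function $W_\kappa(q,\cdot)$ is the Mellin transform $z\mapsto\mathbb{E}[Y^{z-1}]$ of a positive random variable $Y$. For $(\zeta,z)\in\mathbb{C}_{[0,\infty)}\times\mathbb{C}_{(0,\infty)}$ define $$L_\kappa(\zeta,z)=\int_{1\to 1+z}\log_0(\kappa(\zeta,\chi))\,d\chi=z\int_0^1\log_0(\kappa(\zeta,1+zv))\,dv$$ (path integral along a contour from $1$ to $1+z$ in the domain of analyticity of $\log_0(\kappa(\zeta,\cdot))$, which may be taken to be the straight segment), $\mathrm{P}(u)=(u-\lfloor u\rfloor)(1-(u-\lfloor u\rfloor))$, and $$E_\kappa(\zeta,z)=\frac12\int_1^\infty \mathrm{P}(u)\left(\log_0\frac{\kappa(\zeta,u+z)}{\kappa(\zeta,u)}\right)''du,$$ where $''$ is the second derivative in $u$.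
   Formalization: Last limit is stated only if d_2=0, d_1>0 or μ is infinite (false otherwise, e.g. κ=z); for ζ=it, t≠0, the product formula assumes W_κ(ζ,z) is the limit of W_κ(ξ,z) as ξ→ζ, Re ξ>0, since (i)-(iv) do not determine W_κ there. *)

(* Defs.v *)
(* MathComp-Analysis; complex numbers are R[i] over a realType R. *)
From HB Require Import structures.
From mathcomp Require Import all_boot all_order all_algebra.
From mathcomp.real_closed Require Export complex.
From mathcomp Require Import all_classical all_reals all_analysis.

Set Implicit Arguments.
Unset Strict Implicit.
Unset Printing Implicit Defensive.

Import Order.TTheory GRing.Theory Num.Theory.
Import numFieldNormedType.Exports.

Local Open Scope classical_set_scope.
Local Open Scope ring_scope.
Local Open Scope complex_scope.

(* R[i], declared as a numFieldType so that it inherits the normed topology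
   and the (complex) differential calculus of MathComp-Analysis. *)
Definition C (R : realType) : numFieldType := R[i].

Section ComplexFunctions.
Context {R : realType}.
Implicit Types (z w : C R) (x y : R).

Definition toC x : C R := x%:C.

(* The norm `|z| of R[i] is itself a complex number; this is its real value. *)
Definition cmod z : R := complex.Re `|z|.

Definition cexp z : C R :=
  (expR (complex.Re z) * cos (complex.Im z)) +i*
  (expR (complex.Re z) * sin (complex.Im z)).

(* Principal argument, in ]-pi, pi[ off the cut ]-oo, 0]; on the cut (where
   log_0 is undefined in the text) it takes junk values. *)
Definition Arg0 z : R :=
  if 0 <= complex.Im z then acos (complex.Re z / cmod z)
  else - acos (complex.Re z / cmod z).

Definition log0 z : C R := ln (cmod z) +i* Arg0 z.

Definition csqrt z : C R := cexp (2^-1 * log0 z).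

Definition Cgt0 : set (C R) := [set z | 0 < complex.Re z].
Definition Cge0 : set (C R) := [set z | 0 <= complex.Re z].

(* The filter "Re z -> +oo", with no restriction on Im z. *)
Definition Re_pinfty : set_system (C R) :=
  [set A | exists M : R, forall z, M < complex.Re z -> A z].

(* Second derivative of a complex-valued function of a real variable. *)
Definition rderive2 (f : R -> C R) (u : R) : C R :=
  derive1n 2 (fun v => complex.Re (f v)) u +i*
  derive1n 2 (fun v => complex.Im (f v)) u.

Definition cintegrable d (T : measurableType d) (mu : {measure set T -> \bar R})
    (D : set T) (f : T -> C R) : Prop :=
  mu.-integrable D (EFin \o (fun t => complex.Re (f t))) /\
  mu.-integrable D (EFin \o (fun t => complex.Im (f t))).

Definition cintegral d (T : measurableType d) (mu : {measure set T -> \bar R})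
    (D : set T) (f : T -> C R) : C R :=
  Rintegral mu D (fun t => complex.Re (f t)) +i*
  Rintegral mu D (fun t => complex.Im (f t)).

End ComplexFunctions.

Section BernsteinGamma.
Context {R : realType}.

Definition quadrant : set (R * R) := [set x | 0 < x.1 /\ 0 < x.2].

(* [bernstein2_rep kappa k00 d1 d2 mu]: kappa has killing rate k00, drifts
   d1, d2 and Levy measure mu; only the restriction of mu to the open quadrant
   is used.  The min-product condition alone does not make the integrand
   integrable (large jumps in one coordinate), so the existence of the
   integral as a Lebesgue integral is demanded explicitly. *)
Definition bernstein2_rep (kappa : C R -> C R -> C R) (k00 d1 d2 : R)
    (mu : {measure set (R * R)%type -> \bar R}) : Prop :=
  [/\ 0 <= k00, 0 <= d1, 0 <= d2,
      (\int[mu]_(x in quadrant)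
          (Num.min x.1 1 * Num.min x.2 1)%:E < +oo)%E &
      forall zeta z : C R, Cge0 zeta -> Cge0 z ->
        let g := fun x : R * R =>
          1 - cexp (- (zeta * toC x.1) - z * toC x.2) in
        cintegrable mu quadrant g /\
        kappa zeta z = toC k00 + toC d1 * zeta + toC d2 * z
                       + cintegral mu quadrant g].

Definition bernstein2 (kappa : C R -> C R -> C R) : Prop :=
  exists k00 d1 d2 mu, bernstein2_rep kappa k00 d1 d2 mu.

Definition mellin_transform (f : C R -> C R) : Prop :=
  exists (d : measure_display) (T : measurableType d) (P : probability T R)
         (Y : {RV P >-> R}),
    (forall t, 0 < Y t) /\
    forall z, Cgt0 z ->
      let g := fun t => cexp ((z - 1) * toC (ln (Y t))) in
      cintegrable P setT g /\ f z = cintegral P setT g.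

(* These four conditions tie down W zeta z for Re zeta > 0 and for zeta = 0.
   They do not for zeta on the punctured imaginary axis, where holomorphy and
   the Mellin condition say nothing: there W zeta may be multiplied by any
   1-periodic function equal to 1 at 1. *)
Definition bernstein_gamma2 (kappa W : C R -> C R -> C R) : Prop :=
  [/\ forall zeta z, Cge0 zeta -> Cgt0 z ->
        W zeta (z + 1) = kappa zeta z * W zeta z,
      forall zeta, Cge0 zeta -> W zeta 1 = 1,
      forall zeta z, Cgt0 zeta -> Cgt0 z ->
        differentiable (fun p : C R * C R => W p.1 p.2) (zeta, z) &
      forall q : R, 0 <= q -> mellin_transform (W (toC q))].

Definition L_ (kappa : C R -> C R -> C R) (zeta z : C R) : C R :=
  z * cintegral (@lebesgue_measure R) `[0, 1]
        (fun v => log0 (kappa zeta (1 + z * toC v))).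

Definition Psaw (u : R) : R :=
  (u - (Num.floor u)%:~R) * (1 - (u - (Num.floor u)%:~R)).

Definition E_ (kappa : C R -> C R -> C R) (zeta z : C R) : C R :=
  2^-1 * cintegral (@lebesgue_measure R) `[1, +oo[
    (fun u => toC (Psaw u) *
       rderive2 (fun v => log0 (kappa zeta (toC v + z) / kappa zeta (toC v))) u).

Definition T_ (kappa : C R -> C R -> C R) (zeta : C R) : C R :=
  2^-1 * cintegral (@lebesgue_measure R) `[1, +oo[
    (fun u => toC (Psaw u) *
       ((derive1 (kappa zeta) (toC u) / kappa zeta (toC u)) ^+ 2
        - derive1n 2 (kappa zeta) (toC u) / kappa zeta (toC u))).

End BernsteinGamma.

(* Main.v *)
(* Write l = log_0 kappa(zeta, .).  Since 1 - e^-y >= y e^-y and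
   4 (1 - e^-y) >= y^2 e^-y, one has |l'(w)| <= 1 / Re w and
   |l''(w)| <= 5 / (Re w)^2, whence the bound on E and its limit as Re z -> +oo.

   Integrating by parts on each [k, k+1] against the sawtooth P gives Stirling's
   formula: the right-hand side of the representation is cexp (S_n + O(1/n)),
   with S_n = - l(z) + sum_(1 <= j <= n+1) (l(j) - l(j + z)) + z l(n+2) and an
   error that is uniform in zeta.

   - For real zeta = q >= 0, cexp S_n -> W(q, z): tilting the law of Y by Y^n
     concentrates Y around its tilted mean kappa(q, n+1).
   - For Re zeta > 0, W(zeta, z) cexp (- S_n) - 1 is holomorphic in zeta, locally
     bounded, and tends to 0 uniformly on the positive half-line; a two-constants
     argument, resting on Goursat's theorem and the maximum principle, propagates
     this to the half-plane.
   - On the imaginary axis the formula follows by continuity.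

   If kappa(0, 1) = 0 then kappa does not depend on z, so E = T = 0 and no W
   exists. *)

Require Import Defs.
From HB Require Import structures.
From mathcomp Require Import all_boot all_order all_algebra.
From mathcomp Require Import all_classical all_reals all_analysis.
From mathcomp Require Import measurable_realfun ring lra.

Set Implicit Arguments.
Unset Strict Implicit.
Unset Printing Implicit Defensive.

Import Order.TTheory GRing.Theory Num.Theory.
Import numFieldNormedType.Exports.

Local Open Scope ring_scope.
Local Open Scope classical_set_scope.

Local Notation Re := complex.Re.
Local Notation Im := complex.Im.

(** * Complex exponential and logarithm *)

(** The main obstacle is the dependence on [zeta]. Neither L nor E is shown to be holomorphic, or
    even continuous, in [zeta]; only the finite sums S_n are differentiated in it, and all
    information on the limit passes through the Stirling error, whose bound depends on z and n
    alone. The same uniformity supplies the domination: W cexp (- S_n) and W cexp (- S_0) differ by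
    the exponential of a bounded quantity, so a single holomorphic function dominates the whole
    sequence, and a quantitative two-constants estimate takes the place of a normal-family argument.

    E, T and part of the Stirling error are built from one object, the tail (1/2) int_a^oo P(u)
    l''(u + z) du. With a = 1, E is the tail at z minus the tail at 0, and T is minus the tail at 0.
    Hence E - T is the tail at z, of modulus at most 1 / (1 + Re z); this explains both the constant
    2 and a limit that is uniform in Im z.

    Derivatives are mostly obtained from quadratic remainder bounds, so that differentiation under
    an integral sign only needs an integrable majorant of the second derivative. *)

Section ComplexBasics.
Context {R : realType}.
Implicit Types (z w : C R) (x y : R).

Lemma eq_ReIm z w : Re z = Re w -> Im z = Im w -> z = w.
Proof. by case: z w => a b [c d] /= -> ->. Qed.

Lemma cReD z w : Re (z + w) = Re z + Re w. Proof. by case: z w => a b [c d]. Qed.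
Lemma cImD z w : Im (z + w) = Im z + Im w. Proof. by case: z w => a b [c d]. Qed.
Lemma cReN z : Re (- z) = - Re z. Proof. by case: z. Qed.
Lemma cImN z : Im (- z) = - Im z. Proof. by case: z. Qed.
Lemma cReB z w : Re (z - w) = Re z - Re w. Proof. by rewrite cReD cReN. Qed.
Lemma cImB z w : Im (z - w) = Im z - Im w. Proof. by rewrite cImD cImN. Qed.
Lemma cReM z w : Re (z * w) = Re z * Re w - Im z * Im w.
Proof. by case: z w => a b [c d]. Qed.
Lemma cImM z w : Im (z * w) = Re z * Im w + Im z * Re w.
Proof. by case: z w => a b [c d]. Qed.
Lemma cRe1 : Re (1 : C R) = 1. Proof. by []. Qed.
Lemma cIm1 : Im (1 : C R) = 0. Proof. by []. Qed.
Lemma cRe0 : Re (0 : C R) = 0. Proof. by []. Qed.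
Lemma cIm0 : Im (0 : C R) = 0. Proof. by []. Qed.
Lemma cReC x : Re (toC x) = x. Proof. by []. Qed.
Lemma cImC x : Im (toC x) = 0. Proof. by []. Qed.

Definition cReIm := (cReB, cImB, cReD, cImD, cReN, cImN, cReM, cImM, cRe1, cIm1, cRe0, cIm0, cReC, cImC).

Lemma toCD x y : toC (x + y) = toC x + toC y.
Proof. by apply: eq_ReIm; rewrite !cReIm ?addr0. Qed.
Lemma toCN x : toC (- x) = - toC x.
Proof. by apply: eq_ReIm; rewrite !cReIm ?oppr0. Qed.
Lemma toCB x y : toC (x - y) = toC x - toC y.
Proof. by rewrite toCD toCN. Qed.
Lemma toCM x y : toC (x * y) = toC x * toC y.
Proof. by apply: eq_ReIm; rewrite !cReIm; ring. Qed.
Lemma toC0 : toC (0 : R) = 0. Proof. by []. Qed.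
Lemma toC1 : toC (1 : R) = 1. Proof. by []. Qed.
Lemma toC_nat n : toC (n%:R : R) = n%:R.
Proof. by elim: n => // n IH; rewrite -!natr1 toCD IH toC1. Qed.
Lemma toCV x : toC (x^-1) = (toC x)^-1.
Proof.
have [->|x0] := eqVneq x 0; first by rewrite invr0 toC0 invr0.
apply: (@mulfI _ (toC x)).
  by apply/eqP => -[]; apply/eqP.
rewrite -toCM divff // divff //.
by apply/eqP => -[]; apply/eqP.
Qed.
Lemma Re_toCM x z : Re (toC x * z) = x * Re z.
Proof. by rewrite !cReIm mul0r subr0. Qed.
Lemma Im_toCM x z : Im (toC x * z) = x * Im z.
Proof. by rewrite !cReIm mul0r addr0. Qed.

Lemma normCE z : `|z| = toC (cmod z).
Proof. by rewrite /cmod (normc_def z). Qed.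
Lemma cmodE z : cmod z = Num.sqrt (Re z ^+ 2 + Im z ^+ 2).
Proof. by rewrite /cmod (normc_def z). Qed.
Lemma sqr_cmod z : cmod z ^+ 2 = Re z ^+ 2 + Im z ^+ 2.
Proof. by rewrite cmodE sqr_sqrtr // addr_ge0 // sqr_ge0. Qed.
Lemma cmod_ge0 z : 0 <= cmod z. Proof. by rewrite cmodE sqrtr_ge0. Qed.
Lemma ler_toC x y : (toC x <= toC y) = (x <= y). Proof. exact: lecR. Qed.
Lemma ltr_toC x y : (toC x < toC y) = (x < y). Proof. exact: ltcR. Qed.
Lemma cmodM z w : cmod (z * w) = cmod z * cmod w.
Proof. by apply: (@complexI R); rewrite -[LHS]normCE normrM !normCE -toCM. Qed.
Lemma cmodD z w : cmod (z + w) <= cmod z + cmod w.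
Proof. by rewrite -ler_toC toCD -!normCE ler_normD. Qed.
Lemma cmodN z : cmod (- z) = cmod z.
Proof. by rewrite !cmodE !cReIm !sqrrN. Qed.
Lemma cmodB z w : cmod (z - w) <= cmod z + cmod w.
Proof. by rewrite -(cmodN w) cmodD. Qed.
Lemma cmodBC z w : cmod (z - w) = cmod (w - z).
Proof. by rewrite -cmodN opprB. Qed.
Lemma cmodC x : cmod (toC x) = `|x|.
Proof. by rewrite cmodE !cReIm expr0n addr0 sqrtr_sqr. Qed.
Lemma cmod0 : cmod (0 : C R) = 0. Proof. by rewrite -toC0 cmodC normr0. Qed.
Lemma cmod1 : cmod (1 : C R) = 1. Proof. by rewrite -toC1 cmodC normr1. Qed.
Lemma cmodV z : cmod z^-1 = (cmod z)^-1.
Proof. by apply: (@complexI R); rewrite -[LHS]normCE normfV normCE -toCV. Qed.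
Lemma cmod_eq0 z : (cmod z == 0) = (z == 0).
Proof.
apply/eqP/eqP => [h|->]; last exact: cmod0.
by apply/eqP; rewrite -normr_eq0 normCE h.
Qed.
Lemma cmod_gt0 z : (0 < cmod z) = (z != 0).
Proof. by rewrite lt_def cmod_ge0 cmod_eq0 andbT. Qed.
Lemma normRe_le z : `|Re z| <= cmod z.
Proof. by rewrite cmodE -sqrtr_sqr ler_wsqrtr // lerDl sqr_ge0. Qed.
Lemma normIm_le z : `|Im z| <= cmod z.
Proof. by rewrite cmodE -sqrtr_sqr ler_wsqrtr // lerDr sqr_ge0. Qed.
Lemma Re_le_cmod z : Re z <= cmod z.
Proof. exact: le_trans (ler_norm _) (normRe_le z). Qed.
Lemma cmod_le_ReIm z : cmod z <= `|Re z| + `|Im z|.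
Proof.
rewrite -(@ler_pXn2r _ 2) ?nnegrE ?cmod_ge0 ?addr_ge0 // sqr_cmod sqrrD.
by rewrite !real_normK ?num_real // addrAC lerDl mulrn_wge0 // mulr_ge0.
Qed.

Lemma cexpD z w : cexp (z + w) = cexp z * cexp w.
Proof.
by apply: eq_ReIm; rewrite ?cReM ?cImM /cexp cReD cImD expRD cosD sinD /=; ring.
Qed.
Lemma cexp0 : cexp (0 : C R) = 1.
Proof. by apply: eq_ReIm; rewrite /cexp /= expR0 ?cos0 ?sin0; ring. Qed.
Lemma cmod_cexp z : cmod (cexp z) = expR (Re z).
Proof.
rewrite cmodE /cexp /= !exprMn -mulrDr cos2Dsin2 mulr1 sqrtr_sqr.
by rewrite ger0_norm // expR_ge0.
Qed.
Lemma cexp_neq0 z : cexp z != 0.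
Proof. by rewrite -cmod_gt0 cmod_cexp expR_gt0. Qed.
Lemma cexpN z : cexp (- z) = (cexp z)^-1.
Proof.
apply: (mulfI (cexp_neq0 z)).
by rewrite -cexpD subrr cexp0 divff // cexp_neq0.
Qed.
Lemma cexpC x : cexp (toC x) = toC (expR x).
Proof. by apply: eq_ReIm; rewrite /cexp /= ?cos0 ?sin0 ?mulr1 ?mulr0. Qed.
Lemma Re_div_cmod_bd z : z != 0 -> -1 <= Re z / cmod z <= 1.
Proof.
rewrite -cmod_gt0 => z0; have := normRe_le z.
by rewrite ler_norml ler_pdivlMr // ler_pdivrMr // mulN1r mul1r.
Qed.

Lemma log0K z : z != 0 -> cexp (log0 z) = z.
Proof.
move=> z0; have m0 : 0 < cmod z by rewrite cmod_gt0.
have hb := Re_div_cmod_bd z0.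
have hc : cos (Arg0 z) = Re z / cmod z.
  by rewrite /Arg0; case: ifP => _; rewrite ?cosN acosK.
(* The identity sin (acos x) = sqrt (1 - x^2) only yields |Im z| / |z|; the case split in [Arg0]
   restores the sign. *)
have hs : sin (Arg0 z) = Im z / cmod z.
  have e1 : Num.sqrt (1 - (Re z / cmod z) ^+ 2) = `|Im z| / cmod z.
    rewrite -[RHS]ger0_norm ?divr_ge0 ?cmod_ge0 ?normr_ge0 // -[RHS]sqrtr_sqr; congr Num.sqrt.
    rewrite !expr_div_n sqr_cmod real_normK ?num_real //.
    have : Re z ^+ 2 + Im z ^+ 2 != 0 by rewrite -sqr_cmod expf_neq0 ?gt_eqF.
    by move=> ?; field.
  rewrite /Arg0; case: ifPn => h; rewrite ?sinN sin_acos // e1.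
    by rewrite ger0_norm.
  by rewrite ltr0_norm ?ltNge // mulNr opprK.
apply: eq_ReIm; rewrite /cexp /log0 /= lnK ?posrE // ?hc ?hs mulrCA divff ?mulr1 //.
all: by rewrite gt_eqF.
Qed.

Lemma Arg0_Re_gt0 z : 0 < Re z -> `|Arg0 z| < pi / 2.
Proof.
move=> h; have z0 : z != 0 by apply/eqP => z0; move: h; rewrite z0 ltxx.
have m0 : 0 < cmod z by rewrite cmod_gt0.
have hb := Re_div_cmod_bd z0.
have -> : `|Arg0 z| = acos (Re z / cmod z).
  by rewrite /Arg0; case: ifP; rewrite ?normrN ger0_norm ?acos_ge0.
rewrite ltNge; apply/negP; rewrite le_eqVlt => /orP[/eqP hp|].
  by have := acosK hb; rewrite -hp cos_pihalf => /esym/eqP; rewrite gt_eqF ?divr_gt0.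
rewrite -ltr_cos ?in_itv /= ?acos_ge0 ?acos_lepi ?divr_ge0 ?pi_ge0 //=.
  by rewrite cos_pihalf acosK // ltNge ltW // divr_gt0.
by rewrite ler_pdivrMr // ler_peMr ?pi_ge0 // ler1n.
Qed.

Lemma cexp_inj z w : `|Im z - Im w| < 2 * pi -> cexp z = cexp w -> z = w.
Proof.
move=> hzw e.
have eR : Re z = Re w.
  by apply: expR_inj; rewrite -!cmod_cexp e.
have : cexp (z - w) = 1 by rewrite cexpD cexpN e divff // cexp_neq0.
move=> /(congr1 (@complex.Re _)); rewrite /cexp /= !cReIm eR subrr expR0 mul1r.
set t := Im z - Im w => hc.
suff t0 : t = 0 by apply: eq_ReIm => //; apply/eqP; rewrite -subr_eq0 -/t t0.
move: hzw; rewrite -/t => hzw.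
have ct : cos `|t| = 1.
  by have [h|h] := leP 0 t; rewrite ?(ger0_norm h) // (ltr0_norm h) cosN.
have s2 : sin (`|t| / 2) = 0.
  have : cos (`|t| / 2 + `|t| / 2) = 1 by rewrite -splitr.
  rewrite cosD -!expr2 => h1; have h2 := cos2Dsin2 (`|t| / 2).
  apply/eqP; rewrite -sqrf_eq0; apply/eqP; clear e; lra.
apply/eqP/negP => /negP t0.
have : 0 < sin (`|t| / 2).
  apply: sin_gt0_pi; rewrite divr_gt0 ?normr_gt0 //=.
  by rewrite ltr_pdivrMr // mulrC.
by rewrite s2 ltxx.
Qed.

Lemma log0_cexp z : `|Im z| < pi / 2 -> log0 (cexp z) = z.
Proof.
move=> h; have e0 := cexp_neq0 z.
have hRe : 0 < Re (cexp z).
  rewrite /cexp /= mulr_gt0 ?expR_gt0 // cos_gt0_pihalf //.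
  by move: h; rewrite ltr_norml.
apply: cexp_inj; last by rewrite log0K.
apply: le_lt_trans (ler_normB _ _) _.
have := Arg0_Re_gt0 hRe; have := @pi_gt0 R; move: h.
rewrite /log0 /=; set a := `|_|; set b := `|_|; lra.
Qed.

Lemma neq0_Re_gt0 z : 0 < Re z -> z != 0.
Proof. by move=> h; apply/eqP => z0; move: h; rewrite z0 ltxx. Qed.

(** Both sides have the same exponential, and their imaginary parts differ by less than 2 pi: the
    argument of the quotient is at most pi in modulus, each of the two others is below pi / 2. *)
Lemma log0_div z w : 0 < Re z -> 0 < Re w -> log0 (z / w) = log0 z - log0 w.
Proof.
move=> hz hw; have z0 := neq0_Re_gt0 hz; have w0 := neq0_Re_gt0 hw.
have az := Arg0_Re_gt0 hz; have aw := Arg0_Re_gt0 hw.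
have q0 : z / w != 0 by rewrite mulf_neq0 // invr_neq0.
apply: cexp_inj; last by rewrite cexpD cexpN !log0K.
have hA : `|Arg0 (z / w)| <= pi.
  have hb := Re_div_cmod_bd q0.
  rewrite /Arg0; case: ifP => _; rewrite ?normrN ger0_norm ?acos_ge0 //;
    exact: acos_lepi.
move: az aw hA; rewrite cImB /log0 /=.
rewrite !ltr_norml ler_norml => /andP[a1 a2] /andP[a3 a4] /andP[a5 a6].
apply/andP; split; lra.
Qed.

End ComplexBasics.

(** * Differentiation over the complex numbers and along real curves *)

Lemma diff_quotE (K : numFieldType) (f : K -> K) (x d h : K) : h != 0 ->
  `|d - h^-1 *: (f (h *: 1 + x) - f x)| * `|h| = `|f (x + h) - f x - h * d|.
Proof.
move=> h0; have -> : h^-1 *: (f (h *: 1 + x) - f x) = h^-1 * (f (x + h) - f x).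
  by rewrite (_ : h *: 1 = h) ?(addrC h) //; exact: mulr1.
by rewrite -normrM mulrBl mulrAC mulVf // mul1r mulrC distrC.
Qed.

(** A quotient-free form, valid at h = 0 as well, which turns the later differentiation rules into
    estimates. *)
Lemma is_deriveP (K : numFieldType) (f : K -> K) (x d : K) :
  is_derive x 1 f d <->
  forall e, 0 < e -> exists2 r, 0 < r & forall h, `|h| < r ->
    `|f (x + h) - f x - h * d| <= e * `|h|.
Proof.
split=> [[df dd] e e0|H].
  have := df; rewrite /derivable => /cvg_ex[l hl].
  have ld : l = d by rewrite -dd /derive; apply/esym/cvg_lim.
  move: hl; rewrite ld => /cvgrPdist_le/(_ _ e0).
  rewrite near_withinE /dnbhs.
  move=> /nbhs_normP[r r0 hr].
  exists r => // h hh.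
  have [->|h0] := eqVneq h 0; first by rewrite addr0 mul0r subrr subr0 !normr0 mulr0.
  rewrite -(diff_quotE f x d h0) ler_pM2r ?normr_gt0 //.
  by apply: hr => //=; rewrite sub0r normrN.
have hc : (fun h => h^-1 *: (f (h *: 1 + x) - f x)) @ 0^' --> d.
  apply/cvgrPdist_le => e e0; have [r r0 hr] := H e e0.
  rewrite near_withinE; apply/nbhs_normP; exists r => //= h.
  rewrite /= sub0r normrN => hh h0; have := hr h hh.
  by rewrite -(diff_quotE f x d h0) ler_pM2r ?normr_gt0.
by apply: DeriveDef; [apply: cvgP hc | apply: cvg_lim hc].
Qed.

Section Calculus.
Context {R : realType}.
Implicit Types (z w c d : C R) (x y : R).

(* [is_derive] is a class; this alias keeps its instances from being searched. *)
Definition is_cderive (f : C R -> C R) (z d : C R) := is_derive z 1 f d.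

(** Positive elements of [R[i]] are real, so tolerance and radius can be taken in [R] and the norm
    replaced by the real modulus [cmod]. *)
Lemma is_cderiveP (f : C R -> C R) z d :
  is_cderive f z d <->
  forall e : R, 0 < e -> exists2 r : R, 0 < r & forall h, cmod h < r ->
    cmod (f (z + h) - f z - h * d) <= e * cmod h.
Proof.
rewrite /is_cderive is_deriveP; split=> H e e0.
  have e0' : 0 < toC e by rewrite -toC0 ltr_toC.
  have [r r0 hr] := H _ e0'.
  have rr : r = toC (Re r) by apply/esym/RRe_real/gtr0_real.
  exists (Re r); first by move: r0; rewrite rr -toC0 ltr_toC.
  move=> h hh; have := hr h; rewrite {1}rr !normCE ltr_toC => /(_ hh).
  by rewrite -toCM ler_toC.
have ee : e = toC (Re e) by apply/esym/RRe_real/gtr0_real.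
have [] := H (Re e); first by move: e0; rewrite ee -toC0 ltr_toC.
move=> r r0 hr; exists (toC r); first by rewrite -toC0 ltr_toC.
by move=> h; rewrite !normCE ltr_toC => /hr; rewrite ee -toCM ler_toC.
Qed.

Lemma is_cderive_comp (f g : C R -> C R) z df dg :
  is_cderive g (f z) dg -> is_cderive f z df ->
  is_cderive (fun t => g (f t)) z (dg * df).
Proof.
move=> /is_cderiveP Hg /is_cderiveP Hf; apply/is_cderiveP => e e0.
have c0 : 0 < 1 + cmod df by rewrite ltr_pwDl ?cmod_ge0.
have cg0 : 0 < 1 + cmod dg by rewrite ltr_pwDl ?cmod_ge0.
(* Each half of e is divided by the factor its remainder picks up: the Lipschitz constant 1 + |df|
   of the inner function for [e1], the outer slope for [e2]. *)
pose e1 := e / 2 / (1 + cmod df).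
have e10 : 0 < e1 by rewrite !divr_gt0.
pose e2 := e / 2 / (1 + cmod dg).
have e20 : 0 < e2 by rewrite !divr_gt0.
have [r1 r10 h1] := Hg _ e10.
have [r2 r20 h2] := Hf _ e20.
have [r3 r30 h3] := Hf _ ltr01.
exists (Num.min (Num.min r2 r3) (r1 / (1 + cmod df))).
  by rewrite !lt_min r20 r30 divr_gt0.
move=> h; rewrite !lt_min => /andP[/andP[hr2 hr3] hr1].
set k := f (z + h) - f z.
have kle : cmod k <= (1 + cmod df) * cmod h.
  have := h3 _ hr3; rewrite -/k mul1r => h4.
  rewrite -(subrK (h * df) k) (le_trans (cmodD _ _)) //.
  by rewrite mulrDl mul1r lerD // cmodM mulrC.
have klt : cmod k < r1.
  apply: le_lt_trans kle _.
  by rewrite mulrC -ltr_pdivlMr.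
have -> : g (f (z + h)) - g (f z) - h * (dg * df) =
   (g (f z + k) - g (f z) - k * dg) + dg * (k - h * df).
  by rewrite /k [f z + _]addrC subrK; ring.
apply: le_trans (cmodD _ _) _.
have -> : e = e1 * (1 + cmod df) + (1 + cmod dg) * e2.
  by rewrite /e1 /e2 divfK ?gt_eqF // [X in _ + X]mulrC divfK ?gt_eqF // -splitr.
rewrite [X in _ <= X]mulrDl lerD //.
  apply: le_trans (h1 _ klt) _.
  by rewrite -mulrA ler_pM2l.
rewrite cmodM -mulrA ler_pM ?cmod_ge0 //; first by rewrite lerDr.
exact: h2.
Qed.

(** The derivatives of exp, log and parameter integrals are all obtained in this way. *)
Lemma is_cderive_quad (f : C R -> C R) z d (K r : R) : 0 < r ->
  (forall h, cmod h < r -> cmod (f (z + h) - f z - h * d) <= K * cmod h ^+ 2) ->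
  is_cderive f z d.
Proof.
move=> r0 H; apply/is_cderiveP => e e0.
have K0 : 0 < `|K| + 1 by rewrite ltr_wpDl.
exists (Num.min r (e / (`|K| + 1))); first by rewrite lt_min r0 divr_gt0.
move=> h; rewrite lt_min => /andP[h1 h2]; apply: le_trans (H h h1) _.
rewrite expr2 mulrA ler_wpM2r ?cmod_ge0 //.
apply: (@le_trans _ _ ((`|K| + 1) * cmod h)).
  by rewrite ler_wpM2r ?cmod_ge0 // (le_trans (ler_norm _)) // lerDl.
by rewrite mulrC -ler_pdivlMr // ltW.
Qed.

(** Componentwise, so that the real mean value theorem and the fundamental theorem of calculus apply
    to each part. *)
Definition is_rderive (f : R -> C R) (t : R) (d : C R) :=
  is_derive t 1 (fun x => Re (f x)) (Re d) /\ is_derive t 1 (fun x => Im (f x)) (Im d).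

Lemma is_rderiveP (f : R -> C R) t d :
  is_rderive f t d <->
  forall e : R, 0 < e -> exists2 r : R, 0 < r & forall h, `|h| < r ->
    cmod (f (t + h) - f t - toC h * d) <= e * `|h|.
Proof.
rewrite /is_rderive !is_deriveP; split=> [[H1 H2] e e0|H].
  have e20 : 0 < e / 2 by rewrite divr_gt0.
  have [r1 r10 h1] := H1 _ e20; have [r2 r20 h2] := H2 _ e20.
  exists (Num.min r1 r2) => [|h]; first by rewrite lt_min r10.
  rewrite lt_min => /andP[/h1{}h1 /h2{}h2].
  apply: le_trans (cmod_le_ReIm _) _; rewrite (splitr e) mulrDl.
  by rewrite !cReB !cImB Re_toCM Im_toCM lerD.
split=> e e0; have [r r0 hr] := H e e0; exists r => // h /hr; apply: le_trans.
  by have := normRe_le (f (t + h) - f t - toC h * d); rewrite !cReB Re_toCM.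
by have := normIm_le (f (t + h) - f t - toC h * d); rewrite !cImB Im_toCM.
Qed.

Lemma is_rderive_line (f : C R -> C R) (w0 c d : C R) t :
  is_cderive f (w0 + toC t * c) d ->
  is_rderive (fun x => f (w0 + toC x * c)) t (d * c).
Proof.
move=> /is_cderiveP H; apply/is_rderiveP => e e0.
have c0 : 0 < cmod c + 1 by rewrite ltr_wpDl ?cmod_ge0.
have [r r0 hr] := H (e / (cmod c + 1)) (divr_gt0 e0 c0).
exists (r / (cmod c + 1)) => [|h hh]; first exact: divr_gt0.
have kle : cmod (toC h * c) <= (cmod c + 1) * `|h|.
  by rewrite cmodM cmodC mulrC ler_wpM2r // lerDl.
have := hr (toC h * c).
rewrite toCD mulrDl addrA (_ : toC h * c * d = toC h * (d * c)); last by ring.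
move=> H1; apply: le_trans (H1 _) _.
  by apply: le_lt_trans kle _; rewrite mulrC -ltr_pdivlMr.
apply: le_trans (ler_wpM2l _ kle) _; first by rewrite divr_ge0 // ltW.
by rewrite mulrA divfK // gt_eqF.
Qed.

Lemma is_rderive_toC (f : C R -> C R) (d : C R) t :
  is_cderive f (toC t) d -> is_rderive (fun x => f (toC x)) t d.
Proof.
move=> H; rewrite -[d]mulr1.
have := @is_rderive_line f 0 1 d t; rewrite mulr1 add0r => /(_ H).
by under eq_fun do rewrite mulr1 add0r.
Qed.

(** With c = f b - f a, the real mean value theorem is applied to t |-> Re (conj c * f t), whose
    increment is |c|^2. Treating the two components separately would lose a constant factor. *)
Lemma mean_value_ineq (f df : R -> C R) (a b K : R) : a <= b ->
  (forall t, a <= t <= b -> is_rderive f t (df t)) ->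
  (forall t, a <= t <= b -> cmod (df t) <= K) ->
  cmod (f b - f a) <= K * (b - a).
Proof.
move=> ab H HK; pose c := f b - f a.
have [ab'|] := ltP a b; last first.
  move=> ba; have -> : b = a by apply/le_anti; rewrite ab ba.
  by rewrite !subrr cmod0 mulr0.
pose phi t := Re c * Re (f t) + Im c * Im (f t).
pose dphi t := Re c * Re (df t) + Im c * Im (df t).
have dphiP t : a <= t <= b -> is_derive t 1 phi (dphi t).
  move=> /H[h1 h2]; rewrite /phi /dphi.
  apply: is_deriveD.
have [] := @MVT_segment R phi dphi a b ab.
- by move=> t; rewrite in_itv /= => /andP[h1 h2]; apply: dphiP; rewrite !ltW.
- apply: derivable_within_continuous => t; rewrite in_itv /= => h.
  by have [] := dphiP _ h.
move=> t; rewrite in_itv /= => tab e.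
have [c0|c0] := eqVneq (cmod c) 0.
  by rewrite -/c c0 mulr_ge0 ?subr_ge0 // (le_trans (cmod_ge0 (df t))) ?HK.
have cp : 0 < cmod c by rewrite lt_def c0 cmod_ge0.
rewrite -(ler_pM2l cp) -expr2 -/c.
have -> : cmod c ^+ 2 = phi b - phi a.
  by rewrite sqr_cmod /phi /c !cReIm; ring.
rewrite e mulrA ler_wpM2r ?subr_ge0 //.
apply: (@le_trans _ _ (cmod c * cmod (df t))); last by rewrite ler_wpM2l ?HK // ltW.
have -> : cmod c = cmod (conjc c : C R) by rewrite !cmodE; case: (c) => ? ? /=; rewrite sqrrN.
rewrite -cmodM; apply: le_trans (Re_le_cmod _).
by rewrite cReM /dphi; case: (c) => x y /=; rewrite mulNr opprK.
Qed.

Lemma is_cderive_eq (f : C R -> C R) z d d' :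
  is_cderive f z d -> d = d' -> is_cderive f z d'.
Proof. by move=> H <-. Qed.

Lemma is_cderiveD (f g : C R -> C R) z df dg :
  is_cderive f z df -> is_cderive g z dg -> is_cderive (fun t => f t + g t) z (df + dg).
Proof. by rewrite /is_cderive => hf hg; apply: is_deriveD. Qed.
Lemma is_cderiveB (f g : C R -> C R) z df dg :
  is_cderive f z df -> is_cderive g z dg -> is_cderive (fun t => f t - g t) z (df - dg).
Proof. by rewrite /is_cderive => hf hg; apply: is_deriveB. Qed.
Lemma is_cderiveN (f : C R -> C R) z df :
  is_cderive f z df -> is_cderive (fun t => - f t) z (- df).
Proof. by rewrite /is_cderive => hf; apply: is_deriveN. Qed.
Lemma is_cderiveM (f g : C R -> C R) z df dg :
  is_cderive f z df -> is_cderive g z dg ->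
  is_cderive (fun t => f t * g t) z (df * g z + f z * dg).
Proof.
rewrite /is_cderive => hf hg; have H := is_deriveM hf hg.
apply: (@is_cderive_eq (fun t => f t * g t) z _ _ H).
by rewrite addrC /GRing.scale /= mulrC.
Qed.
Lemma is_cderiveV (f : C R -> C R) z df : f z != 0 ->
  is_cderive f z df -> is_cderive (fun t => (f t)^-1) z (- df / f z ^+ 2).
Proof.
move=> f0 hf; have df1 : derivable f z 1 by case: hf.
have e : 'D_1 f z = df by case: hf.
apply: DeriveDef; first exact: derivableV.
by rewrite (deriveV f0 df1) e /GRing.scale /= mulNr mulNr mulrC -exprVn.
Qed.
Lemma is_cderive_id z : is_cderive (fun t : C R => t) z 1.
Proof. exact: is_derive_id. Qed.
Lemma is_cderive_cst (c : C R) z : is_cderive (fun=> c) z 0.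
Proof. exact: is_derive_cst. Qed.
Lemma is_cderiveZ (f : C R -> C R) c z df :
  is_cderive f z df -> is_cderive (fun t => c * f t) z (c * df).
Proof.
move=> hf; have /is_cderive_eq := is_cderiveM (is_cderive_cst c z) hf; apply.
by rewrite mul0r add0r.
Qed.

Lemma cmod_seg (h : C R) (t : R) : 0 <= t <= 1 -> cmod (toC t * h) <= cmod h.
Proof.
move=> /andP[t0 t1]; rewrite cmodM cmodC ger0_norm //.
by rewrite ler_piMl ?cmod_ge0.
Qed.

Lemma cderive_bound (f df : C R -> C R) z (h : C R) (K : R) :
  (forall t : R, 0 <= t <= 1 -> is_cderive f (z + toC t * h) (df (z + toC t * h))) ->
  (forall t : R, 0 <= t <= 1 -> cmod (df (z + toC t * h)) <= K) ->
  cmod (f (z + h) - f z) <= K * cmod h.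
Proof.
move=> H HK.
have := @mean_value_ineq (fun t => f (z + toC t * h)) (fun t => df (z + toC t * h) * h)
   0 1 (K * cmod h) ler01.
rewrite toC0 toC1 mul0r mul1r addr0 subr0 mulr1; apply => t ht.
  exact/is_rderive_line/H.
by rewrite cmodM ler_wpM2r ?cmod_ge0 ?HK.
Qed.

(** The mean value inequality is used twice: for w |-> f w - w f1(z), whose derivative is f1 w - f1
    z, and for [f1] itself. The missing factor 1/2 is immaterial. *)
Lemma cderive_taylor (f f1 f2 : C R -> C R) z (h : C R) (K : R) :
  (forall t : R, 0 <= t <= 1 -> is_cderive f (z + toC t * h) (f1 (z + toC t * h))) ->
  (forall t : R, 0 <= t <= 1 -> is_cderive f1 (z + toC t * h) (f2 (z + toC t * h))) ->
  (forall t : R, 0 <= t <= 1 -> cmod (f2 (z + toC t * h)) <= K) ->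
  cmod (f (z + h) - f z - h * f1 z) <= K * cmod h ^+ 2.
Proof.
move=> H1 H2 HK.
have K0 : 0 <= K by apply: le_trans (HK 0 _); rewrite ?cmod_ge0 ?lexx ?ler01.
have := @cderive_bound (fun w => f w - w * f1 z) (fun w => f1 w - f1 z) z h (K * cmod h).
rewrite (_ : f (z + h) - _ - _ = f (z + h) - f z - h * f1 z); last by ring.
rewrite expr2 mulrA; apply => t ht.
  apply: is_cderiveB; first exact: H1.
  have := is_cderiveM (is_cderive_id (z + toC t * h)) (is_cderive_cst (f1 z) (z + toC t * h)).
  by move/is_cderive_eq; apply; rewrite mul1r mulr0 addr0.
have H : cmod (f1 (z + toC t * h) - f1 z) <= K * cmod (toC t * h); last first.
  by apply: (le_trans H); rewrite ler_wpM2l // cmod_seg.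
refine (@cderive_bound f1 f2 z (toC t * h) K _ _) => s hs.
- rewrite mulrA -toCM; apply: H2; move: hs ht => /andP[? ?] /andP[? ?].
  by rewrite mulr_ge0 //= mulr_ile1.
- rewrite mulrA -toCM; apply: HK; move: hs ht => /andP[? ?] /andP[? ?].
  by rewrite mulr_ge0 //= mulr_ile1.
Qed.

Lemma is_cderive_near (f g : C R -> C R) z d (r : R) : 0 < r ->
  (forall h, cmod h < r -> f (z + h) = g (z + h)) ->
  is_cderive g z d -> is_cderive f z d.
Proof.
move=> r0 fg /is_cderiveP H; apply/is_cderiveP => e e0.
have [s s0 hs] := H e e0; exists (Num.min r s) => [|h]; first by rewrite lt_min r0.
rewrite lt_min => /andP[h1 h2]; rewrite fg // -{2}[z]addr0 fg ?cmod0 // addr0.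
exact: hs.
Qed.

Lemma derivable_continuous (f : R -> R) (t : R) : derivable f t 1 -> {for t, continuous f}.
Proof. by move=> df; apply/differentiable_continuous/derivable1_diffP. Qed.

Lemma is_derive_affine (x a t : R) : is_derive t 1 (fun s => x + s * a) a.
Proof.
have H := is_deriveD (is_derive_cst x t 1) (is_deriveM (is_derive_id t 1) (is_derive_cst a t 1)).
apply: (is_derive_eq H).
by rewrite add0r scaler0 add0r /GRing.scale /= mulr1.
Qed.

Lemma is_derive_fcomp (f g : R -> R) (t a b : R) :
  is_derive (g t) 1 f a -> is_derive t 1 g b -> is_derive t 1 (fun s => f (g s)) (a * b).
Proof. by move=> hf hg; exact: is_derive1_comp. Qed.

Lemma is_derive_fmul (f g : R -> R) (t a b : R) :
  is_derive t 1 f a -> is_derive t 1 g b -> is_derive t 1 (fun s => f s * g s) (a * g t + f t * b).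
Proof.
move=> hf hg; apply: (is_derive_eq (is_deriveM hf hg)).
by rewrite addrC /GRing.scale /= mulrC.
Qed.

Lemma is_derive_fadd (f g : R -> R) (t a b : R) :
  is_derive t 1 f a -> is_derive t 1 g b -> is_derive t 1 (fun s => f s + g s) (a + b).
Proof. by move=> hf hg; exact: is_deriveD. Qed.

Lemma is_derive_finv (f : R -> R) (t a : R) : f t != 0 ->
  is_derive t 1 f a -> is_derive t 1 (fun s => (f s)^-1) (- a / f t ^+ 2).
Proof.
move=> f0 hf; have df1 : derivable f t 1 by case: hf.
have e : 'D_1 f t = a by case: hf.
apply: DeriveDef; first exact: derivableV.
by rewrite (deriveV f0 df1) e /GRing.scale /= mulNr mulNr mulrC -exprVn.
Qed.

Lemma is_derive_near (f g : R -> R) (t a r : R) : 0 < r ->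
  (forall h, `|h| < r -> f (t + h) = g (t + h)) ->
  is_derive t 1 g a -> is_derive t 1 f a.
Proof.
move=> r0 fg /is_deriveP H; apply/is_deriveP => e e0.
have [s s0 hs] := H e e0; exists (Num.min r s) => [|h]; first by rewrite lt_min r0.
rewrite lt_min => /andP[h1 h2]; rewrite fg // -{2}[t]addr0 fg ?normr0 // addr0.
exact: hs.
Qed.

Lemma is_rderiveB (f g : R -> C R) (t : R) (df dg : C R) :
  is_rderive f t df -> is_rderive g t dg -> is_rderive (fun s => f s - g s) t (df - dg).
Proof.
move=> [f1 f2] [g1 g2]; split.
  under eq_fun do rewrite cReB; rewrite cReB; exact: is_deriveB.
by under eq_fun do rewrite cImB; rewrite cImB; exact: is_deriveB.
Qed.

Lemma is_rderiveM (f g : R -> C R) (t : R) (df dg : C R) :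
  is_rderive f t df -> is_rderive g t dg ->
  is_rderive (fun s => f s * g s) t (df * g t + f t * dg).
Proof.
move=> [f1 f2] [g1 g2]; split.
  under eq_fun do rewrite cReM.
  have := is_deriveB (is_derive_fmul f1 g1) (is_derive_fmul f2 g2).
  move=> h; apply: (is_derive_eq h); rewrite cReD !cReM; ring.
under eq_fun do rewrite cImM.
have := is_deriveD (is_derive_fmul f1 g2) (is_derive_fmul f2 g1).
move=> h; apply: (is_derive_eq h); rewrite cImD !cImM; ring.
Qed.

Lemma is_rderive_cst (c : C R) (t : R) : is_rderive (fun=> c) t 0.
Proof. by split; exact: is_derive_cst. Qed.

Lemma is_rderiveZ (f : R -> C R) (c : C R) (t : R) (df : C R) :
  is_rderive f t df -> is_rderive (fun s => c * f s) t (c * df).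
Proof. by move/(is_rderiveM (is_rderive_cst c t)); rewrite mul0r add0r. Qed.

Lemma is_rderive_cexp (h : C R) (t : R) :
  is_rderive (fun x => cexp (toC x * h)) t (cexp (toC t * h) * h).
Proof.
have ea : is_derive t 1 (fun x => x * Re h) (Re h).
  by have := is_derive_affine 0 (Re h) t; under eq_fun do rewrite add0r.
have eb : is_derive t 1 (fun x => x * Im h) (Im h).
  by have := is_derive_affine 0 (Im h) t; under eq_fun do rewrite add0r.
have ee := is_derive_fcomp (is_derive_expR _) ea.
have ec := is_derive_fcomp (is_derive_cos _) eb.
have es := is_derive_fcomp (is_derive_sin _) eb.
split.
  rewrite (_ : (fun x => _) = (fun x => expR (x * Re h) * cos (x * Im h))); last first.
    by apply/funext => x; rewrite /cexp /= Re_toCM Im_toCM.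
  apply: (is_derive_eq (is_derive_fmul ee ec)).
  by rewrite cReM /cexp /= Re_toCM Im_toCM; ring.
rewrite (_ : (fun x => _) = (fun x => expR (x * Re h) * sin (x * Im h))); last first.
  by apply/funext => x; rewrite /cexp /= Re_toCM Im_toCM.
apply: (is_derive_eq (is_derive_fmul ee es)).
by rewrite cImM /cexp /= Re_toCM Im_toCM; ring.
Qed.

Lemma cexp_sub1_le (h : C R) : cmod (cexp h - 1) <= expR (cmod h) * cmod h.
Proof.
have := @mean_value_ineq (fun x => cexp (toC x * h)) (fun t => cexp (toC t * h) * h)
  0 1 (expR (cmod h) * cmod h) ler01.
rewrite toC0 toC1 mul0r mul1r cexp0 subr0 mulr1; apply => t ht.
  exact: is_rderive_cexp.
rewrite cmodM ler_wpM2r ?cmod_ge0 // cmod_cexp ler_expR.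
exact: le_trans (Re_le_cmod _) (cmod_seg h ht).
Qed.

Lemma cexp_sub1B_le (h : C R) : cmod (cexp h - 1 - h) <= expR (cmod h) * cmod h ^+ 2.
Proof.
have := @mean_value_ineq (fun x => cexp (toC x * h) - toC x * h)
  (fun t => cexp (toC t * h) * h - h) 0 1 (expR (cmod h) * cmod h ^+ 2) ler01.
rewrite toC0 toC1 !mul0r !mul1r cexp0 !subr0 mulr1.
rewrite (_ : cexp h - h - 1 = cexp h - 1 - h); last by rewrite addrAC.
apply => t ht.
  have [h1 h2] := is_rderive_cexp h t.
  split; under eq_fun do rewrite ?cReB ?cImB ?Re_toCM ?Im_toCM.
    rewrite cReB; apply: is_deriveB.
    by have := is_derive_affine 0 (Re h) t; under eq_fun do rewrite add0r.
  rewrite cImB; apply: is_deriveB.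
  by have := is_derive_affine 0 (Im h) t; under eq_fun do rewrite add0r.
rewrite (_ : _ * h - h = (cexp (toC t * h) - 1) * h); last by ring.
rewrite cmodM expr2 mulrA ler_wpM2r ?cmod_ge0 //.
apply: le_trans (cexp_sub1_le _) _.
by rewrite ler_pM ?expR_ge0 ?cmod_ge0 ?ler_expR ?cmod_seg.
Qed.

Lemma is_cderive_cexp z : is_cderive (@cexp R) z (cexp z).
Proof.
apply: (@is_cderive_quad _ _ _ (expR (Re z) * expR 1) 1) => // h h1.
rewrite cexpD (_ : _ - _ - _ = cexp z * (cexp h - 1 - h)); last by ring.
rewrite cmodM cmod_cexp -mulrA ler_wpM2l ?expR_ge0 //.
apply: le_trans (cexp_sub1B_le _) _.
by rewrite ler_wpM2r ?sqr_ge0 // ler_expR ltW.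
Qed.

(** On the right half-plane both components become smooth real functions, which can be
    differentiated directly, unlike the case split on the sign of Im z in [Arg0]. *)
Lemma log0_atan z : 0 < Re z ->
  log0 z = Complex (2^-1 * ln (Re z ^+ 2 + Im z ^+ 2)) (atan (Im z / Re z)) :> C R.
Proof.
move=> h; set w : C R := Complex _ _.
have z0 := neq0_Re_gt0 h; have m0 : 0 < cmod z by rewrite cmod_gt0.
suff e : z = cexp w.
  by rewrite [in LHS]e log0_cexp //= ltr_norml atan_gtNpi2 atan_ltpi2.
have e1 : 2^-1 * ln (Re z ^+ 2 + Im z ^+ 2) = ln (cmod z).
  by rewrite -sqr_cmod lnXn // -[ln _ *+ _]mulr_natl mulKf // pnatr_eq0.
have hc : cos (atan (Im z / Re z)) = Re z / cmod z.
  rewrite cos_atan -[RHS]invrK; congr (_^-1).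
  rewrite invf_div -[RHS]ger0_norm ?divr_ge0 ?cmod_ge0 ?(ltW h) // -[RHS]sqrtr_sqr.
  congr Num.sqrt; rewrite !expr_div_n sqr_cmod mulrDl divff //.
  by rewrite expf_neq0 // gt_eqF.
have hs : sin (atan (Im z / Re z)) = Im z / cmod z.
  have := atanK (Im z / Re z); rewrite /tan hc => /(canRL (mulfVK _)) ->.
    by rewrite mulrA divfK // gt_eqF.
  by rewrite mulf_neq0 ?invr_neq0 // gt_eqF.
apply: eq_ReIm; rewrite /cexp /w /= e1 lnK ?posrE // ?hc ?hs mulrCA divff ?mulr1 //.
all: by rewrite gt_eqF.
Qed.

(** On the disc |h| < Re z / 2 the segment from z to z + h stays in real part at least Re z / 2.
    There t |-> log (z + t h) has derivative h / (z + t h), and its difference from h / z is bounded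
    by |h|^2 / (|z| Re z / 2), a quadratic remainder. *)
Lemma is_cderive_log0 z : 0 < Re z -> is_cderive (@log0 R) z z^-1.
Proof.
move=> hz; have z0 := neq0_Re_gt0 hz; have m0 : 0 < cmod z by rewrite cmod_gt0.
have pos (h : C R) (t : R) : cmod h <= Re z / 2 -> 0 <= t <= 1 -> Re z / 2 <= Re (z + toC t * h).
  move=> hh ht; rewrite cReD; have := normRe_le (toC t * h).
  have := cmod_seg h ht; rewrite ler_norml => h1 /andP[h2 _]; lra.
have rd (h : C R) (t : R) : 0 < Re (z + toC t * h) ->
    is_rderive (fun x => log0 (z + toC x * h)) t (h / (z + toC t * h)).
  rewrite cReD Re_toCM => hp.
  have np : Re z + t * Re h != 0 by rewrite gt_eqF.
  have sp : (Re z + t * Re h) ^+ 2 + (Im z + t * Im h) ^+ 2 != 0.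
    by rewrite gt_eqF // ltr_wpDr ?sqr_ge0 // exprn_gt0.
  have hx := is_derive_affine (Re z) (Re h) t.
  have hy := is_derive_affine (Im z) (Im h) t.
  have [r r0 hr] : exists2 r : R, 0 < r & forall s : R, `|s| < r -> 0 < Re z + (t + s) * Re h.
    have c0 : 0 < `|Re h| + 1 by rewrite ltr_wpDl.
    exists ((Re z + t * Re h) / (`|Re h| + 1)); first by rewrite divr_gt0.
    move=> s; rewrite ltr_pdivlMr // => hs.
    rewrite mulrDl addrA -ltrBlDr sub0r.
    have : `|s * Re h| <= `|s| * (`|Re h| + 1) by rewrite normrM ler_wpM2l // lerDl.
    move=> h2; have := le_lt_trans h2 hs; rewrite ltr_norml => /andP[h3 _].
    by rewrite ltrNl.
  have e : h / (z + toC t * h) =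
    Complex ((Re h * (Re z + t * Re h) + Im h * (Im z + t * Im h)) /
             ((Re z + t * Re h) ^+ 2 + (Im z + t * Im h) ^+ 2))
            ((Im h * (Re z + t * Re h) - Re h * (Im z + t * Im h)) /
             ((Re z + t * Re h) ^+ 2 + (Im z + t * Im h) ^+ 2)) :> C R.
    apply: (@mulIf _ (z + toC t * h)).
      by apply: neq0_Re_gt0; rewrite cReD Re_toCM.
    rewrite divfK; last by apply: neq0_Re_gt0; rewrite cReD Re_toCM.
    by apply: eq_ReIm; rewrite ?cReM ?cImM !cReD !cImD !Re_toCM !Im_toCM /=; field.
  rewrite e; split.
    apply: (@is_derive_near _ (fun x => 2^-1 *
      ln ((Re z + x * Re h) * (Re z + x * Re h) + (Im z + x * Im h) * (Im z + x * Im h)))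
      _ _ _ r0).
      move=> s hs; rewrite log0_atan /= ?cReD ?cImD ?Re_toCM ?Im_toCM ?expr2 //.
      exact: hr.
    have hh := is_derive_fadd (is_derive_fmul hx hx) (is_derive_fmul hy hy).
    have hl := is_derive_fcomp (is_derive1_ln _) hh.
    have h2 := is_derive_fmul (is_derive_cst (2^-1 : R) t 1) (hl _).
    apply: (is_derive_eq (h2 _)).
      by rewrite lt_def -!expr2 sp addr_ge0 ?sqr_ge0.
    by rewrite /= -!expr2; field.
  apply: (@is_derive_near _ (fun x => atan ((Im z + x * Im h) * (Re z + x * Re h)^-1))
      _ _ _ r0).
    move=> s hs; rewrite log0_atan /= ?cReD ?cImD ?Re_toCM ?Im_toCM //.
    exact: hr.
  have hh := is_derive_fmul hy (@is_derive_finv (fun s => Re z + s * Re h) t _ np hx).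
  apply: (is_derive_eq (is_derive_fcomp (is_derive1_atan _) hh)).
  have sp' : 1 + ((Im z + t * Im h) / (Re z + t * Re h)) ^+ 2 != 0.
    by rewrite gt_eqF // ltr_pwDl // sqr_ge0.
  clear e hh hx hy hr; move: np sp sp' => /=.
  move: (Re z + t * Re h) (Im z + t * Im h) => X Y np sp sp'.
  by field; rewrite np sp.
have r0 : 0 < Re z / 2 by rewrite divr_gt0.
apply: (@is_cderive_quad _ _ _ ((cmod z)^-1 * (Re z / 2)^-1) (Re z / 2)) => // h h1.
have h1' := ltW h1.
have := @mean_value_ineq (fun x => log0 (z + toC x * h) - toC x * (h / z))
  (fun t => h / (z + toC t * h) - h / z) 0 1
  ((cmod z)^-1 * (Re z / 2)^-1 * cmod h ^+ 2) ler01.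
rewrite toC0 toC1 !mul0r !mul1r addr0 !subr0 mulr1.
rewrite addrAC; apply => t ht.
  have hp : 0 < Re (z + toC t * h) by apply: lt_le_trans r0 _; exact: pos.
  have [h2 h3] := rd h t hp.
  split; under eq_fun do rewrite ?cReB ?cImB ?Re_toCM ?Im_toCM.
    rewrite cReB; apply: is_deriveB.
    by have := is_derive_affine 0 (Re (h / z)) t; under eq_fun do rewrite add0r.
  rewrite cImB; apply: is_deriveB.
  by have := is_derive_affine 0 (Im (h / z)) t; under eq_fun do rewrite add0r.
have hp := pos h t h1' ht.
have hp' : 0 < Re (z + toC t * h) by exact: lt_le_trans hp.
have n0 := neq0_Re_gt0 hp'.
have -> : h / (z + toC t * h) - h / z = - (h * (toC t * h) / (z + toC t * h) / z).
  by field; rewrite z0 n0.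
have hk := cmod_seg h ht; move: hp n0 hk; set k := toC t * h; move: (k) => {}k hp n0 hk.
have -> : cmod (- (h * k / (z + k) / z)) =
    (cmod z)^-1 * ((cmod (z + k))^-1 * (cmod h * cmod k)).
  by rewrite cmodN !cmodM !cmodV; ring.
rewrite -mulrA ler_wpM2l ?invr_ge0 ?cmod_ge0 // ler_pM ?mulr_ge0 ?invr_ge0 ?cmod_ge0 //.
  by rewrite lef_pV2 ?posrE // ?cmod_gt0 // (le_trans hp) // Re_le_cmod.
by rewrite expr2 ler_wpM2l ?cmod_ge0.
Qed.

End Calculus.

(** * Complex-valued integrals *)

Section ComplexIntegration.
Context d (T : measurableType d) {R : realType} (mu : {measure set T -> \bar R}).
Variables (D : set T) (mD : measurable D).
Implicit Types (f g : T -> C R) (p q : T -> R).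

Definition cmeasurable f :=
  measurable_fun D (fun x => Re (f x)) /\ measurable_fun D (fun x => Im (f x)).

Lemma cmeasurableN f : cmeasurable f -> cmeasurable (fun x => - f x).
Proof.
move=> [f1 f2]; split; under eq_fun do rewrite ?cReN ?cImN;
  exact: measurable_funN.
Qed.
Lemma cmeasurableM f g : cmeasurable f -> cmeasurable g ->
  cmeasurable (fun x => f x * g x).
Proof.
move=> [f1 f2] [g1 g2]; split; under eq_fun do rewrite ?cReM ?cImM.
  by apply: measurable_funB; exact: measurable_funM.
by apply: measurable_funD; exact: measurable_funM.
Qed.
Lemma cmeasurable_cst c : cmeasurable (fun=> c).
Proof. by split; exact: measurable_cst. Qed.
Lemma cmeasurable_toC p : measurable_fun D p -> cmeasurable (fun x => toC (p x)).
Proof. by move=> mp; split => //; exact: measurable_cst. Qed.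
Lemma cmeasurable_cexp f : cmeasurable f -> cmeasurable (fun x => cexp (f x)).
Proof.
move=> [f1 f2]; split; apply: measurable_funM => //.
- exact: (measurableT_comp (@measurable_expR R)).
- exact: (measurableT_comp (continuous_measurable_fun (@continuous_cos R))).
- exact: (measurableT_comp (@measurable_expR R)).
- exact: (measurableT_comp (continuous_measurable_fun (@continuous_sin R))).
Qed.
Lemma measurable_cmod f : cmeasurable f -> measurable_fun D (fun x => cmod (f x)).
Proof.
move=> [f1 f2]; under eq_fun do rewrite cmodE.
apply: (measurableT_comp (continuous_measurable_fun (@sqrt_continuous R))).
by apply: measurable_funD; exact: measurable_funX.
Qed.
Lemma cintegrable_measurable f : cintegrable mu D f -> cmeasurable f.
Proof.
by move=> [/measurable_int/measurable_EFinP h1 /measurable_int/measurable_EFinP h2].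
Qed.

Lemma rintegrable_dom p q : measurable_fun D p -> mu.-integrable D (EFin \o q) ->
  (forall x, D x -> `|p x| <= q x) -> mu.-integrable D (EFin \o p).
Proof.
move=> mp iq pq; apply: le_integrable iq => //; first exact/measurable_EFinP.
by move=> x Dx /=; rewrite lee_fin (le_trans (pq _ Dx)) // ler_norm.
Qed.

Lemma rintegrableZ (k : R) p :
  mu.-integrable D (EFin \o p) -> mu.-integrable D (EFin \o (fun x => k * p x)).
Proof.
move=> ip; rewrite (_ : _ \o _ = (fun x => k%:E * (EFin \o p) x))%E.
  exact: integrableZl.
by apply/funext => x; rewrite /= EFinM.
Qed.

Lemma rintegrableD p q : mu.-integrable D (EFin \o p) -> mu.-integrable D (EFin \o q) ->
  mu.-integrable D (EFin \o (fun x => p x + q x)).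
Proof.
move=> ip iq; rewrite (_ : _ \o _ = (EFin \o p) \+ (EFin \o q))%E.
  exact: integrableD.
by apply/funext => x; rewrite /= EFinD.
Qed.

Lemma cintegrable_dom f q : cmeasurable f -> mu.-integrable D (EFin \o q) ->
  (forall x, D x -> cmod (f x) <= q x) -> cintegrable mu D f.
Proof.
move=> [f1 f2] iq fq; split; apply: rintegrable_dom iq _ => // x Dx.
  exact: le_trans (normRe_le _) (fq _ Dx).
exact: le_trans (normIm_le _) (fq _ Dx).
Qed.

Lemma integrable_cmod f : cintegrable mu D f ->
  mu.-integrable D (EFin \o (fun x => cmod (f x))).
Proof.
move=> fi; have mf := cintegrable_measurable fi; case: fi => f1 f2.
have i12 : mu.-integrable D (EFin \o (fun x => `|Re (f x)| + `|Im (f x)|)).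
  by apply: rintegrableD; exact: integrable_norm.
apply: rintegrable_dom i12 _ => [|x Dx]; first exact: measurable_cmod.
by rewrite ger0_norm ?cmod_ge0 // cmod_le_ReIm.
Qed.

Lemma eq_cintegral f g : (forall x, D x -> f x = g x) ->
  cintegral mu D f = cintegral mu D g.
Proof.
move=> fg; rewrite /cintegral; congr Complex; apply: eq_Rintegral => x;
  by rewrite inE => /fg ->.
Qed.
Lemma eq_cintegrable f g : (forall x, D x -> f x = g x) ->
  cintegrable mu D f -> cintegrable mu D g.
Proof.
move=> fg [f1 f2]; split; [apply: eq_integrable f1 => // x|apply: eq_integrable f2 => // x];
  by rewrite inE => /fg /= ->.
Qed.

Lemma cintegrableD f g : cintegrable mu D f -> cintegrable mu D g ->
  cintegrable mu D (fun x => f x + g x).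
Proof.
move=> [f1 f2] [g1 g2]; split; under eq_fun do rewrite ?cReD ?cImD; exact: rintegrableD.
Qed.

Lemma cintegrableZ c f : cintegrable mu D f -> cintegrable mu D (fun x => c * f x).
Proof.
move=> fi; have mf := cintegrable_measurable fi.
have i1 : mu.-integrable D (EFin \o (fun x => cmod c * cmod (f x))).
  by apply: rintegrableZ; exact: integrable_cmod.
apply: cintegrable_dom i1 _; first exact: cmeasurableM (cmeasurable_cst c) mf.
by move=> x Dx; rewrite cmodM.
Qed.

Lemma cintegrableN f : cintegrable mu D f -> cintegrable mu D (fun x => - f x).
Proof.
by move/(cintegrableZ (-1)); apply: eq_cintegrable => x _; rewrite mulN1r.
Qed.

Lemma cintegrableB f g : cintegrable mu D f -> cintegrable mu D g ->
  cintegrable mu D (fun x => f x - g x).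
Proof. by move=> fi /cintegrableN; exact: cintegrableD. Qed.

Lemma cintegralD f g : cintegrable mu D f -> cintegrable mu D g ->
  cintegral mu D (fun x => f x + g x) = cintegral mu D f + cintegral mu D g.
Proof.
move=> [f1 f2] [g1 g2]; apply: eq_ReIm; rewrite ?cReD ?cImD /cintegral /= -RintegralD //;
  by apply: eq_Rintegral => x _; rewrite ?cReD ?cImD.
Qed.

Lemma cintegralZ c f : cintegrable mu D f ->
  cintegral mu D (fun x => c * f x) = c * cintegral mu D f.
Proof.
move=> [f1 f2]; apply: eq_ReIm; rewrite ?cReM ?cImM /cintegral /= -!RintegralZl //.
  rewrite -RintegralB //; try exact: rintegrableZ.
  by apply: eq_Rintegral => x _; rewrite cReM.
rewrite -RintegralD //; try exact: rintegrableZ.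
by apply: eq_Rintegral => x _; rewrite cImM.
Qed.

Lemma cintegralN f : cintegrable mu D f ->
  cintegral mu D (fun x => - f x) = - cintegral mu D f.
Proof.
by move=> fi; rewrite -mulN1r -cintegralZ //; apply: eq_cintegral => x _; rewrite mulN1r.
Qed.

Lemma cintegralB f g : cintegrable mu D f -> cintegrable mu D g ->
  cintegral mu D (fun x => f x - g x) = cintegral mu D f - cintegral mu D g.
Proof.
by move=> fi gi; rewrite cintegralD ?cintegralN //; exact: cintegrableN.
Qed.

(** For c the value of the integral, |c|^2 = Re (conj c * c) is the integral of Re (conj c * f),
    which is at most |c| times the integral of q. Again no constant is lost to the components. *)
Lemma cmod_cintegral_le f q : cintegrable mu D f -> mu.-integrable D (EFin \o q) ->
  (forall x, D x -> cmod (f x) <= q x) ->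
  cmod (cintegral mu D f) <= Rintegral mu D q.
Proof.
move=> fi qi fq; set c := cintegral mu D f.
have q0 : 0 <= Rintegral mu D q.
  by apply: Rintegral_ge0 => x Dx; exact: le_trans (cmod_ge0 _) (fq x Dx).
have [->|c0] := eqVneq c 0; first by rewrite cmod0.
have cp : 0 < cmod c by rewrite cmod_gt0.
pose c' : C R := conjc c.
have cc : cmod c' = cmod c by rewrite !cmodE /c'; case: (c) => ? ? /=; rewrite sqrrN.
rewrite -(ler_pM2l cp) -RintegralZl //.
have -> : cmod c * cmod c = Re (c' * c).
  rewrite -expr2 sqr_cmod cReM /c'; case: (c) => x y /=.
  by rewrite mulNr opprK -!expr2.
have [g1 g2] := cintegrableZ c' fi.
rewrite {2}/c -cintegralZ // /cintegral /=; apply: le_Rintegral => //.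
  rewrite (_ : _ \o _ = (fun x => (cmod c)%:E * (EFin \o q) x))%E.
    exact: integrableZl.
  by apply/funext => x; rewrite /= EFinM.
move=> x Dx; apply: le_trans (Re_le_cmod _) _.
by rewrite cmodM cc ler_wpM2l ?fq // ltW.
Qed.

(** The pointwise Taylor bound B x * |h|^2 is integrated, which gives a quadratic remainder with
    constant the integral of B. *)
Lemma is_cderive_integral (f f1 f2 : C R -> T -> C R) (B : T -> R) (z : C R) (r : R) :
  0 < r -> mu.-integrable D (EFin \o B) ->
  (forall w, cmod (w - z) < r -> cintegrable mu D (f w)) ->
  cintegrable mu D (f1 z) ->
  (forall w x, cmod (w - z) < r -> D x ->
    [/\ is_cderive (fun w => f w x) w (f1 w x), is_cderive (fun w => f1 w x) w (f2 w x)
      & cmod (f2 w x) <= B x]) ->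
  is_cderive (fun w => cintegral mu D (f w)) z (cintegral mu D (f1 z)).
Proof.
move=> r0 Bi fi f1i H; apply: (@is_cderive_quad _ _ _ _ (Rintegral mu D B) r) => // h hr.
have i1 : cintegrable mu D (f (z + h)) by apply: fi; rewrite [z + h]addrC addrK.
have i0 : cintegrable mu D (f z) by apply: fi; rewrite subrr cmod0.
rewrite -cintegralZ // -cintegralB // -cintegralB; [|exact: cintegrableB|exact: cintegrableZ].
rewrite -RintegralZr //; apply: cmod_cintegral_le.
- by apply: cintegrableB; [exact: cintegrableB|exact: cintegrableZ].
- rewrite (_ : _ \o _ = (fun x => (EFin \o B) x * (cmod h ^+ 2)%:E))%E; last first.
    by apply/funext => x; rewrite /= EFinM.
  exact: integrableZr.
move=> x Dx.
have hseg (t : R) : 0 <= t <= 1 -> cmod (z + toC t * h - z) < r.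
  by move=> ht; rewrite [z + _]addrC addrK (le_lt_trans (cmod_seg h ht)).
apply: (@cderive_taylor _ (fun w => f w x) (fun w => f1 w x) (fun w => f2 w x)) => t ht;
  by have [] := H _ _ (hseg t ht) Dx.
Qed.

End ComplexIntegration.

Section RealLine.
Context {R : realType}.
Local Notation leb := (@lebesgue_measure R).
Implicit Types (F f : R -> C R) (a b : R).

Lemma is_rderive_within_continuous f (f1 : R -> C R) (D : set R) :
  (forall t, D t -> is_rderive f t (f1 t)) ->
  {within D, continuous (fun x => Re (f x))} /\ {within D, continuous (fun x => Im (f x))}.
Proof.
move=> H; split; apply: continuous_in_subspaceT => t /set_mem Dt; case: (H t Dt) => [[d1 _] [d2 _]].
  exact: derivable_continuous d1.
exact: derivable_continuous d2.
Qed.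

Lemma cmeasurable_is_rderive f (f1 : R -> C R) (D : set R) : measurable D ->
  (forall t, D t -> is_rderive f t (f1 t)) -> cmeasurable D f.
Proof.
move=> mD H; have [h1 h2] := is_rderive_within_continuous H.
by split; apply: subspace_continuous_measurable_fun.
Qed.

Lemma cintegrable_is_rderive f (f1 : R -> C R) a b :
  (forall t, a <= t <= b -> is_rderive f t (f1 t)) -> cintegrable leb `[a, b] f.
Proof.
move=> H; have H' : forall t, `[a, b]%classic t -> is_rderive f t (f1 t).
  by move=> t /=; rewrite in_itv /= => /H.
have [h1 h2] := is_rderive_within_continuous H'.
by split; apply: continuous_compact_integrable => //; exact: segment_compact.
Qed.

(** Continuity of the integrand is supplied by its own derivative [f1]. *)
Lemma cintegral_FTC F f (f1 : R -> C R) a b : a <= b ->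
  (forall t, a <= t <= b -> is_rderive F t (f t)) ->
  (forall t, a <= t <= b -> is_rderive f t (f1 t)) ->
  cintegral leb `[a, b] f = F b - F a.
Proof.
rewrite le_eqVlt => /orP[/eqP -> _ _|ab HF Hf].
  rewrite /cintegral set_itv1 !Rintegral_set1 subrr.
  by apply: eq_ReIm.
have H' : forall t, `[a, b]%classic t -> is_rderive f t (f1 t).
  by move=> t /=; rewrite in_itv /= => /Hf.
have [c1 c2] := is_rderive_within_continuous H'.
have key (p q : R -> R) : {within `[a, b], continuous p} ->
    (forall t, a <= t <= b -> is_derive t 1 q (p t)) ->
    Rintegral leb `[a, b] p = q b - q a.
  move=> cp dq; rewrite /Rintegral (@continuous_FTC2 R p q a b) //.
    have cq t : a <= t <= b -> {for t, continuous q}.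
      move=> /dq [dt _]; exact: derivable_continuous dt.
    split.
    - by move=> t; rewrite in_itv /= => /andP[h1 h2]; have [] := dq t; rewrite ?ltW.
    - by apply: cvg_at_right_filter; apply: cq; rewrite lexx ltW.
    - by apply: cvg_at_left_filter; apply: cq; rewrite lexx ltW.
  move=> t; rewrite in_itv /= => /andP[h1 h2]; rewrite derive1E.
  by have [] := dq t; rewrite ?ltW.
apply: eq_ReIm; rewrite ?cReB ?cImB /cintegral /=.
  exact: (key (fun x => Re (f x)) (fun x => Re (F x)) c1 (fun t h => (HF t h).1)).
exact: (key (fun x => Im (f x)) (fun x => Im (F x)) c2 (fun t h => (HF t h).2)).
Qed.

Definition invsq (c x : R) := (x + c) ^- 2.

Lemma integrable_invsq (a c : R) : 0 < a + c ->
  leb.-integrable `[a, +oo[ (EFin \o invsq c) /\ Rintegral leb `[a, +oo[ (invsq c) = (a + c)^-1.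
Proof.
move=> a0.
have d0 (x : R) : is_derive x 1 (fun y => y + c) 1.
  by have := is_deriveD (is_derive_id x 1) (is_derive_cst c x 1); rewrite addr0.
have d (x : R) : 0 < x + c -> is_derive x 1 (fun y => - (y + c)^-1) ((x + c) ^- 2).
  move=> x0; have := @is_derive_finv R (fun y => y + c) x 1; rewrite /= gt_eqF // => /(_ isT (d0 x)).
  move=> h; apply: (is_derive_eq (is_deriveN h)).
  by rewrite mulN1r opprK.
have cinv (x : R) : 0 < x + c -> {for x, continuous (invsq c)}.
  move=> x0; apply: cvgV; first by rewrite expf_neq0 // gt_eqF.
  by apply: (@continuous_comp _ _ _ (fun y => y + c) (fun y => y ^+ 2));
    [apply: cvgD; [exact: cvg_id|exact: cvg_cst]|exact: exprn_continuous].
have ax : forall x : R, a <= x -> 0 < x + c.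
  by move=> x h; apply: lt_le_trans a0 _; rewrite lerD2r.
have cw : {within `[a, +oo[, continuous (invsq c)}.
  apply: continuous_in_subspaceT => x /set_mem /=.
  by rewrite in_itv /= andbT => /ax/cinv.
have e : (\int[leb]_(x in `[a, +oo[) (invsq c x)%:E = 0%:E - (- (a + c)^-1)%:E)%E.
  apply: (@ge0_continuous_FTC2y R (invsq c) (fun y => - (y + c)^-1)).
  - by move=> x ax'; rewrite invr_ge0 sqr_ge0.
  - exact: cw.
  - rewrite -[X in _ --> X]oppr0; apply: cvgN; apply/gtr0_cvgV0.
      near=> x; rewrite -ltrBlDr sub0r; near: x; apply: nbhs_pinfty_gt; exact: num_real.
    by apply: cvg_addrr.
  - by move=> x /ltW/ax/d[].
  - apply: cvg_at_right_filter.
    apply: cvgN; apply: cvgV; first by rewrite gt_eqF.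
    by apply: cvgD; [exact: cvg_id|exact: cvg_cst].
  - by move=> x; rewrite in_itv /= andbT => /ltW/ax/d[h1 h2]; rewrite derive1E.
have mf : measurable_fun `[a, +oo[ (invsq c).
  exact: subspace_continuous_measurable_fun.
split; last by rewrite /Rintegral e -EFinB /= sub0r opprK.
apply/integrableP; split; first exact/measurable_EFinP.
under eq_integral => x _ do rewrite /= ger0_norm ?invr_ge0 ?sqr_ge0 //.
by rewrite e ltry.
Unshelve. all: by end_near. Qed.

End RealLine.

(** * Stirling's formula with sawtooth remainder *)

Section Stirling.
Context {R : realType}.
Local Notation leb := (@lebesgue_measure R).
Variables (l l1 l2 l3 : C R -> C R).
Hypothesis dl : forall w, Cgt0 w -> is_cderive l w (l1 w).
Hypothesis dl1 : forall w, Cgt0 w -> is_cderive l1 w (l2 w).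
Hypothesis dl2 : forall w, Cgt0 w -> is_cderive l2 w (l3 w).
Hypothesis bl1 : forall w, Cgt0 w -> cmod (l1 w) <= (Re w)^-1.
Hypothesis bl2 : forall w, Cgt0 w -> cmod (l2 w) <= 5 * (Re w) ^- 2.

Lemma Psaw_ge0_le (u : R) : 0 <= Psaw u <= 4^-1.
Proof.
rewrite /Psaw; set v := u - _; have := floor_itv u.
rewrite intrD => /andP[h1 h2].
have v0 : 0 <= v by rewrite subr_ge0.
have v1 : v <= 1 by rewrite lerBlDl ltW.
rewrite mulr_ge0 ?subr_ge0 //= -subr_ge0 (_ : _ - _ = (v - 2^-1) ^+ 2) ?sqr_ge0 //.
by field.
Qed.

(** The right end-point is included: both sides vanish there. So the sawtooth may be replaced by a
    polynomial on a closed unit interval. *)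
Lemma Psaw_nat (k : nat) (u : R) : k%:R <= u <= k.+1%:R ->
  Psaw u = (u - k%:R) * (k.+1%:R - u).
Proof.
move=> /andP[h1]; rewrite le_eqVlt => /orP[/eqP ->|h2].
  rewrite /Psaw subrr mulr0.
  have -> : Num.floor (k.+1%:R : R) = k.+1%:Z by apply/eqP; rewrite floor_eq -natr1 -!pmulrn; lra.
  by rewrite -pmulrn subrr mul0r.
rewrite /Psaw; have -> : Num.floor u = k%:Z.
  by apply/eqP; rewrite floor_eq intrD -!pmulrn h1 /= natr1.
by rewrite -pmulrn -natr1; ring.
Qed.

Lemma measurable_Psaw (D : set R) : measurable D -> measurable_fun D Psaw.
Proof.
move=> mD.
have mf : measurable_fun D (fun u : R => (Num.floor u)%:~R : R).
  by apply: nondecreasing_measurable => // x y xy; rewrite ler_int le_floor.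
by apply: measurable_funM; [apply: measurable_funB => //; exact: measurable_id |
  apply: measurable_funB => //; apply: measurable_funB => //; exact: measurable_id].
Qed.

Lemma is_rderive_shift (f f1 : C R -> C R) (z : C R) (u : R) :
  (forall w, Cgt0 w -> is_cderive f w (f1 w)) -> 0 <= Re z -> 0 < u ->
  is_rderive (fun v => f (toC v + z)) u (f1 (toC u + z)).
Proof.
move=> df z0 u0.
have := @is_rderive_line R f z 1 (f1 (toC u + z)) u.
rewrite !mulr1 (addrC z); under eq_fun do rewrite mulr1 addrC.
by apply; apply: df; rewrite /Cgt0 /= cReD cReC ltr_pwDl.
Qed.

Let Q (z : C R) (u : R) := toC (Psaw u) * l2 (toC u + z).

Lemma cmod_Psaw_l2 (z : C R) (u : R) : 0 < u -> 0 <= Re z ->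
  cmod (Q z u) <= 5 / 4 * invsq (Re z) u.
Proof.
move=> u0 z0; have /andP[p0 p1] := Psaw_ge0_le u.
rewrite /Q cmodM cmodC ger0_norm //.
have h : cmod (l2 (toC u + z)) <= 5 * invsq (Re z) u.
  have := @bl2 (toC u + z); rewrite /Cgt0 /= cReD cReC; apply.
  by rewrite ltr_pwDl.
apply: le_trans (ler_pM p0 (cmod_ge0 _) p1 h) _.
by rewrite mulrA (mulrC 4^-1).
Qed.

Lemma Psaw_l2_integrable (z : C R) (a : R) : 0 < a -> 0 <= Re z ->
  cintegrable leb `[a, +oo[ (Q z).
Proof.
move=> a0 z0; have az : 0 < a + Re z by rewrite ltr_pwDl.
have [i1 _] := @integrable_invsq R a (Re z) az.
have pos u : `[a, +oo[%classic u -> 0 < u.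
  by rewrite /= in_itv /= andbT; exact: lt_le_trans.
apply: (cintegrable_dom _ _ (rintegrableZ _ (5 / 4) i1)) => //.
  apply: cmeasurableM => //.
    apply: cmeasurable_toC; exact: measurable_Psaw.
  apply: (@cmeasurable_is_rderive _ _ (fun u => l3 (toC u + z))) => // t /pos t0.
  exact: is_rderive_shift.
move=> x /pos x0; exact: cmod_Psaw_l2.
Qed.

(** For l2 = (log kappa)'' and a = 1, E is the tail at z minus the tail at 0, and T is minus the
    tail at 0. *)
Definition saw_tail (z : C R) (a : R) := 2^-1 * cintegral leb `[a, +oo[ (Q z).

(** The factor is (1/2) * (1/4) * 5 = 5/8, from P <= 1/4 and the bound on l''; it is rounded up to
    1. Two such tails at a = 1 make up the constant 2. *)
Lemma cmod_saw_tail (z : C R) (a : R) : 0 < a -> 0 <= Re z ->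
  cmod (saw_tail z a) <= (a + Re z)^-1.
Proof.
move=> a0 z0; have az : 0 < a + Re z by rewrite ltr_pwDl.
have [i1 e1] := @integrable_invsq R a (Re z) az.
rewrite /saw_tail cmodM.
have -> : cmod (2^-1 : C R) = 2^-1 by rewrite cmodV -(toC_nat 2) cmodC ger0_norm.
have h : cmod (cintegral leb `[a, +oo[ (Q z)) <= 5 / 4 * (a + Re z)^-1.
  rewrite -e1 -RintegralZl //; apply: cmod_cintegral_le => //.
  - exact: Psaw_l2_integrable.
  - exact: rintegrableZ.
  move=> x /=; rewrite in_itv /= andbT => ax; apply: cmod_Psaw_l2 => //.
  exact: lt_le_trans ax.
have : 0 < (a + Re z)^-1 by rewrite invr_gt0.
move: h; set X := (a + Re z)^-1; set Y := cmod _; lra.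
Qed.

(* The substitute for an antiderivative of [u |-> l (u + z) - l u]. *)
Definition seg_int (z w : C R) : C R :=
  z * cintegral leb `[0, 1] (fun v => l (w + z * toC v)).

Lemma rint01 (k : R) : leb.-integrable `[0, 1] (EFin \o (fun=> k)) /\
  Rintegral leb `[0, 1] (fun=> k) = k.
Proof.
split; last by rewrite Rintegral_cst //= lebesgue_measure_itv /= lte_fin ltr01 -EFinB subr0 mulr1.
apply: measurable_bounded_integrable => //.
  by rewrite /= lebesgue_measure_itv /= lte_fin ltr01 -EFinB subr0 ltry.
exact: bounded_cst.
Qed.

Lemma is_rderive_ray (f f1 : C R -> C R) (w z : C R) (v : R) :
  (forall w, Cgt0 w -> is_cderive f w (f1 w)) -> 0 < Re w -> 0 <= Re z -> 0 <= v ->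
  is_rderive (fun v => f (w + z * toC v)) v (z * f1 (w + z * toC v)).
Proof.
move=> df w0 z0 v0; rewrite mulrC (mulrC z).
under eq_fun do rewrite (mulrC z).
apply: is_rderive_line; apply: df; rewrite /Cgt0 /= cReD Re_toCM.
by rewrite ltr_wpDr // mulr_ge0.
Qed.

Lemma ray_integrable (f f1 : C R -> C R) (w z : C R) :
  (forall w, Cgt0 w -> is_cderive f w (f1 w)) -> 0 < Re w -> 0 <= Re z ->
  cintegrable leb `[0, 1] (fun v => f (w + z * toC v)).
Proof.
move=> df w0 z0; apply: (@cintegrable_is_rderive _ _ (fun v => z * f1 (w + z * toC v))).
by move=> t /andP[t0 _]; exact: is_rderive_ray.
Qed.

(** Differentiation under the integral gives the integral of z l'(x + z v) over v in [0, 1], and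
    this integrand is the v-derivative of l(x + z v). *)
Lemma is_rderive_seg_int (z : C R) (x : R) : 0 < x -> 0 <= Re z ->
  is_rderive (fun u => seg_int z (toC u)) x (l (toC x + z) - l (toC x)).
Proof.
move=> x0 z0.
have r0 : 0 < x / 2 by rewrite divr_gt0.
have pos w v : cmod (w - toC x) < x / 2 -> 0 <= v -> x / 2 <= Re (w + z * toC v).
  move=> hw v0; rewrite cReD cReM cImC cReC mulr0 subr0.
  have := le_lt_trans (normRe_le _) hw; rewrite cReB cReC ltr_norml => /andP[h1 _].
  have : 0 <= Re z * v by rewrite mulr_ge0.
  move: h1; lra.
have wpos w : cmod (w - toC x) < x / 2 -> 0 < Re w.
  by move=> /pos /(_ (lexx 0)); rewrite toC0 mulr0 addr0; exact: lt_le_trans.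
have H : is_cderive (seg_int z) (toC x)
    (z * cintegral leb `[0, 1] (fun v => l1 (toC x + z * toC v))).
  apply: is_cderiveZ.
  apply: (@is_cderive_integral _ _ R leb `[0%R, 1%R]%classic _ (fun w v => l (w + z * toC v))
    (fun w v => l1 (w + z * toC v)) (fun w v => l2 (w + z * toC v))
    (fun=> 5 * (x / 2) ^- 2) _ (x / 2)) => //.
  - by have [] := rint01 (5 * (x / 2) ^- 2).
  - by move=> w /wpos hw; exact: (ray_integrable dl).
  - exact: (ray_integrable dl1).
  move=> w v hw; rewrite /= in_itv /= => /andP[v0 v1].
  have hp := pos w v hw v0.
  have hp0 : 0 < Re (w + z * toC v) by exact: lt_le_trans hp.
  have sh (f f1 : C R -> C R) : (forall w, Cgt0 w -> is_cderive f w (f1 w)) ->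
      is_cderive (fun w => f (w + z * toC v)) w (f1 (w + z * toC v)).
    move=> df; have d1 : is_cderive (fun w => w + z * toC v) w 1.
      have := is_cderiveD (is_cderive_id w) (is_cderive_cst (z * toC v) w).
      by rewrite addr0.
    have := @is_cderive_comp R (fun w => w + z * toC v) f w 1 _ (df _ hp0) d1.
    by rewrite mulr1.
  split; [exact: sh|exact: sh|].
  apply: le_trans (bl2 hp0) _.
  rewrite ler_wpM2l // lef_pV2 ?posrE ?exprn_gt0 //.
  by rewrite ler_pXn2r ?nnegrE ?(ltW hp0) ?(ltW r0).
have e : z * cintegral leb `[0, 1] (fun v => l1 (toC x + z * toC v)) =
    l (toC x + z) - l (toC x).
  rewrite -cintegralZ //; last exact: (ray_integrable dl1).
  rewrite (@cintegral_FTC _ (fun v => l (toC x + z * toC v)) _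
     (fun v => z * (z * l2 (toC x + z * toC v)))) //.
  - by rewrite toC0 toC1 mulr0 mulr1 addr0.
  - by move=> t /andP[t0 _]; exact: (is_rderive_ray dl).
  - move=> t /andP[t0 _].
    apply: (@is_rderive_ray (fun w => z * l1 w) (fun w => z * l2 w)) => // w hw.
    exact/is_cderiveZ/dl1.
rewrite -e; exact: is_rderive_toC.
Qed.

(** The point x + z v is at distance at most |z| + 1 from x + 1, and |l'| <= 1 / x on the segment
    between them. With x = n + 1, the value at x + 1 is the l(n+2) of S_n. *)
Lemma cmod_seg_int (z : C R) (x : R) : 0 < x -> 0 <= Re z ->
  cmod (seg_int z (toC x) - z * l (toC (x + 1))) <= cmod z * (cmod z + 1) / x.
Proof.
move=> x0 z0; rewrite /seg_int.
have [i1 e1] := rint01 ((cmod z + 1) / x).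
have ic : cintegrable leb `[0, 1] (fun=> l (toC (x + 1))).
  apply: (@cintegrable_is_rderive _ _ (fun=> 0)) => t _.
  by split; exact: is_derive_cst.
have ec : cintegral leb `[0, 1] (fun=> l (toC (x + 1))) = l (toC (x + 1)).
  by apply: eq_ReIm; rewrite /cintegral /= (rint01 _).2.
rewrite -{1}ec -mulrBr -cintegralB //; last exact: (ray_integrable dl).
rewrite cmodM -mulrA ler_wpM2l ?cmod_ge0 // -e1.
apply: cmod_cintegral_le => //.
  by apply: cintegrableB => //; exact: (ray_integrable dl).
move=> v; rewrite /= in_itv /= => /andP[v0 v1].
have e : toC x + z * toC v = toC (x + 1) + (z * toC v - 1) by rewrite toCD toC1; ring.
have pos (t : R) : 0 <= t <= 1 -> x <= Re (toC (x + 1) + toC t * (z * toC v - 1)).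
  move=> /andP[t0 t1]; rewrite cReD Re_toCM cReC cReB cReM cImC cReC mulr0 subr0 cRe1.
  have : 0 <= t * (Re z * v) by rewrite !mulr_ge0.
  by rewrite mulrBr mulr1; lra.
have pos' (t : R) : 0 <= t <= 1 -> Cgt0 (toC (x + 1) + toC t * (z * toC v - 1)).
  by move=> /pos; exact: lt_le_trans.
rewrite e; apply: le_trans (@cderive_bound _ l l1 _ _ x^-1 _ _) _.
- by move=> t /pos'; exact: dl.
- move=> t ht; apply: le_trans (bl1 (pos' t ht)) _.
  by rewrite lef_pV2 ?posrE ?pos //; exact: pos'.
rewrite mulrC ler_wpM2r ?invr_ge0 ?(ltW x0) //.
apply: le_trans (cmodB _ _) _; rewrite cmod1 lerD2r cmodM cmodC ger0_norm //.
by rewrite ler_piMr ?cmod_ge0.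
Qed.

Lemma cmod_l_shift (z : C R) (x : R) : 0 < x -> 0 <= Re z ->
  cmod (l (toC x + z) - l (toC x)) <= cmod z / x.
Proof.
move=> x0 z0; rewrite mulrC.
have pos (t : R) : 0 <= t <= 1 -> x <= Re (toC x + toC t * z).
  by move=> /andP[t0 t1]; rewrite cReD Re_toCM cReC lerDl mulr_ge0.
apply: (@cderive_bound _ l l1) => t ht.
  by apply: dl; exact: lt_le_trans (pos t ht).
apply: le_trans (bl1 _) _; first exact: lt_le_trans (pos t ht).
by rewrite lef_pV2 ?posrE ?pos //; exact: lt_le_trans (pos t ht).
Qed.

Lemma cintegral_split (f : R -> C R) (a b : R) : a <= b ->
  cintegrable leb `[a, +oo[ f ->
  cintegral leb `[a, +oo[ f = cintegral leb `[a, b] f + cintegral leb `[b, +oo[ f.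
Proof.
move=> ab [f1 f2].
have key (g : R -> R) : leb.-integrable `[a, +oo[ (EFin \o g) ->
    Rintegral leb `[a, +oo[ g = Rintegral leb `[a, b] g + Rintegral leb `[b, +oo[ g.
  move=> gi; apply/eqP; rewrite addrC -subr_eq; apply/eqP.
  rewrite (@Rintegral_itvB _ g (BLeft a) +oo%O b) //.
  rewrite Rintegral_itv_obnd_cbnd //.
  apply: integrableS gi => //.
  move=> x /=; rewrite !in_itv /= !andbT => bx; exact: ltW (le_lt_trans ab bx).
by apply: eq_ReIm; rewrite ?cReD ?cImD /cintegral /=; exact: key.
Qed.

Definition saw_diff (z : C R) (a : R) := saw_tail z a - saw_tail 0 a.

Lemma cmod_saw_diff (z : C R) (a : R) : 0 < a -> 0 <= Re z ->
  cmod (saw_diff z a) <= 2 / a.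
Proof.
move=> a0 z0; apply: le_trans (cmodB _ _) _.
rewrite (_ : 2 / a = a^-1 + a^-1); last by ring.
apply: lerD; apply: le_trans (cmod_saw_tail _ _) _; rewrite ?cRe0 ?addr0 //.
by rewrite lef_pV2 ?posrE ?ltr_wpDr // lerDl.
Qed.

(** Two integrations by parts of (1/2) P h'' on [k, k+1], for h(u) = l(u + z) - l(u). They are
    packed into the antiderivative (1/2) (P h' - P' h) - int h, using P'' = -2; P vanishes at both
    ends, where P' is 1 and -1. *)
Lemma saw_diff_step (z : C R) (k : nat) : (0 < k)%N -> 0 <= Re z ->
  let g (j : nat) := l (toC j%:R + z) - l (toC j%:R) in
  saw_diff z k%:R - saw_diff z k.+1%:R =
  2^-1 * (g k + g k.+1) - (seg_int z (toC k.+1%:R) - seg_int z (toC k%:R)).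
Proof.
move=> k0 z0 g.
have kp : 0 < k%:R :> R by rewrite ltr0n.
have kk : k%:R <= k.+1%:R :> R by rewrite ler_nat.
have q0 : 0 <= Re (0 : C R) by rewrite cRe0.
have i1 := Psaw_l2_integrable kp z0; have i0 := Psaw_l2_integrable kp q0.
have sub (D : set R) : measurable D -> D `<=` `[k%:R, +oo[%classic ->
    cintegrable leb D (Q z) /\ cintegrable leb D (Q 0).
  move=> mD sD; move: i1 i0 => [a1 a2] [a3 a4].
  by split; split; apply: (@integrableS _ _ _ leb `[k%:R, +oo[%classic D).
rewrite /saw_diff /saw_tail (cintegral_split kk i1) (cintegral_split kk i0).
rewrite (_ : _ - _ - (_ - _) = 2^-1 * (cintegral leb `[k%:R, k.+1%:R] (Q z) -
  cintegral leb `[k%:R, k.+1%:R] (Q 0))); last by ring.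
have sD : (`[k%:R, k.+1%:R] : set R) `<=` (`[k%:R, +oo[ : set R).
  by move=> x /=; rewrite !in_itv /= andbT => /andP[].
have [] := sub `[k%:R, k.+1%:R]%classic _ sD => // j1 j0.
rewrite -cintegralB // -cintegralZ; last exact: cintegrableB.
pose P (u : R) := toC ((u - k%:R) * (k.+1%:R - u)).
pose P' (u : R) := toC (k.+1%:R - u - (u - k%:R)).
(* The second argument is written [toC u + 0] to match [Q 0] syntactically. *)
pose h f (u : R) := f (toC u + z) - f (toC u + 0) : C R.
pose F u := 2^-1 * (P u * h l1 u - P' u * h l u) - seg_int z (toC u).
transitivity (cintegral leb `[k%:R, k.+1%:R] (fun u : R => 2^-1 * (P u * h l2 u))).
  apply: eq_cintegral => u /=; rewrite in_itv /= => hu; rewrite /Q /h /P -(Psaw_nat hu); ring.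
have dh f f1 (u : R) : (forall w, Cgt0 w -> is_cderive f w (f1 w)) -> 0 < u ->
    is_rderive (h f) u (h f1 u).
  by move=> df u0; apply: is_rderiveB; exact: is_rderive_shift.
have d1 (u : R) : is_derive u 1 (fun u => u - k%:R) 1.
  by apply: (is_derive_eq (is_deriveB (is_derive_id u 1) (is_derive_cst _ u 1))); rewrite subr0.
have d2 (u : R) : is_derive u 1 (fun u => k.+1%:R - u) (-1).
  by apply: (is_derive_eq (is_deriveB (is_derive_cst _ u 1) (is_derive_id u 1))); rewrite sub0r.
have dP u : is_rderive P u (P' u).
  split; last exact: is_derive_cst.
  by apply: (is_derive_eq (is_derive_fmul (d1 u) (d2 u))); rewrite /P' /=; ring.
have dP' u : is_rderive P' u (toC (-2)).
  split; last exact: is_derive_cst.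
  by apply: (is_derive_eq (is_deriveB (d2 u) (d1 u))) => /=; ring.
have kpos (u : R) : k%:R <= u <= k.+1%:R -> 0 < u.
  by move=> /andP[h1 _]; exact: lt_le_trans h1.
rewrite (@cintegral_FTC _ F _ (fun u => 2^-1 * (P' u * h l2 u + P u * h l3 u))) //.
- have e1 : k.+1%:R - k%:R = 1 :> R by rewrite -natr1 addrAC subrr add0r.
  have P0 : P k%:R = 0 by rewrite /P subrr mul0r.
  have P1 : P k.+1%:R = 0 by rewrite /P subrr mulr0.
  have P'0 : P' k%:R = 1 by rewrite /P' e1 subrr subr0.
  have P'1 : P' k.+1%:R = -1 by rewrite /P' subrr e1 sub0r toCN.
  by rewrite /F P0 P1 P'0 P'1 /h !addr0 /g; ring.
- move=> u /kpos u0; rewrite (_ : 2^-1 * (P u * h l2 u) =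
    2^-1 * ((P' u * h l1 u + P u * h l2 u) - (toC (-2) * h l u + P' u * h l1 u))
    - (l (toC u + z) - l (toC u))); last first.
    by rewrite toCN (toC_nat 2) /h addr0; field.
  apply: is_rderiveB; last exact: is_rderive_seg_int.
  apply: is_rderiveZ; apply: is_rderiveB; apply: is_rderiveM => //; exact: dh.
- move=> u /kpos u0; apply: is_rderiveZ; apply: is_rderiveM => //; exact: dh.
- exact: measurable_itv.
Qed.

Definition stirling_sum (z : C R) (n : nat) : C R :=
  - l z + \sum_(j < n.+1) (l (toC j.+1%:R) - l (toC j.+1%:R + z)) + z * l (toC n.+2%:R).

(** The auxiliary D n does not depend on n, by [saw_diff_step], and D 0 is the wanted exponent. The
    three summands of D n - S_n contribute |z| (|z| + 1), |z| and 2 to the numerator. *)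
Lemma stirling (z : C R) (n : nat) : Cgt0 z ->
  cmod (2^-1 * l 1 - l z - 2^-1 * l (1 + z) + seg_int z 1 - saw_diff z 1 - stirling_sum z n)
    <= (cmod z ^+ 2 + 2 * cmod z + 2) / n.+1%:R.
Proof.
move=> z0; have z0' : 0 <= Re z by exact: ltW.
pose g (j : nat) := l (toC j%:R + z) - l (toC j%:R).
pose D n := - l z + \sum_(j < n.+1) (l (toC j.+1%:R) - l (toC j.+1%:R + z))
  + 2^-1 * g n.+1 + seg_int z (toC n.+1%:R) - saw_diff z n.+1%:R.
have D0 : D n = D 0%N.
  elim: n => // m <-; rewrite /D big_ord_recr /=.
  have := saw_diff_step (isT : (0 < m.+1)%N) z0'; rewrite -/(g m.+1) -/(g m.+2).
  by move=> /= /(canRL (subrK _)) ->; rewrite /g; field.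
have -> : 2^-1 * l 1 - l z - 2^-1 * l (1 + z) + seg_int z 1 - saw_diff z 1 = D n.
  by rewrite D0 /D big_ord1 /g !toC1; field.
have np : 0 < n.+1%:R :> R by rewrite ltr0n.
rewrite (_ : D n - stirling_sum z n = (seg_int z (toC n.+1%:R) - z * l (toC (n.+1%:R + 1)))
   + 2^-1 * g n.+1 - saw_diff z n.+1%:R); last first.
  rewrite /D /stirling_sum natr1; ring.
apply: le_trans (cmodB _ _) _.
apply: le_trans (lerD (cmodD _ _) (lexx _)) _.
rewrite cmodM (_ : cmod 2^-1 = 2^-1); last by rewrite cmodV -(toC_nat 2) cmodC ger0_norm.
have h1 := cmod_seg_int np z0'; have h2 := cmod_l_shift np z0'.
have h3 := cmod_saw_diff np z0'.
rewrite (_ : _ / n.+1%:R = cmod z * (cmod z + 1) / n.+1%:R + cmod z / n.+1%:R + 2 / n.+1%:R); last by ring.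
rewrite !lerD //; apply: le_trans h2.
by rewrite ler_piMl ?cmod_ge0 // invf_le1 ?ltr0n // ler1n.
Qed.

End Stirling.

(** * Laplace integrals *)

Section RealInequalities.
Context {R : realType}.
Implicit Types (y a : R).

Lemma expRN_mul y : expR (- y) * expR y = 1.
Proof. by rewrite -expRD addNr expR0. Qed.

Lemma sub1_expRN_ge y : 0 <= y -> y / (1 + y) <= 1 - expR (- y).
Proof.
move=> y0; have p : 0 < 1 + y by rewrite ltr_pwDl.
have h : expR (- y) <= (1 + y)^-1.
  by rewrite expRN lef_pV2 ?posrE ?expR_gt0 // expR_ge1Dx.
rewrite (_ : y / (1 + y) = 1 - (1 + y)^-1); last by field; rewrite gt_eqF.
by rewrite lerB.
Qed.

(** Square e^(y/2) >= 1 + y/2. The coefficient 1/4 is the source of the constant 4 in the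
    second-moment bound. *)
Lemma expR_ge_quad y : 0 <= y -> 1 + y + y ^+ 2 / 4 <= expR y.
Proof.
move=> y0; rewrite (_ : 1 + y + y ^+ 2 / 4 = (1 + y / 2) ^+ 2); last by field.
rewrite [in leRHS](splitr y) expRD -expr2 ler_pXn2r ?nnegrE ?expR_ge0 ?expR_ge1Dx //.
by rewrite addr_ge0 // divr_ge0.
Qed.

Lemma sub1_expRN_quad y : 0 <= y ->
  y * expR (- y) <= 1 - expR (- y) /\ y ^+ 2 * expR (- y) <= 4 * (1 - expR (- y)).
Proof.
move=> y0; have := expR_ge_quad y0; have := expRN_mul y; have := expR_gt0 (- y).
have : 0 <= y ^+ 2 by rewrite sqr_ge0.
move: (expR (- y)) (expR y) (y ^+ 2) => e E s s0 e0 eE h.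
have h2 : e * (1 + y + s / 4) <= 1 by rewrite -[leRHS]eE ler_wpM2l ?(ltW e0).
have : 0 <= e * s by rewrite mulr_ge0 // ltW.
have : 0 <= e * y by rewrite mulr_ge0 // ltW.
move: h2; rewrite !mulrDr mulr1 mulrA.
rewrite (mulrC y) (mulrC s); move: (e * y) (e * s) => A B; split; lra.
Qed.

(** Makes 1 - e^-y a common majorant of all moments of positive order. It is at least y / (1 + y),
    so y^n <= (1 + y)^n (1 - e^-y), and the exponential absorbs (1 + y)^n. *)
Lemma exprn_expRN_le (n : nat) (a : R) : (0 < n)%N -> 0 < a ->
  exists2 K : R, 0 < K & forall y, 0 <= y -> y ^+ n * expR (- (a * y)) <= K * (1 - expR (- y)).
Proof.
move=> n0 a0; case: n n0 => // m _.
(* From c <= 1 follows 1 + y <= c^-1 e^(c y); from c (m + 1) <= a, the power m + 1 of the right side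
   stays below a constant times e^(a y). *)
pose c := Num.min 1 (a / m.+1%:R).
have c0 : 0 < c by rewrite lt_min ltr01 divr_gt0 // ltr0n.
exists (c^-1 ^+ m.+1) => [|y y0]; first by rewrite exprn_gt0 // invr_gt0.
have p : 0 < 1 + y by rewrite ltr_pwDl.
have h1 : 1 + y <= c^-1 * expR (c * y).
  rewrite mulrC ler_pdivlMr //; apply: le_trans (expR_ge1Dx _).
  rewrite mulrDl mul1r [y * c]mulrC lerD2r.
  by rewrite /c ge_min lexx.
have h2 : (1 + y) ^+ m.+1 <= c^-1 ^+ m.+1 * expR (a * y).
  apply: (@le_trans _ _ ((c^-1 * expR (c * y)) ^+ m.+1)).
    by rewrite ler_pXn2r ?nnegrE ?mulr_ge0 ?invr_ge0 ?expR_ge0 ?(ltW c0) ?(ltW p).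
  rewrite exprMn ler_wpM2l ?exprn_ge0 ?invr_ge0 ?(ltW c0) //.
  rewrite -expRM_natr ler_expR -mulrA mulrCA (mulrC a) ler_wpM2l //.
  by rewrite -ler_pdivlMr ?ltr0n // /c ge_min lexx orbT.
have h3 : y ^+ m.+1 <= (1 + y) ^+ m.+1 * (1 - expR (- y)).
  apply: le_trans (ler_wpM2l (exprn_ge0 _ (ltW p)) (sub1_expRN_ge y0)).
  rewrite (_ : _ * (y / _) = (1 + y) ^+ m * y).
    by rewrite exprSr ler_wpM2r // lerXn2r ?nnegrE ?(ltW p) // lerDr.
  by rewrite exprSr; field; rewrite gt_eqF.
have e1 : 0 <= 1 - expR (- y) by rewrite subr_ge0 -expR0 ler_expR oppr_le0.
apply: (@le_trans _ _ ((1 + y) ^+ m.+1 * (1 - expR (- y)) * expR (- (a * y)))).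
  by rewrite ler_wpM2r ?expR_ge0.
apply: (@le_trans _ _ (c^-1 ^+ m.+1 * expR (a * y) * (1 - expR (- y)) * expR (- (a * y)))).
  by rewrite !ler_wpM2r ?expR_ge0.
by rewrite mulrAC -(mulrA (c^-1 ^+ m.+1)) (mulrC (expR (a * y))) expRN_mul mulr1.
Qed.

(** Both sides are compared with y / (1 + y), the left one through min(1, y). It relates the Laplace
    exponent at 1 to its value at any point of the open half-plane. *)
Lemma sub1_expRN_cmp (a y : R) : 0 < a -> 0 <= y ->
  1 - expR (- y) <= 2 * (1 + a^-1) * (1 - expR (- (a * y))).
Proof.
move=> a0 y0; have p : 0 < 1 + y by rewrite ltr_pwDl.
have ay : 0 <= a * y by rewrite mulr_ge0 // ltW.
have pa : 0 < 1 + a * y by rewrite ltr_pwDl.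
have h1 : 1 - expR (- y) <= 2 * (y / (1 + y)).
  have ly : 1 - expR (- y) <= y by rewrite lerBlDl -lerBlDr; exact: expR_ge1Dx.
  have l1 : 1 - expR (- y) <= 1 by rewrite gerBl expR_ge0.
  rewrite mulrA ler_pdivlMr //.
  have : 0 <= 1 - expR (- y) by rewrite subr_ge0 -expR0 ler_expR oppr_le0.
  move: (1 - _) ly l1 => X h1 h2 h3.
  have : X * y <= y by rewrite ler_piMl.
  rewrite mulrDr mulr1; lra.
apply: (le_trans h1); rewrite -mulrA ler_wpM2l //.
apply: (@le_trans _ _ ((1 + a^-1) * (a * y / (1 + a * y)))).
  rewrite !mulrA ler_pdivrMr // mulrAC ler_pdivlMr //.
  rewrite (_ : (1 + a^-1) * a = a + 1); last by field; rewrite gt_eqF.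
  nra.
by rewrite ler_wpM2l ?sub1_expRN_ge // addr_ge0 // invr_ge0 ltW.
Qed.

End RealInequalities.

Section LaplaceFamily.
Context d (T : measurableType d) {R : realType} (mu : {measure set T -> \bar R}).
Variables (D : set T) (mD : measurable D) (p : T -> R) (phi : T -> C R).
Hypothesis mp : measurable_fun D p.
Hypothesis p0 : forall x, D x -> 0 <= p x.
Hypothesis mphi : cmeasurable D phi.
Hypothesis phi1 : forall x, D x -> cmod (phi x) <= 1.
Hypothesis ip : mu.-integrable D (EFin \o (fun x => 1 - expR (- p x))).

(** With one variable of kappa frozen, its exponential becomes a weight [phi] of modulus at most 1
    and a Laplace integral in the other variable remains. Both choices of [p] are used: [snd] for
    derivatives in z, [fst] for the derivative in zeta. *)
Definition laplace_moment (n : nat) (w : C R) : C R :=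
  cintegral mu D (fun x => toC (p x ^+ n) * (phi x * cexp (- (w * toC (p x))))).

Lemma cmeasurable_laplace n w :
  cmeasurable D (fun x => toC (p x ^+ n) * (phi x * cexp (- (w * toC (p x))))).
Proof.
apply: cmeasurableM => //; first exact/cmeasurable_toC/measurable_funX.
apply: cmeasurableM => //; apply: cmeasurable_cexp => //; apply: cmeasurableN => //.
by apply: cmeasurableM.
Qed.

Lemma cmod_laplace n w x : D x ->
  cmod (toC (p x ^+ n) * (phi x * cexp (- (w * toC (p x)))))
    = p x ^+ n * (cmod (phi x) * expR (- (Re w * p x))).
Proof.
move=> Dx; rewrite !cmodM cmodC ger0_norm ?exprn_ge0 ?p0 // cmod_cexp cReN.
by rewrite (mulrC w) Re_toCM (mulrC (Re w)).
Qed.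

Lemma laplace_dom (n : nat) (a : R) : (0 < n)%N -> 0 < a ->
  exists2 B : T -> R, mu.-integrable D (EFin \o B) &
    forall (w : C R) x, D x -> a <= Re w ->
    cmod (toC (p x ^+ n) * (phi x * cexp (- (w * toC (p x))))) <= B x.
Proof.
move=> n0 a0; have [K K0 HK] := exprn_expRN_le n0 a0.
exists (fun x => K * (1 - expR (- p x))); first exact: rintegrableZ.
move=> w x Dx aw; rewrite cmod_laplace //; apply: le_trans (HK _ (p0 Dx)).
rewrite ler_wpM2l ?exprn_ge0 ?p0 //.
apply: (@le_trans _ _ (1 * expR (- (a * p x)))); last by rewrite mul1r.
rewrite ler_pM ?cmod_ge0 ?expR_ge0 ?phi1 // ler_expR lerN2.
by rewrite ler_wpM2r ?p0.
Qed.

Lemma laplace_integrable n w : (0 < n)%N -> Cgt0 w ->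
  cintegrable mu D (fun x => toC (p x ^+ n) * (phi x * cexp (- (w * toC (p x))))).
Proof.
move=> n0 w0; have [B iB HB] := laplace_dom n0 w0.
by apply: (cintegrable_dom _ _ iB) => [//||x Dx]; [exact: cmeasurable_laplace|exact: HB].
Qed.

Lemma Re_near (w z : C R) : cmod (w - z) < Re z / 2 -> Re z / 2 <= Re w.
Proof.
move=> h; have := le_lt_trans (normRe_le _) h; rewrite cReB ltr_norml => /andP[h1 _].
lra.
Qed.

Lemma is_cderive_cexpM (q : R) (c w : C R) :
  is_cderive (fun w => c * cexp (- (w * toC q))) w (- (toC q * (c * cexp (- (w * toC q))))).
Proof.
have d1 : is_cderive (fun w => - (w * toC q)) w (- toC q).
  apply: is_cderiveN; have := is_cderiveM (is_cderive_id w) (is_cderive_cst (toC q) w).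
  by rewrite mul1r mulr0 addr0.
have d2 := @is_cderive_comp R (fun w => - (w * toC q)) (@cexp R) w _ _ (is_cderive_cexp _) d1.
have d3 := is_cderiveZ c d2; apply: (is_cderive_eq d3); ring.
Qed.

(** Only for n > 0: the measure may be infinite, so the integrand of order 0 need not be integrable;
    [laplace_exponent] subtracts it from 1. *)
Lemma is_cderive_laplace n w : (0 < n)%N -> Cgt0 w ->
  is_cderive (laplace_moment n) w (- laplace_moment n.+1 w).
Proof.
move=> n0 w0; have r0 : 0 < Re w / 2 by rewrite divr_gt0.
have [B iB HB] := laplace_dom (isT : (0 < n.+2)%N) r0.
pose f1 (w : C R) x : C R := - (toC (p x ^+ n.+1) * (phi x * cexp (- (w * toC (p x))))).
pose f2 (w : C R) x : C R := toC (p x ^+ n.+2) * (phi x * cexp (- (w * toC (p x)))).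
have i1 : cintegrable mu D (f1 w) by apply: cintegrableN => //; exact: laplace_integrable.
have -> : - laplace_moment n.+1 w = cintegral mu D (f1 w).
  by rewrite cintegralN //; exact: laplace_integrable.
apply: (is_cderive_integral mD (f2 := f2) r0 iB) => //.
  move=> v hv; apply: laplace_integrable => //; exact: lt_le_trans r0 (Re_near hv).
move=> v x hv Dx; split; last by apply: HB => //; exact: Re_near.
- have := is_cderive_cexpM (p x) (toC (p x ^+ n) * phi x) v.
  rewrite /f1 exprS toCM; under eq_fun do rewrite -mulrA.
  by move/is_cderive_eq; apply; ring.
- have := is_cderiveN (is_cderive_cexpM (p x) (toC (p x ^+ n.+1) * phi x) v).
  rewrite /f1 /f2 [in X in _ -> is_cderive _ _ X]exprS [in X in _ -> is_cderive _ _ X]toCM.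
  under eq_fun do rewrite -mulrA.
  by move/is_cderive_eq; apply; ring.
Qed.

Definition laplace_exponent (w : C R) : C R :=
  cintegral mu D (fun x => 1 - phi x * cexp (- (w * toC (p x)))).

Hypothesis ie : forall w : C R, Cge0 w ->
  cintegrable mu D (fun x => 1 - phi x * cexp (- (w * toC (p x)))).

Lemma is_cderive_laplace_exponent w : Cgt0 w ->
  is_cderive laplace_exponent w (laplace_moment 1 w).
Proof.
move=> w0; have r0 : 0 < Re w / 2 by rewrite divr_gt0.
have [B iB HB] := laplace_dom (isT : (0 < 2)%N) r0.
pose f2 (w : C R) x : C R := - (toC (p x ^+ 2) * (phi x * cexp (- (w * toC (p x))))).
apply: (@is_cderive_integral _ _ _ mu D mD
  (fun w x => 1 - phi x * cexp (- (w * toC (p x))))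
  (fun w x => toC (p x ^+ 1) * (phi x * cexp (- (w * toC (p x))))) f2 B w _ r0 iB).
- by move=> v hv; apply: ie; exact: ltW (lt_le_trans r0 (Re_near hv)).
- exact: laplace_integrable.
move=> v x hv Dx; split; last by rewrite /f2 cmodN; apply: HB => //; exact: Re_near.
- have := is_cderiveB (is_cderive_cst 1 v) (is_cderive_cexpM (p x) (phi x) v).
  by move/is_cderive_eq; apply; rewrite expr1; ring.
- have := is_cderive_cexpM (p x) (toC (p x ^+ 1) * phi x) v.
  rewrite /f2 expr2 expr1 toCM; under eq_fun do rewrite -mulrA.
  by move/is_cderive_eq; apply; ring.
Qed.

(** From |phi| <= 1: the real part is at least 1 - |phi| e^(- Re w p), and 1 >= |phi|. Keeping |phi|
    on the left matches the same factor in the moments. *)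
Lemma Re_integrand_ge w x : D x ->
  cmod (phi x) * (1 - expR (- (Re w * p x))) <= Re (1 - phi x * cexp (- (w * toC (p x)))).
Proof.
move=> Dx; rewrite cReB cRe1.
have := Re_le_cmod (phi x * cexp (- (w * toC (p x)))).
rewrite cmodM cmod_cexp cReN (mulrC w) Re_toCM (mulrC (p x)).
have := phi1 Dx; rewrite mulrBr mulr1; lra.
Qed.

Lemma Re_integrand_ge1 w x : D x ->
  1 - expR (- (Re w * p x)) <= Re (1 - phi x * cexp (- (w * toC (p x)))).
Proof.
move=> Dx; rewrite cReB cRe1 lerB //; apply: le_trans (Re_le_cmod _) _.
rewrite cmodM cmod_cexp cReN (mulrC w) Re_toCM (mulrC (p x)).
by rewrite ler_piMl ?expR_ge0 ?phi1.
Qed.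

(** The inequalities of [sub1_expRN_quad] at y = Re w * p x, weighted by |phi| and integrated. For
    kappa they become the bounds on the first two logarithmic derivatives. *)
Lemma cmod_laplace_moment_le w : Cgt0 w ->
  Re w * cmod (laplace_moment 1 w) <= Re (laplace_exponent w) /\
  Re w ^+ 2 * cmod (laplace_moment 2 w) <= 4 * Re (laplace_exponent w).
Proof.
move=> w0; have w0' := ltW w0; have [ir _] := ie w0'.
have key n (c : R) : (0 < n)%N -> 0 < c ->
    (forall y, 0 <= y -> y ^+ n * expR (- y) <= c * (1 - expR (- y))) ->
   Re w ^+ n * cmod (laplace_moment n w) <= c * Re (laplace_exponent w).
  move=> n0 c0 H; have wn : 0 < Re w ^+ n by rewrite exprn_gt0.
  rewrite mulrC -ler_pdivlMr // /laplace_exponent /= mulrAC -RintegralZl //.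
  apply: cmod_cintegral_le => //; [exact: laplace_integrable|exact: rintegrableZ|].
  move=> x Dx; rewrite cmod_laplace // mulrAC ler_pdivlMr // mulrC.
  apply: le_trans (ler_wpM2l (ltW c0) (Re_integrand_ge w Dx)).
  have wp : 0 <= Re w * p x by rewrite mulr_ge0 ?p0.
  rewrite [leLHS]mulrA -exprMn [leLHS]mulrCA [leRHS]mulrCA ler_wpM2l ?cmod_ge0 //.
  exact: H.
split.
  rewrite -[Re w in X in X <= _]expr1 -[X in _ <= X]mul1r; apply: key => // y y0.
  by rewrite expr1 mul1r; have [] := sub1_expRN_quad y0.
by apply: key => // y y0; have [] := sub1_expRN_quad y0.
Qed.

Lemma Re_laplace_exponent_ge w : Cgt0 w ->
  Rintegral mu D (fun x => 1 - expR (- p x)) <= 2 * (1 + (Re w)^-1) * Re (laplace_exponent w).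
Proof.
move=> w0; have w0' := ltW w0; have [ir _] := ie w0'.
rewrite /laplace_exponent /= -RintegralZl //; apply: le_Rintegral => //.
  exact: rintegrableZ.
move=> x Dx; apply: le_trans (sub1_expRN_cmp w0 (p0 Dx)) _.
rewrite ler_wpM2l ?Re_integrand_ge1 // mulr_ge0 // addr_ge0 // invr_ge0 //.
Qed.

Lemma laplace_moment1_eq0 w : Cgt0 w ->
  Rintegral mu D (fun x => 1 - expR (- p x)) = 0 -> laplace_moment 1 w = 0.
Proof.
move=> w0 e0; have [K K0 HK] := exprn_expRN_le (isT : (0 < 1)%N) w0.
apply/eqP; rewrite -cmod_eq0 eq_le cmod_ge0 andbT.
apply: (@le_trans _ _ (Rintegral mu D (fun x => K * (1 - expR (- p x))))).
  apply: cmod_cintegral_le => //; [exact: laplace_integrable|exact: rintegrableZ|].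
  move=> x Dx; rewrite cmod_laplace //; apply: le_trans (HK _ (p0 Dx)).
  by rewrite ler_wpM2l ?exprn_ge0 ?p0 // ler_piMl ?expR_ge0 ?phi1.
by rewrite RintegralZl // e0 mulr0.
Qed.

End LaplaceFamily.

(** * Logarithmic derivatives and the sawtooth form of E and T *)

Section SecondDerivatives.
Context {R : realType}.

Lemma derive1_is_derive (K : numFieldType) (f : K -> K) (x d : K) :
  is_derive x 1 f d -> derive1 f x = d.
Proof. by case=> _ <-; rewrite derive1E. Qed.

Lemma derive1n2_R (f f1 : R -> R) (u d : R) : 0 < u ->
  (forall v : R, 0 < v -> is_derive v 1 f (f1 v)) -> is_derive u 1 f1 d ->
  derive1n 2 f u = d.
Proof.
move=> u0 df df1; rewrite derive1nS derive1n1; apply: derive1_is_derive.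
apply: (@is_derive_near _ _ f1 _ _ u) => // h; rewrite ltr_norml => /andP[h1 h2].
apply: derive1_is_derive; apply: df; lra.
Qed.

Lemma derive1n2_C (f f1 : C R -> C R) (w d : C R) : Cgt0 w ->
  (forall v, Cgt0 v -> is_cderive f v (f1 v)) -> is_cderive f1 w d ->
  derive1n 2 f w = d.
Proof.
move=> w0 df df1; rewrite derive1nS derive1n1; apply: derive1_is_derive.
apply: (@is_cderive_near _ _ f1 _ _ (Re w)) => // h hh.
apply: derive1_is_derive; apply: df; rewrite /Cgt0 /= cReD.
have := le_lt_trans (normRe_le h) hh; rewrite ltr_norml => /andP[h1 _]; lra.
Qed.

Lemma rderive2E (f f1 : R -> C R) (u : R) (d : C R) : 0 < u ->
  (forall v : R, 0 < v -> is_rderive f v (f1 v)) -> is_rderive f1 u d ->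
  rderive2 f u = d.
Proof.
move=> u0 df [d1 d2]; apply: eq_ReIm; rewrite /rderive2 /=.
  exact: (derive1n2_R u0 (fun v v0 => (df v v0).1) d1).
exact: (derive1n2_R u0 (fun v v0 => (df v v0).2) d2).
Qed.

Lemma is_rderive_near (f g : R -> C R) (u : R) (d : C R) : 0 < u ->
  (forall v : R, 0 < v -> f v = g v) -> is_rderive g u d -> is_rderive f u d.
Proof.
move=> u0 fg [d1 d2]; split; [apply: (is_derive_near u0 _ d1) | apply: (is_derive_near u0 _ d2)];
  move=> h; rewrite ltr_norml => /andP[h1 h2]; rewrite fg //; lra.
Qed.

End SecondDerivatives.

Section LogKernel.
Context {R : realType}.
Local Notation leb := (@lebesgue_measure R).
Variables (k k1 k2 k3 : C R -> C R).
Hypothesis dk : forall w, Cgt0 w -> is_cderive k w (k1 w).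
Hypothesis dk1 : forall w, Cgt0 w -> is_cderive k1 w (k2 w).
Hypothesis dk2 : forall w, Cgt0 w -> is_cderive k2 w (k3 w).
Hypothesis kp : forall w, Cgt0 w -> 0 < Re (k w).
Hypothesis bk1 : forall w, Cgt0 w -> Re w * cmod (k1 w) <= Re (k w).
Hypothesis bk2 : forall w, Cgt0 w -> Re w ^+ 2 * cmod (k2 w) <= 4 * Re (k w).

Definition logk (w : C R) : C R := log0 (k w).
Definition logk1 (w : C R) : C R := k1 w / k w.
Definition logk2 (w : C R) : C R := k2 w / k w - logk1 w * logk1 w.
Definition logk3 (w : C R) : C R :=
  (k3 w / k w + k2 w * (- k1 w / k w ^+ 2)) - (logk2 w * logk1 w + logk1 w * logk2 w).

Let kn0 w : Cgt0 w -> k w != 0.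
Proof. by move=> /kp/neq0_Re_gt0. Qed.

Lemma is_cderive_logk w : Cgt0 w -> is_cderive logk w (logk1 w).
Proof.
move=> w0; rewrite /logk1 mulrC.
exact: (is_cderive_comp (is_cderive_log0 (kp w0)) (dk w0)).
Qed.

Lemma is_cderive_logk1 w : Cgt0 w -> is_cderive logk1 w (logk2 w).
Proof.
move=> w0; have := is_cderiveM (dk1 w0) (is_cderiveV (kn0 w0) (dk w0)).
move/is_cderive_eq; apply; rewrite /logk2 /logk1; field.
exact: kn0.
Qed.

Lemma is_cderive_logk2 w : Cgt0 w -> is_cderive logk2 w (logk3 w).
Proof.
move=> w0; apply: is_cderiveB.
  exact: is_cderiveM (dk2 w0) (is_cderiveV (kn0 w0) (dk w0)).
exact: is_cderiveM (is_cderive_logk1 w0) (is_cderive_logk1 w0).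
Qed.

Lemma cmod_logk1 w : Cgt0 w -> cmod (logk1 w) <= (Re w)^-1.
Proof.
move=> w0; rewrite /logk1 cmodM cmodV ler_pdivrMr ?cmod_gt0 ?kn0 //.
rewrite mulrC ler_pdivlMr // mulrC.
exact: le_trans (bk1 w0) (Re_le_cmod _).
Qed.

Lemma cmod_logk2 w : Cgt0 w -> cmod (logk2 w) <= 5 * (Re w) ^- 2.
Proof.
move=> w0; have w0' : 0 < Re w by [].
apply: le_trans (cmodB _ _) _.
(* The 4 bounds k'' / k and the remaining 1 bounds (k' / k)^2. *)
rewrite (_ : 5 * _ = 4 * (Re w) ^- 2 + (Re w)^-1 * (Re w)^-1); last first.
  by field; rewrite gt_eqF.
apply: lerD.
  rewrite cmodM cmodV ler_pdivrMr ?cmod_gt0 ?kn0 // mulrAC ler_pdivlMr ?exprn_gt0 //.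
  rewrite mulrC; apply: le_trans (bk2 w0) _.
  by rewrite ler_wpM2l // Re_le_cmod.
by rewrite cmodM ler_pM ?cmod_ge0 ?cmod_logk1.
Qed.

(** Both values of k lie in the right half-plane, so the logarithm of the quotient is the difference
    of the logarithms. *)
Lemma rderive2_logk (z : C R) (u : R) : 0 <= Re z -> 0 < u ->
  rderive2 (fun v => log0 (k (toC v + z) / k (toC v))) u = logk2 (toC u + z) - logk2 (toC u).
Proof.
move=> z0 u0.
have sh f f1 (v : R) : (forall w, Cgt0 w -> is_cderive f w (f1 w)) -> 0 < v ->
    is_rderive (fun v => f (toC v + z) - f (toC v)) v (f1 (toC v + z) - f1 (toC v)).
  move=> df v0; apply: is_rderiveB; first exact: is_rderive_shift.
  by apply: is_rderive_toC; exact: df.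
apply: (rderive2E (f1 := fun v => logk1 (toC v + z) - logk1 (toC v))) => //.
  move=> v v0; apply: (is_rderive_near (g := fun v => logk (toC v + z) - logk (toC v))) => //.
    move=> s s0; rewrite log0_div //; apply: kp; rewrite /Cgt0 /= ?cReD ?cReC //.
    by rewrite ltr_pwDl.
  exact/sh/v0/is_cderive_logk.
exact/sh/u0/is_cderive_logk1.
Qed.

Lemma E_logk (z : C R) : 0 <= Re z ->
  2^-1 * cintegral leb `[1, +oo[ (fun u => toC (Psaw u) *
     rderive2 (fun v => log0 (k (toC v + z) / k (toC v))) u) = saw_diff logk2 z 1.
Proof.
move=> z0; have q0 : 0 <= Re (0 : C R) by rewrite cRe0.
rewrite /saw_diff /saw_tail -mulrBr -cintegralB.
- congr (_ * _); apply: eq_cintegral => u; rewrite [X in X -> _]/= in_itv [X in X -> _]/= andbT => u1.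
  by rewrite rderive2_logk // ?addr0 ?mulrBr // (lt_le_trans ltr01).
- exact: measurable_itv.
- exact: (Psaw_l2_integrable is_cderive_logk2 cmod_logk2 ltr01 z0).
- exact: (Psaw_l2_integrable is_cderive_logk2 cmod_logk2 ltr01 q0).
Qed.

Lemma T_logk : 2^-1 * cintegral leb `[1, +oo[ (fun u => toC (Psaw u) *
       ((derive1 k (toC u) / k (toC u)) ^+ 2 - derive1n 2 k (toC u) / k (toC u)))
  = - saw_tail logk2 0 1.
Proof.
have q0 : 0 <= Re (0 : C R) by rewrite cRe0.
rewrite /saw_tail -mulrN -cintegralN.
- congr (_ * _); apply: eq_cintegral => u; rewrite [X in X -> _]/= in_itv [X in X -> _]/= andbT => u1.
  have u0 : Cgt0 (toC u) by rewrite /Cgt0 /= (lt_le_trans ltr01).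
  rewrite (derive1_is_derive (dk u0)) (derive1n2_C u0 dk (dk1 u0)) addr0.
  by rewrite -[RHS]mulrN /logk2 opprB expr2.
- exact: measurable_itv.
- exact: (Psaw_l2_integrable is_cderive_logk2 cmod_logk2 ltr01 q0).
Qed.

End LogKernel.

Section DegenerateKernel.
Context {R : realType}.
Local Notation leb := (@lebesgue_measure R).
Variables (k : C R -> C R) (c : C R).
Hypothesis kc : forall w, Cgt0 w -> k w = c.

(** The constant may be 0; then [log0 (c / c)] is a default value, but still independent of u, so
    its second derivative vanishes. *)
Lemma E_cst (z : C R) : 0 <= Re z ->
  2^-1 * cintegral leb `[1, +oo[ (fun u => toC (Psaw u) *
     rderive2 (fun v => log0 (k (toC v + z) / k (toC v))) u) = 0.
Proof.
move=> z0; transitivity (2^-1 * cintegral leb `[1, +oo[ (fun=> 0 : C R)); last first.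
  by rewrite /cintegral /Rintegral !integral0 mulr0.
congr (_ * _); apply: eq_cintegral.
move=> u; rewrite [X in X -> _]/= in_itv [X in X -> _]/= andbT => u1.
have u0 : 0 < u by exact: lt_le_trans u1.
rewrite (@rderive2E _ _ (fun=> 0) u 0) ?mulr0 //; last exact: is_rderive_cst.
move=> v v0; apply: (is_rderive_near (g := fun=> log0 (c / c))) => //; last exact: is_rderive_cst.
by move=> s s0; rewrite !kc // /Cgt0 /= cReD cReC ltr_pwDl.
Qed.

Lemma T_cst : 2^-1 * cintegral leb `[1, +oo[ (fun u => toC (Psaw u) *
       ((derive1 k (toC u) / k (toC u)) ^+ 2 - derive1n 2 k (toC u) / k (toC u))) = 0.
Proof.
transitivity (2^-1 * cintegral leb `[1, +oo[ (fun=> 0 : C R)); last first.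
  by rewrite /cintegral /Rintegral !integral0 mulr0.
congr (_ * _); apply: eq_cintegral.
move=> u; rewrite [X in X -> _]/= in_itv [X in X -> _]/= andbT => u1.
have u0 : Cgt0 (toC u) by rewrite /Cgt0 /= (lt_le_trans ltr01).
have dk v : Cgt0 v -> is_cderive k v 0.
  move=> v0; apply: (@is_cderive_near _ _ (fun=> c) _ _ (Re v)) => //; last exact: is_cderive_cst.
  move=> h hh; rewrite kc // /Cgt0 /= cReD.
  have := le_lt_trans (normRe_le h) hh; rewrite ltr_norml => /andP[h1 _]; lra.
rewrite (derive1_is_derive (dk _ u0)) (derive1n2_C u0 dk (is_cderive_cst 0 _)).
by rewrite !mul0r expr0n /= subrr mulr0.
Qed.

End DegenerateKernel.

(** * Bivariate Bernstein functions *)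

Section RealDominated.
Context d (T : measurableType d) {R : realType} (mu : {measure set T -> \bar R}).
Variables (D : set T) (mD : measurable D).

Lemma Rintegral_dominated0 (f : nat -> T -> R) (B : T -> R) :
  (forall n, measurable_fun D (f n)) -> mu.-integrable D (EFin \o B) ->
  (forall n x, D x -> `|f n x| <= B x) ->
  (forall x, D x -> f n x @[n --> \oo] --> (0 : R)) ->
  (fun n => Rintegral mu D (f n)) n @[n --> \oo] --> (0 : R).
Proof.
move=> mf iB fB f0.
have [] := @dominated_convergence _ _ _ mu D mD (fun n x => (f n x)%:E) (cst 0%E) (EFin \o B).
- by move=> n; exact/measurable_EFinP.
- exact: measurable_cst.
- apply: aeW => x Dx; apply: cvg_EFin; first exact: nearW.
  exact: f0.
- exact: iB.
- by apply: aeW => x n Dx; rewrite /= lee_fin; exact: fB.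
move=> _ _; rewrite integral0 => h.
exact: (@fine_cvg _ _ _ _ _ 0 h).
Qed.

End RealDominated.

Section Bernstein.
Context {R : realType}.
Variables (kappa : C R -> C R -> C R) (k00 d1 d2 : R).
Variable (mu : {measure set (R * R)%type -> \bar R}).
Hypothesis rep : bernstein2_rep kappa k00 d1 d2 mu.
Local Notation Q := (@quadrant R).

Lemma measurable_quadrant : measurable Q.
Proof.
have -> : Q = (`]0, +oo[%classic `*` `]0, +oo[%classic).
  by apply/seteqP; split => -[a b] /=; rewrite !in_itv /= !andbT.
by apply: measurableX; exact: measurable_itv.
Qed.
Let mQ := measurable_quadrant.

Definition expwt1 (zeta : C R) (x : R * R) : C R := cexp (- (zeta * toC x.1)).
Definition expwt2 (z : C R) (x : R * R) : C R := cexp (- (z * toC x.2)).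

Let mfst : measurable_fun Q (fst : R * R -> R).
Proof. exact: measurable_funTS measurable_fst. Qed.
Let msnd : measurable_fun Q (snd : R * R -> R).
Proof. exact: measurable_funTS measurable_snd. Qed.

Let fst0 x : Q x -> 0 <= x.1. Proof. by case=> /ltW. Qed.
Let snd0 x : Q x -> 0 <= x.2. Proof. by case=> _ /ltW. Qed.

Lemma cmeasurable_expwt1 zeta : cmeasurable Q (expwt1 zeta).
Proof.
apply: cmeasurable_cexp => //; apply: cmeasurableN => //.
by apply: cmeasurableM.
Qed.
Lemma cmeasurable_expwt2 z : cmeasurable Q (expwt2 z).
Proof.
apply: cmeasurable_cexp => //; apply: cmeasurableN => //.
by apply: cmeasurableM.
Qed.

Lemma cmod_expwt1 zeta x : cmod (expwt1 zeta x) = expR (- (Re zeta * x.1)).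
Proof. by rewrite cmod_cexp cReN mulrC Re_toCM mulrC. Qed.
Lemma cmod_expwt2 z x : cmod (expwt2 z x) = expR (- (Re z * x.2)).
Proof. by rewrite cmod_cexp cReN mulrC Re_toCM mulrC. Qed.

Lemma cmod_expwt1_le1 zeta : Cge0 zeta -> forall x, Q x -> cmod (expwt1 zeta x) <= 1.
Proof.
move=> z0 x Qx; rewrite cmod_expwt1 -expR0 ler_expR oppr_le0 mulr_ge0 //; exact: fst0.
Qed.
Lemma cmod_expwt2_le1 z : Cge0 z -> forall x, Q x -> cmod (expwt2 z x) <= 1.
Proof.
move=> z0 x Qx; rewrite cmod_expwt2 -expR0 ler_expR oppr_le0 mulr_ge0 //; exact: snd0.
Qed.

Lemma integrandE1 zeta z (x : R * R) :
  1 - cexp (- (zeta * toC x.1) - z * toC x.2) = 1 - expwt1 zeta x * cexp (- (z * toC x.2)).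
Proof. by rewrite cexpD. Qed.
Lemma integrandE2 zeta z (x : R * R) :
  1 - cexp (- (zeta * toC x.1) - z * toC x.2) = 1 - expwt2 z x * cexp (- (zeta * toC x.1)).
Proof. by rewrite cexpD mulrC. Qed.

Lemma integrable1 zeta z : Cge0 zeta -> Cge0 z ->
  cintegrable mu Q (fun x => 1 - expwt1 zeta x * cexp (- (z * toC x.2))).
Proof.
move=> h1 h2; have [_ _ _ _ /(_ _ _ h1 h2)[h _]] := rep.
by apply: eq_cintegrable h => // x _; exact: integrandE1.
Qed.
Lemma integrable2 zeta z : Cge0 zeta -> Cge0 z ->
  cintegrable mu Q (fun x => 1 - expwt2 z x * cexp (- (zeta * toC x.1))).
Proof.
move=> h1 h2; have [_ _ _ _ /(_ _ _ h1 h2)[h _]] := rep.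
by apply: eq_cintegrable h => // x _; exact: integrandE2.
Qed.

Let Cge00 : Cge0 (0 : C R). Proof. exact: lexx. Qed.
Let Cge01 : Cge0 (1 : C R). Proof. exact: ler01. Qed.

Lemma Re_integrand01 (a b : R) :
  Re (1 - cexp (- (0 * toC a)) * cexp (- (1 * toC b))) = 1 - expR (- b).
Proof. by rewrite mul0r oppr0 cexp0 !mul1r -toCN cexpC cReB cRe1 cReC. Qed.

Lemma Re_integrand10 (a b : R) :
  Re (1 - cexp (- (1 * toC a)) * cexp (- (0 * toC b))) = 1 - expR (- a).
Proof. by rewrite mul0r oppr0 cexp0 mulr1 !mul1r -toCN cexpC cReB cRe1 cReC. Qed.

Lemma Im_integrand_real (q a u v : R) :
  Im (1 - cexp (- (toC q * toC u)) * cexp (- (toC a * toC v))) = 0.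
Proof. by rewrite cImB cIm1 -!toCM -!toCN !cexpC -toCM cImC subr0. Qed.

(** Read off the integrability demanded by the representation at (zeta, z) = (0, 1), where the
    integrand is real. *)
Lemma integrable_snd : mu.-integrable Q (EFin \o (fun x : R * R => 1 - expR (- x.2))).
Proof.
have [h _] := integrable1 Cge00 Cge01; apply: eq_integrable h => // x _.
by congr (_%:E); exact: Re_integrand01.
Qed.
Lemma integrable_fst : mu.-integrable Q (EFin \o (fun x : R * R => 1 - expR (- x.1))).
Proof.
have [h _] := integrable1 Cge01 Cge00; apply: eq_integrable h => // x _.
by congr (_%:E); exact: Re_integrand10.
Qed.

Definition lap_exp (zeta z : C R) := laplace_exponent mu Q snd (expwt1 zeta) z.
Definition lap_mom (n : nat) (zeta z : C R) := laplace_moment mu Q snd (expwt1 zeta) n z.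

Lemma kappaE zeta z : Cge0 zeta -> Cge0 z ->
  kappa zeta z = toC k00 + toC d1 * zeta + toC d2 * z + lap_exp zeta z.
Proof.
move=> h1 h2; have [_ _ _ _ /(_ _ _ h1 h2)[_ ->]] := rep.
by congr (_ + _); apply: eq_cintegral => x _; exact: integrandE1.
Qed.

Lemma kappaE2 zeta z : Cge0 zeta -> Cge0 z ->
  kappa zeta z = toC k00 + toC d1 * zeta + toC d2 * z
    + laplace_exponent mu Q fst (expwt2 z) zeta.
Proof.
move=> h1 h2; have [_ _ _ _ /(_ _ _ h1 h2)[_ ->]] := rep.
by congr (_ + _); apply: eq_cintegral => x _; exact: integrandE2.
Qed.

Lemma Re_kappaE zeta z : Cge0 zeta -> Cge0 z ->
  Re (kappa zeta z) = k00 + d1 * Re zeta + d2 * Re z + Re (lap_exp zeta z).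
Proof. by move=> h1 h2; rewrite kappaE // !cReD !Re_toCM cReC. Qed.

Definition kappa1 (zeta z : C R) : C R := toC d2 + lap_mom 1 zeta z.
Definition kappa2 (zeta z : C R) : C R := - lap_mom 2 zeta z.
Definition kappa3 (zeta z : C R) : C R := lap_mom 3 zeta z.

Section FixedZeta.
Variable zeta : C R.
Hypothesis zeta0 : Cge0 zeta.

Lemma is_cderive_kappa z : Cgt0 z -> is_cderive (kappa zeta) z (kappa1 zeta z).
Proof.
move=> z0.
apply: (@is_cderive_near _ _ (fun z => toC k00 + toC d1 * zeta + toC d2 * z + lap_exp zeta z)
  _ _ (Re z)); [exact: z0| |].
  move=> h hh; rewrite kappaE // /Cge0 /= cReD.
  by have := le_lt_trans (normRe_le h) hh; rewrite ltr_norml => /andP[h1 _]; lra.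
apply: is_cderiveD.
  have := is_cderiveD (is_cderive_cst (toC k00 + toC d1 * zeta) z)
     (is_cderiveZ (toC d2) (is_cderive_id z)).
  by rewrite add0r mulr1.
apply: (is_cderive_laplace_exponent mQ msnd snd0 (cmeasurable_expwt1 zeta)
  (cmod_expwt1_le1 zeta0) integrable_snd _ z0).
by move=> w w0; exact: integrable1.
Qed.

Lemma is_cderive_kappa1 z : Cgt0 z -> is_cderive (kappa1 zeta) z (kappa2 zeta z).
Proof.
move=> z0; rewrite -[kappa2 _ _]add0r; apply: is_cderiveD; first exact: is_cderive_cst.
exact: (is_cderive_laplace mQ msnd snd0 (cmeasurable_expwt1 zeta)
  (cmod_expwt1_le1 zeta0) integrable_snd).
Qed.

Lemma is_cderive_kappa2 z : Cgt0 z -> is_cderive (kappa2 zeta) z (kappa3 zeta z).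
Proof.
move=> z0; rewrite -[kappa3 _ _]opprK; apply: is_cderiveN.
exact: (is_cderive_laplace mQ msnd snd0 (cmeasurable_expwt1 zeta)
  (cmod_expwt1_le1 zeta0) integrable_snd).
Qed.

Let mom_le z (z0 : Cgt0 z) := cmod_laplace_moment_le mQ msnd snd0 (cmeasurable_expwt1 zeta)
  (cmod_expwt1_le1 zeta0) integrable_snd (fun w w0 => integrable1 zeta0 w0) z0.

Lemma Re_lap_exp_ge0 z : Cgt0 z -> 0 <= Re (lap_exp zeta z).
Proof.
move=> z0; have [h _] := mom_le z0; apply: le_trans h.
by rewrite mulr_ge0 ?cmod_ge0 // ltW.
Qed.

Lemma Re_kappa_ge z : Cgt0 z -> Re (lap_exp zeta z) + d2 * Re z <= Re (kappa zeta z).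
Proof.
move=> z0; rewrite Re_kappaE //; last exact: ltW.
have [k0 e1 e2 _ _] := rep.
have : 0 <= d1 * Re zeta by rewrite mulr_ge0.
lra.
Qed.

Lemma cmod_kappa1 z : Cgt0 z -> Re z * cmod (kappa1 zeta z) <= Re (kappa zeta z).
Proof.
move=> z0; apply: le_trans (Re_kappa_ge z0); have [h _] := mom_le z0.
have [_ _ e2 _ _] := rep.
apply: (@le_trans _ _ (Re z * (d2 + cmod (lap_mom 1 zeta z)))).
  by rewrite ler_wpM2l ?(ltW z0) // (le_trans (cmodD _ _)) // cmodC ger0_norm.
by rewrite mulrDr addrC (mulrC d2) lerD2r.
Qed.

Lemma cmod_kappa2 z : Cgt0 z -> Re z ^+ 2 * cmod (kappa2 zeta z) <= 4 * Re (kappa zeta z).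
Proof.
move=> z0; have [_ h] := mom_le z0; rewrite /kappa2 cmodN; apply: le_trans h _.
rewrite ler_wpM2l //; apply: le_trans (Re_kappa_ge z0).
by have [_ _ e2 _ _] := rep; rewrite lerDl mulr_ge0 // ltW.
Qed.

Lemma Re_lap_exp_ge z : Cgt0 z ->
  Rintegral mu Q (fun x => 1 - expR (- x.2)) <= 2 * (1 + (Re z)^-1) * Re (lap_exp zeta z).
Proof.
move=> z0; apply: Re_laplace_exponent_ge => //.
- exact: cmod_expwt1_le1.
- exact: integrable_snd.
- by move=> w; exact: integrable1.
Qed.

End FixedZeta.

Lemma Re_kappa01 : Re (kappa 0 1) = k00 + d2 + Rintegral mu Q (fun x => 1 - expR (- x.2)).
Proof.
rewrite Re_kappaE // cRe0 cRe1 mulr0 mulr1 addr0; congr (_ + _).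
rewrite /lap_exp /laplace_exponent /=; apply: eq_Rintegral => x _.
exact: Re_integrand01.
Qed.

Lemma Rintegral_snd_ge0 : 0 <= Rintegral mu Q (fun x => 1 - expR (- x.2)).
Proof.
by apply: Rintegral_ge0 => x Qx; rewrite subr_ge0 -expR0 ler_expR oppr_le0 snd0.
Qed.

Lemma Re_kappa01_ge0 : 0 <= Re (kappa 0 1).
Proof.
by have [k0 _ e2 _ _] := rep; rewrite Re_kappa01 !addr_ge0 // Rintegral_snd_ge0.
Qed.

(** Re kappa is a sum of nonnegative terms. If it were not positive, k00, d2 and the Laplace part
    would vanish; by [Re_lap_exp_ge] the integral of 1 - e^(- x2) would vanish too, hence also Re
    kappa(0, 1). *)
Lemma Re_kappa_gt0 zeta z : 0 < Re (kappa 0 1) -> Cge0 zeta -> Cgt0 z ->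
  0 < Re (kappa zeta z).
Proof.
rewrite Re_kappa01 => pos h1 z0; rewrite ltNge; apply/negP => neg.
have [k0 e1 e2 _ _] := rep; have z0' : 0 < Re z by [].
have h2 := Re_lap_exp_ge h1 z0; have h3 := Re_lap_exp_ge0 h1 z0.
move: neg; rewrite Re_kappaE //; last exact: ltW.
have a1 : 0 <= d1 * Re zeta by rewrite mulr_ge0.
have a2 : 0 <= d2 * Re z by rewrite mulr_ge0 // ltW.
move=> neg.
have l0 : Re (lap_exp zeta z) = 0 by lra.
have k00' : k00 = 0 by lra.
have : d2 * Re z = 0 by lra.
move=> /eqP; rewrite mulf_eq0 (gt_eqF z0') orbF => /eqP d20.
by move: h2 pos; rewrite l0 mulr0 k00' d20; lra.
Qed.

(** Vanishing at (0, 1) annihilates d2 and the integral of 1 - e^(- x2), which dominates the first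
    moment; so the z-derivative is 0 on the segment from 1 to z. *)
Lemma kappa_degenerate zeta z : Re (kappa 0 1) = 0 -> Cge0 zeta -> Cgt0 z ->
  kappa zeta z = kappa zeta 1.
Proof.
rewrite Re_kappa01 => e h1 z0; have z0' : 0 < Re z by [].
have [k0 e1 e2 _ _] := rep; have i0 := Rintegral_snd_ge0.
have d20 : d2 = 0 by lra.
have l0 : Rintegral mu Q (fun x => 1 - expR (- x.2)) = 0 by lra.
have pos (t : R) : 0 <= t <= 1 -> Cgt0 (1 + toC t * (z - 1)).
  move=> /andP[t0 t1]; rewrite /Cgt0 /= cReD cRe1 Re_toCM cReB cRe1.
  have [->|tn] := eqVneq t 0; first by rewrite mul0r addr0.
  have : 0 < t * Re z by rewrite mulr_gt0 // lt_def tn.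
  by rewrite mulrBr mulr1; lra.
have k10 w : Cgt0 w -> kappa1 zeta w = 0.
  move=> w0; rewrite /kappa1 d20 toC0 add0r.
  exact: (laplace_moment1_eq0 mQ msnd snd0 (cmeasurable_expwt1 zeta)
    (cmod_expwt1_le1 h1) integrable_snd).
have := @cderive_bound _ (kappa zeta) (kappa1 zeta) 1 (z - 1) 0.
rewrite mul0r (addrC 1 (z - 1)) subrK => H.
apply/eqP; rewrite -subr_eq0 -cmod_eq0 eq_le cmod_ge0 andbT.
apply: H => t /pos h; first exact: is_cderive_kappa.
by rewrite k10 // cmod0.
Qed.

Lemma is_cderive_kappa_zeta zeta z : Cgt0 zeta -> Cge0 z ->
  exists dk, is_cderive (fun zeta => kappa zeta z) zeta dk.
Proof.
move=> h1 z0; exists (toC d1 + laplace_moment mu Q fst (expwt2 z) 1 zeta).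
apply: (@is_cderive_near _ _ (fun zeta => toC k00 + toC d1 * zeta + toC d2 * z +
  laplace_exponent mu Q fst (expwt2 z) zeta) _ _ (Re zeta)); [exact: h1| |].
  move=> h hh; apply: kappaE2 => //.
  rewrite /Cge0 /= cReD.
  by have := le_lt_trans (normRe_le h) hh; rewrite ltr_norml => /andP[h2 _]; lra.
apply: is_cderiveD.
  have := is_cderiveD (is_cderiveD (is_cderive_cst (toC k00) zeta)
     (is_cderiveZ (toC d1) (is_cderive_id zeta))) (is_cderive_cst (toC d2 * z) zeta).
  by rewrite add0r mulr1 addr0.
apply: (is_cderive_laplace_exponent mQ mfst fst0 (cmeasurable_expwt2 z)
  (cmod_expwt2_le1 z0) integrable_fst _ h1).
by move=> w w0; exact: integrable2.
Qed.

Lemma Im_kappa_real (q a : R) : 0 <= q -> 0 <= a -> Im (kappa (toC q) (toC a)) = 0.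
Proof.
move=> q0 a0; rewrite kappaE // !cImD !Im_toCM !cImC !mulr0 !add0r.
transitivity (Rintegral mu Q (fun=> 0)); last by rewrite /Rintegral integral0.
rewrite /lap_exp /laplace_exponent /=; apply: eq_Rintegral => x _.
exact: Im_integrand_real.
Qed.

(** The shift moves boundary points into the open half-plane. The integrands differ by at most 1 -
    e^(- h x1) with h = 1 / (n + 1) <= 1, which tends to 0 and is dominated by 1 - e^(- x1). *)
Lemma kappa_zeta_right_cvg zeta z (e : R) : Cge0 zeta -> Cge0 z -> 0 < e ->
  exists N, forall n, (N <= n)%N ->
    cmod (kappa (zeta + toC n.+1%:R^-1) z - kappa zeta z) <= e.
Proof.
move=> h1 h2 e0.
pose h (n : nat) : R := n.+1%:R^-1.
have hp n : 0 < h n by rewrite invr_gt0 ltr0n.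
have h1n n : h n <= 1 by rewrite /h invf_le1 ?ltr0n // ler1n.
have zn n : Cge0 (zeta + toC (h n)).
  by rewrite /Cge0 /= cReD cReC addr_ge0 // ltW.
pose f n (x : R * R) := 1 - expR (- (h n * x.1)).
have f0 n x : Q x -> 0 <= f n x.
  by move=> Qx; rewrite subr_ge0 -expR0 ler_expR oppr_le0 mulr_ge0 ?(ltW (hp n)) ?fst0.
have fB n x : Q x -> `|f n x| <= 1 - expR (- x.1).
  move=> Qx; rewrite ger0_norm ?f0 // lerB // ler_expR lerN2.
  by rewrite ler_piMl ?fst0.
have mf n : measurable_fun Q (f n).
  apply: measurable_funB; first exact: measurable_cst.
  apply: (measurableT_comp (@measurable_expR R)); apply: measurable_funN.
  by apply: measurable_funM => //; exact: measurable_cst.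
have hc : h n @[n --> \oo] --> (0 : R) by exact: cvg_harmonic.
have fc x : Q x -> f n x @[n --> \oo] --> (0 : R).
  move=> Qx; rewrite [X in _ --> X](_ : 0 = 1 - expR (- (0 * x.1))); last first.
    by rewrite mul0r oppr0 expR0 subrr.
  apply: cvgB; first exact: cvg_cst.
  apply: (continuous_cvg _ (@continuous_expR R _)); apply: cvgN.
  by apply: cvgM => //; exact: cvg_cst.
have Hc := Rintegral_dominated0 mQ mf integrable_fst fB fc.
have Hd : (d1 * h n + Rintegral mu Q (f n)) @[n --> \oo] --> (0 : R).
  rewrite [X in _ --> X](_ : 0 = d1 * 0 + 0); last by rewrite mulr0 addr0.
  by apply: cvgD => //; apply: cvgM => //; exact: cvg_cst.
have [N _ HN] := (cvgr0Pnorm_le _).1 Hd e e0.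
exists N => n Nn; have := HN n Nn; apply: le_trans; apply: le_trans (ler_norm _).
rewrite !kappaE // -/(h n).
have ii := integrable1 (zn n) h2; have ij := integrable1 h1 h2.
rewrite (_ : _ - _ = toC d1 * toC (h n) + (lap_exp (zeta + toC (h n)) z - lap_exp zeta z));
  last by ring.
apply: le_trans (cmodD _ _) _; have [_ d10 _ _ _] := rep.
rewrite -toCM cmodC ger0_norm ?mulr_ge0 ?(ltW (hp n)) // lerD2l.
rewrite /lap_exp /laplace_exponent -cintegralB //; apply: cmod_cintegral_le => //.
- exact: cintegrableB.
- by apply: rintegrable_dom integrable_fst _ => // x; exact: fB.
move=> x Qx; rewrite (_ : _ - _ = expwt1 zeta x * cexp (- (z * toC x.2)) *
   toC (1 - expR (- (h n * x.1)))); last first.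
  rewrite /expwt1 mulrDl opprD cexpD -toCM -toCN cexpC toCB toC1; ring.
rewrite !cmodM cmodC -/(f n x) ger0_norm ?f0 // ler_piMl ?f0 //.
  have p1 := cmod_expwt1_le1 h1 Qx.
  have p2 : cmod (cexp (- (z * toC x.2))) <= 1 := cmod_expwt2_le1 h2 Qx.
  by rewrite mulr_ile1 ?cmod_ge0.
exact: zn.
Qed.

Lemma Re_kappa_mono (q q' : R) (w : C R) : 0 <= q' -> q' <= q -> 1 <= Re w ->
  Re (kappa (toC q') 1) <= Re (kappa (toC q) w).
Proof.
move=> q0 qq w1; have qq0 : 0 <= q by exact: le_trans qq.
have w0 : Cge0 w by exact: le_trans w1.
rewrite !Re_kappaE //; have [k0 e1 e2 _ _] := rep.
have [i1 _] := integrable1 (zeta := toC q') (z := 1) q0 Cge01.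
have [i2 _] := integrable1 (zeta := toC q) (z := w) qq0 w0.
apply: lerD; first by rewrite !cReC !lerD // ler_wpM2l.
apply: le_Rintegral => // x Qx; have := Re_le_cmod (expwt1 (toC q) x * cexp (- (w * toC x.2))).
rewrite cmodM cmod_expwt1 cmod_cexp cReN (mulrC w) Re_toCM cReC => h.
rewrite !cReB !cRe1 lerB //; apply: le_trans h _.
rewrite /expwt1 -toCM -toCN cexpC mul1r -toCN cexpC -toCM cReC.
rewrite ler_pM ?expR_ge0 // ler_expR lerN2.
  by rewrite ler_wpM2r ?fst0.
by rewrite ler_peMr ?snd0.
Qed.

(** The moment at w = 1; it majorises |lap_mom n q w| for all w with Re w >= 1, hence uniformly. *)
Definition real_mom (n : nat) (q : R) :=
  Rintegral mu Q (fun x => x.2 ^+ n * (expR (- (q * x.1)) * expR (- x.2))).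

Lemma real_mom_dom (n : nat) : (0 < n)%N -> exists2 B : R * R -> R,
  mu.-integrable Q (EFin \o B) & forall q x, 0 <= q -> Q x ->
  `|x.2 ^+ n * (expR (- (q * x.1)) * expR (- x.2))| <= B x.
Proof.
move=> n0; have [K K0 HK] := @exprn_expRN_le R n 1 n0 ltr01.
exists (fun x => K * (1 - expR (- x.2))); first by apply: rintegrableZ => //; exact: integrable_snd.
move=> q x q0 Qx; rewrite ger0_norm ?mulr_ge0 ?exprn_ge0 ?expR_ge0 ?snd0 //.
apply: le_trans (HK _ (snd0 Qx)); rewrite mul1r ler_wpM2l ?exprn_ge0 ?snd0 //.
by rewrite ler_piMl ?expR_ge0 // -expR0 ler_expR oppr_le0 mulr_ge0 ?fst0.
Qed.

Lemma measurable_real_mom (n : nat) (q : R) :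
  measurable_fun Q (fun x : R * R => x.2 ^+ n * (expR (- (q * x.1)) * expR (- x.2))).
Proof.
apply: measurable_funM; first exact: measurable_funX.
apply: measurable_funM; apply: (measurableT_comp (@measurable_expR R)); apply: measurable_funN => //.
by apply: measurable_funM => //; exact: measurable_cst.
Qed.

Lemma integrable_real_mom (n : nat) (q : R) : (0 < n)%N -> 0 <= q ->
  mu.-integrable Q (EFin \o (fun x : R * R => x.2 ^+ n * (expR (- (q * x.1)) * expR (- x.2)))).
Proof.
move=> n0 q0; have [B iB HB] := real_mom_dom n0.
by apply: rintegrable_dom iB _ => // [|x Qx]; [exact: measurable_real_mom|exact: HB].
Qed.

Lemma real_mom_ge0 n q : 0 <= real_mom n q.
Proof.
by apply: Rintegral_ge0 => x Qx; rewrite !mulr_ge0 ?exprn_ge0 ?expR_ge0 ?snd0.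
Qed.

Lemma real_mom_mono (n : nat) (q q' : R) : (0 < n)%N -> 0 <= q' -> q' <= q ->
  real_mom n q <= real_mom n q'.
Proof.
move=> n0 q0 qq; apply: le_Rintegral => //.
- by apply: integrable_real_mom => //; exact: le_trans qq.
- exact: integrable_real_mom.
move=> x Qx; rewrite ler_wpM2l ?exprn_ge0 ?snd0 // ler_wpM2r ?expR_ge0 // ler_expR lerN2.
by rewrite ler_wpM2r ?fst0.
Qed.

Lemma cmod_lap_mom_le (n : nat) (q : R) (w : C R) : (0 < n)%N -> 0 <= q -> 1 <= Re w ->
  cmod (lap_mom n (toC q) w) <= real_mom n q.
Proof.
move=> n0 q0 w1; have w0 : Cgt0 w by exact: lt_le_trans w1.
apply: cmod_cintegral_le => //; last move=> x Qx.
- exact: (laplace_integrable mQ msnd snd0 (cmeasurable_expwt1 (toC q))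
    (@cmod_expwt1_le1 (toC q) q0) integrable_snd).
- exact: integrable_real_mom.
rewrite (@cmod_laplace _ _ _ Q snd (expwt1 (toC q)) snd0 n w x Qx).
rewrite cmod_expwt1 cReC ler_wpM2l ?exprn_ge0 ?snd0 // ler_wpM2l ?expR_ge0 // ler_expR lerN2.
by rewrite ler_peMl ?snd0.
Qed.

Lemma expRN_nat_cvg0 (x : R) : 0 < x -> expR (- (j%:R * x)) @[j --> \oo] --> (0 : R).
Proof.
move=> x0; under eq_fun do rewrite -mulrN expRM_natl.
by apply: cvg_expr; rewrite ger0_norm ?expR_ge0 // -expR0 ltr_expR oppr_lt0.
Qed.

(** Dominated convergence along integers q, extended to real q by monotonicity. *)
Lemma real_mom_cvg0 (n : nat) (e : R) : (0 < n)%N -> 0 < e ->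
  exists2 q0 : R, 0 <= q0 & forall q, q0 <= q -> real_mom n q <= e.
Proof.
move=> n0 e0; have [B iB HB] := real_mom_dom n0.
pose f (j : nat) (x : R * R) := x.2 ^+ n * (expR (- (j%:R * x.1)) * expR (- x.2)).
have fc x : Q x -> f j x @[j --> \oo] --> (0 : R).
  move=> [x1 x2]; rewrite [X in _ --> X](_ : 0 = x.2 ^+ n * (0 * expR (- x.2))); last first.
    by rewrite mul0r mulr0.
  apply: cvgM; first exact: cvg_cst.
  by apply: cvgM; [exact: expRN_nat_cvg0|exact: cvg_cst].
have Hc := Rintegral_dominated0 mQ (fun j => measurable_real_mom n j%:R) iB
  (fun j x => HB j%:R x (ler0n _ _)) fc.
have [N _ HN] := (cvgr0Pnorm_le _).1 Hc e e0.
exists N%:R => // q Nq; apply: le_trans (real_mom_mono n0 (ler0n _ N) Nq) _.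
by apply: le_trans (ler_norm _) _; exact: (HN N (leqnn N)).
Qed.

(** Either the drift term d1 q grows, or the integrals of 1 - e^(- j x1) increase to the infinite
    mass of the quadrant by monotone convergence. *)
Lemma Re_kappa_unbounded (A : R) : 0 < d1 \/ mu Q = +oo%E ->
  exists2 q0 : R, 0 <= q0 & forall q, q0 <= q -> A <= Re (kappa (toC q) 1).
Proof.
have [k0 e1 e2 _ _] := rep.
have l0 (q : R) : 0 <= q -> 0 <= Re (lap_exp (toC q) 1).
  by move=> q0; apply: Re_lap_exp_ge0 => //; exact: ltr01.
case=> [d10|muoo].
  exists `|A / d1| => // q hq; have q0 : 0 <= q by exact: le_trans hq.
  rewrite Re_kappaE // cReC cRe1 mulr1; have := l0 q q0.
  have : A <= d1 * q by rewrite mulrC -ler_pdivrMr // (le_trans (ler_norm _)).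
  lra.
pose g (j : nat) (x : R * R) := (1 - expR (- (j%:R * x.1)))%:E.
have mg j : measurable_fun Q (g j).
  apply/measurable_EFinP; apply: measurable_funB; first exact: measurable_cst.
  apply: (measurableT_comp (@measurable_expR R)); apply: measurable_funN.
  by apply: measurable_funM => //; exact: measurable_cst.
have g0 j x : Q x -> (0 <= g j x)%E.
  by move=> Qx; rewrite lee_fin subr_ge0 -expR0 ler_expR oppr_le0 mulr_ge0 ?fst0.
have gn x : Q x -> nondecreasing_seq (g ^~ x).
  move=> Qx i j ij; rewrite lee_fin lerB // ler_expR lerN2 ler_wpM2r ?fst0 //.
  by rewrite ler_nat.
have := @cvg_monotone_convergence _ _ _ mu Q mQ g mg g0 gn.
have -> : (\int[mu]_(x in Q) limn (g ^~ x) = +oo)%E.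
  rewrite -muoo -[RHS]mul1e -integral_cst //.
  apply: eq_integral => x; rewrite inE => -[x1 _].
  apply/cvg_lim => //; apply: cvg_EFin; first exact: nearW.
  rewrite -[X in _ --> X]subr0; apply: cvgB; first exact: cvg_cst.
  exact: expRN_nat_cvg0.
move=> /cvgeyPge/(_ A)[N _ HN]; exists N%:R => // q hq.
have R11 : 1 <= Re (1 : C R) by rewrite cRe1.
apply: le_trans (@Re_kappa_mono q N%:R (1 : C R) (ler0n _ N) hq R11).
have := HN N (leqnn N); rewrite /= => h.
have [iN _] := integrable1 (zeta := toC N%:R) (z := 1) (ler0n R N) Cge01.
rewrite Re_kappaE //; last exact: ler0n.
rewrite cReC cRe1 mulr1.
have : A <= Re (lap_exp (toC N%:R) 1).
  rewrite -lee_fin; apply: (le_trans h).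
  rewrite (_ : Re (lap_exp _ _) = Rintegral mu Q
    (fun x => Re (1 - expwt1 (toC N%:R) x * cexp (- (1 * toC x.2))))) //.
  rewrite /Rintegral fineK; last exact: integrable_fin_num.
  have le x : Q x -> 1 - expR (- (N%:R * x.1)) <=
      Re (1 - expwt1 (toC N%:R) x * cexp (- (1 * toC x.2))).
    move=> Qx; rewrite cReB cRe1 lerB //; apply: le_trans (Re_le_cmod _) _.
    rewrite cmodM cmod_expwt1 cmod_cexp mul1r cReN.
    by rewrite ler_piMr ?expR_ge0 // -expR0 ler_expR oppr_le0 snd0.
  have mR := measurable_int _ iN.
  by apply: ge0_le_integral => // x Qx; exact: g0.
have : 0 <= d1 * N%:R by rewrite mulr_ge0.
lra.
Qed.

(* Either [kappa q 1] is unbounded in [q] while the moments of [mu] stay bounded,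
   or [d2 = 0] and the moments tend to 0 by dominated convergence. *)
Lemma log_curvature_cvg0 (e : R) : 0 < Re (kappa 0 1) ->
  [\/ d2 = 0, 0 < d1 | mu Q = +oo%E] -> 0 < e ->
  exists2 q0 : R, 0 <= q0 & forall (q : R) (w : C R), q0 <= q -> 1 <= Re w ->
   cmod (kappa2 (toC q) w / kappa (toC q) w
     - kappa1 (toC q) w / kappa (toC q) w * (kappa1 (toC q) w / kappa (toC q) w)) <= e.
Proof.
move=> nd H e0; have [k0 e1 e2 _ _] := rep.
(* Since eta <= 1, the squared logarithmic derivative is at most eta^2 <= eta, so the two terms add
   up to at most 2 eta <= e. *)
pose eta := Num.min 1 (e / 2).
have eta0 : 0 < eta by rewrite lt_min ltr01 divr_gt0.
suff [q0 q00 Hq] : exists2 q0 : R, 0 <= q0 & forall q, q0 <= q ->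
    d2 + real_mom 1 q <= eta * Re (kappa (toC q) 1) /\ real_mom 2 q <= eta * Re (kappa (toC q) 1).
  exists q0 => // q w qq w1; have qp : 0 <= q by exact: le_trans qq.
  have [b1 b2] := Hq q qq.
  have mm := Re_kappa_mono qp (lexx q) w1.
  have kw : 0 < Re (kappa (toC q) 1) by apply: Re_kappa_gt0 => //; exact: ltr01.
  have kw' : Re (kappa (toC q) 1) <= cmod (kappa (toC q) w).
    exact: le_trans mm (Re_le_cmod _).
  have kp : 0 < cmod (kappa (toC q) w) by exact: lt_le_trans kw'.
  have c1 : cmod (kappa1 (toC q) w / kappa (toC q) w) <= eta.
    rewrite cmodM cmodV ler_pdivrMr //; apply: le_trans (ler_wpM2l (ltW eta0) kw').
    apply: le_trans b1; apply: le_trans (cmodD _ _) _; rewrite cmodC ger0_norm // lerD2l.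
    exact: cmod_lap_mom_le.
  have c2 : cmod (kappa2 (toC q) w / kappa (toC q) w) <= eta.
    rewrite cmodM cmodV ler_pdivrMr //; apply: le_trans (ler_wpM2l (ltW eta0) kw').
    by apply: le_trans b2; rewrite cmodN; exact: cmod_lap_mom_le.
  apply: le_trans (cmodB _ _) _; rewrite [X in _ + X]cmodM.
  have ee : eta <= e / 2 by rewrite ge_min lexx orbT.
  have ee1 : eta <= 1 by rewrite ge_min lexx.
  have : cmod (kappa1 (toC q) w / kappa (toC q) w) * cmod (kappa1 (toC q) w / kappa (toC q) w) <= eta * 1.
    by rewrite ler_pM ?cmod_ge0 // (le_trans c1).
  by move: c2 ee; lra.
have m0 (q : R) : 0 <= q -> Re (kappa 0 1) <= Re (kappa (toC q) 1).
  move=> qp; have R11 : 1 <= Re (1 : C R) by rewrite cRe1.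
  exact: (@Re_kappa_mono q 0 (1 : C R) (lexx 0) qp R11).
have [d20|H'] : d2 = 0 \/ (0 < d1 \/ mu Q = +oo%E) by case: H; tauto.
  have ec : 0 < eta * Re (kappa 0 1) by rewrite mulr_gt0.
  have [q1 q10 H1] := real_mom_cvg0 (isT : (0 < 1)%N) ec.
  have [q2 q20 H2] := real_mom_cvg0 (isT : (0 < 2)%N) ec.
  exists (Num.max q1 q2) => [|q]; first by rewrite le_max q10.
  rewrite ge_max => /andP[a1 a2]; have qp : 0 <= q by exact: le_trans a1.
  have mq : eta * Re (kappa 0 1) <= eta * Re (kappa (toC q) 1) by rewrite ler_wpM2l ?m0 // ltW.
  by rewrite d20 add0r; split; apply: le_trans mq; [exact: H1|exact: H2].
have [q0 q00 Hq] := Re_kappa_unbounded ((d2 + real_mom 1 0 + real_mom 2 0) / eta) H'.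
exists q0 => // q qq; have qp : 0 <= q by exact: le_trans qq.
have := Hq q qq; rewrite ler_pdivrMr // mulrC => h.
have r1 := real_mom_mono (isT : (0 < 1)%N) (lexx 0) qp.
have r2 := real_mom_mono (isT : (0 < 2)%N) (lexx 0) qp.
have := real_mom_ge0 1 0; have := real_mom_ge0 2 0; move: h r1 r2 => h r1 r2 p2 p1.
split; apply: le_trans h; first by rewrite -addrA lerD2l (le_trans r1) // lerDl.
by rewrite (le_trans r2) // lerDr addr_ge0.
Qed.

End Bernstein.

(** * Goursat's theorem and the maximum principle *)

Section Antiderivative.
Context {R : realType}.
Local Notation leb := (@lebesgue_measure R).

Lemma antiderivative_exists (g g1 : R -> C R) (a b : R) : a < b ->
  (forall x, a <= x <= b -> is_rderive g x (g1 x)) ->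
  exists G : R -> C R, forall x, a < x < b -> is_rderive G x (g x).
Proof.
move=> ab H; have [i1 i2] := cintegrable_is_rderive H.
exists (fun x => cintegral leb `[a, x] g) => x /andP[ax xb].
have [[d1 _] [d2 _]] := H x (introT andP (conj (ltW ax) (ltW xb))).
have key (p : R -> R) : leb.-integrable `[a, b] (EFin \o p) -> derivable p x 1 ->
    is_derive x 1 (fun x => Rintegral leb `[a, x] p) (p x).
  move=> ip dp; have cp := derivable_continuous dp.
  have [h1 h2] := continuous_FTC1_closed xb ip ax cp.
  by apply: DeriveDef; [exact: h1|rewrite -derive1E h2].
by split; [exact: (key _ i1 d1)|exact: (key _ i2 d2)].
Qed.

End Antiderivative.

Section Goursat.
Context {R : realType}.
Implicit Types (f : C R -> C R) (A B : R -> R -> C R) (a b x y : R).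

Definition iC : C R := Complex 0 1.

Lemma ComplexE x y : Complex x y = toC x + toC y * iC :> C R.
Proof. by apply: eq_ReIm; rewrite !cReIm /=; ring. Qed.

Lemma cmod_iC : cmod iC = 1.
Proof. by rewrite cmodE /= expr0n expr1n add0r sqrtr1. Qed.

Lemma iC_sqr : iC * iC = -1.
Proof. by apply: eq_ReIm; rewrite !cReIm /=; ring. Qed.

Lemma is_rderive_horiz f x y d : is_cderive f (Complex x y) d ->
  is_rderive (fun t => f (Complex t y)) x d.
Proof.
move=> H; rewrite (_ : (fun t => _) = (fun t => f (toC y * iC + toC t * 1))); last first.
  by apply/funext => t; rewrite ComplexE mulr1 addrC.
rewrite -[d]mulr1; apply: is_rderive_line.
by rewrite mulr1 addrC -ComplexE.
Qed.

Lemma is_rderive_vert f x y d : is_cderive f (Complex x y) d ->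
  is_rderive (fun t => f (Complex x t)) y (d * iC).
Proof.
move=> H; rewrite (_ : (fun t => _) = (fun t => f (toC x + toC t * iC))); last first.
  by apply/funext => t; rewrite ComplexE.
by apply: is_rderive_line; rewrite -ComplexE.
Qed.

(** The counterclockwise contour integral around [a, b] x [c, d], written with primitives A and B of
    f along horizontal and vertical lines. Additivity under subdivision becomes an algebraic
    identity. *)
Definition rect_int A B a b c d : C R :=
  (A b c - A a c) - (A b d - A a d) + iC * ((B b d - B b c) - (B a d - B a c)).

Definition in_rect a b c d x y := a <= x <= b /\ c <= y <= d.

Definition primitives f A B a b c d :=
  (forall x y, in_rect a b c d x y -> is_rderive (A^~ y) x (f (Complex x y))) /\
  (forall x y, in_rect a b c d x y -> is_rderive (B x) y (f (Complex x y))).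

Lemma primitives_sub f A B a b c d a' b' c' d' :
  a <= a' -> b' <= b -> c <= c' -> d' <= d ->
  primitives f A B a b c d -> primitives f A B a' b' c' d'.
Proof.
move=> h1 h2 h3 h4 [H1 H2]; split => x y [/andP[p1 p2] /andP[p3 p4]]; [apply: H1|apply: H2];
  by split; apply/andP; split; apply: le_trans; eassumption.
Qed.

(* Both sides of the rectangle integral of the affine function
   [alpha + beta s] vanish, so only the deviation of [f] from it counts. *)
Lemma rect_int_affine f A B a b c d (alpha beta : C R) (M : R) :
  a <= b -> c <= d -> primitives f A B a b c d ->
  (forall x y, in_rect a b c d x y ->
     cmod (f (Complex x y) - (alpha + beta * Complex x y)) <= M) ->
  cmod (rect_int A B a b c d) <= 2 * M * ((b - a) + (d - c)).
Proof.
move=> ab cd [hA hB] HM.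
pose G (s : C R) := alpha * s + beta * (2^-1 * (s * s)).
have dG s : is_cderive G s (alpha + beta * s).
  have d1 := is_cderiveZ alpha (is_cderive_id s).
  have d2 := is_cderiveZ beta (is_cderiveZ 2^-1 (is_cderiveM (is_cderive_id s) (is_cderive_id s))).
  have := is_cderiveD d1 d2; move/is_cderive_eq; apply; by field.
pose A' x y := A x y - G (Complex x y).
pose B' x y := B x y - (- iC) * G (Complex x y).
have bA y : c <= y <= d -> cmod (A' b y - A' a y) <= M * (b - a).
  move=> hy; apply: (@mean_value_ineq _ (A'^~ y)
    (fun x => f (Complex x y) - (alpha + beta * Complex x y))) => // t ht.
    by apply: is_rderiveB; [exact: hA|exact: is_rderive_horiz (dG _)].
  exact: HM.
have bB x : a <= x <= b -> cmod (B' x d - B' x c) <= M * (d - c).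
  move=> hx; apply: (@mean_value_ineq _ (B' x)
    (fun y => f (Complex x y) - (alpha + beta * Complex x y))) => // t ht.
    apply: is_rderiveB; first exact: hB.
    have := is_rderiveZ (- iC) (is_rderive_vert (dG (Complex x t))).
    by rewrite mulrCA mulNr iC_sqr opprK mulr1.
  exact: HM.
have -> : rect_int A B a b c d = (A' b c - A' a c) - (A' b d - A' a d)
    + iC * ((B' b d - B' b c) - (B' a d - B' a c)).
  apply/eqP; rewrite -subr_eq0; apply/eqP; rewrite /rect_int /A' /B'.
  rewrite (_ : _ - _ = - (1 + iC * iC) * (G (Complex b d) - G (Complex b c)
     - G (Complex a d) + G (Complex a c))); last by ring.
  by rewrite iC_sqr subrr oppr0 mul0r.
have l1 := bA c (introT andP (conj (lexx c) cd)); have l2 := bA d (introT andP (conj cd (lexx d))).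
have l3 := bB a (introT andP (conj (lexx a) ab)); have l4 := bB b (introT andP (conj ab (lexx b))).
apply: le_trans (cmodD _ _) _; rewrite cmodM cmod_iC mul1r.
rewrite (_ : 2 * M * _ = (M * (b - a) + M * (b - a)) + (M * (d - c) + M * (d - c))); last by ring.
by apply: lerD; apply: le_trans (cmodB _ _) _; exact: lerD.
Qed.

Lemma rect_int_quarter A B a b c d (K m n : R) : K < cmod (rect_int A B a b c d) ->
  [\/ K / 4 < cmod (rect_int A B a m c n), K / 4 < cmod (rect_int A B m b c n),
     K / 4 < cmod (rect_int A B a m n d) | K / 4 < cmod (rect_int A B m b n d)].
Proof.
have -> : rect_int A B a b c d = rect_int A B a m c n + rect_int A B m b c n
  + rect_int A B a m n d + rect_int A B m b n d by rewrite /rect_int; ring.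
move=> h; have [h1|h1] := ltP (K / 4) (cmod (rect_int A B a m c n)); first by constructor 1.
have [h2|h2] := ltP (K / 4) (cmod (rect_int A B m b c n)); first by constructor 2.
have [h3|h3] := ltP (K / 4) (cmod (rect_int A B a m n d)); first by constructor 3.
have [h4|h4] := ltP (K / 4) (cmod (rect_int A B m b n d)); first by constructor 4.
have := lt_le_trans h (le_trans (cmodD _ _) (lerD (le_trans (cmodD _ _) (lerD (cmodD _ _) (lexx _))) (lexx _))).
move: h1 h2 h3 h4; lra.
Qed.

Section Bisection.
Variables (A B : R -> R -> C R) (a b c d eta : R).
Hypotheses (ab : a <= b) (cd : c <= d).
Hypothesis Jbig : eta < cmod (rect_int A B a b c d).

Let p := b - a.
Let q := d - c.
(** The bisection invariant: [s] is the lower left corner of a rectangle of generation n whose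
    contour integral exceeds eta / 4^n. *)
Let P (n : nat) (s : R * R) :=
  [/\ a <= s.1, s.1 + p / 2 ^+ n <= b, c <= s.2, s.2 + q / 2 ^+ n <= d &
   eta / 4 ^+ n < cmod (rect_int A B s.1 (s.1 + p / 2 ^+ n) s.2 (s.2 + q / 2 ^+ n))].
(** Stated as an implication, so that every [s] has a successor and the sequence is defined by plain
    recursion on a choice function. *)
Let step (n : nat) (s t : R * R) := P n s -> [/\ P n.+1 t, s.1 <= t.1, s.2 <= t.2,
  t.1 + p / 2 ^+ n.+1 <= s.1 + p / 2 ^+ n & t.2 + q / 2 ^+ n.+1 <= s.2 + q / 2 ^+ n].

Let step_ex n s : exists t, step n s t.
Proof.
have [Ps|nP] := pselect (P n s); last by exists s => /nP.
case: (Ps) => h1 h2 h3 h4 h5.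
have p0 : 0 <= p / 2 ^+ n.+1 by rewrite divr_ge0 ?exprn_ge0 ?subr_ge0.
have q0 : 0 <= q / 2 ^+ n.+1 by rewrite divr_ge0 ?exprn_ge0 ?subr_ge0.
have dbl (r : R) : r / 2 ^+ n = r / 2 ^+ n.+1 + r / 2 ^+ n.+1.
  by rewrite exprS invfM mulrA -mulrDl -splitr.
have e4 : eta / 4 ^+ n.+1 = eta / 4 ^+ n / 4 by rewrite exprS invfM mulrCA mulrC.
have := rect_int_quarter (s.1 + p / 2 ^+ n.+1) (s.2 + q / 2 ^+ n.+1) h5.
rewrite -e4 !dbl !addrA => H.
move: h2 h4; rewrite !dbl !addrA => h2 h4.
have [t Ht] : exists t : R * R, [/\ (t.1 = s.1 \/ t.1 = s.1 + p / 2 ^+ n.+1),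
    (t.2 = s.2 \/ t.2 = s.2 + q / 2 ^+ n.+1) &
    eta / 4 ^+ n.+1 < cmod (rect_int A B t.1 (t.1 + p / 2 ^+ n.+1) t.2 (t.2 + q / 2 ^+ n.+1))].
  case: H => H; [exists (s.1, s.2)|exists (s.1 + p / 2 ^+ n.+1, s.2)|
    exists (s.1, s.2 + q / 2 ^+ n.+1)|exists (s.1 + p / 2 ^+ n.+1, s.2 + q / 2 ^+ n.+1)];
    split => //=; first [by left|by right].
exists t => _; case: Ht => e1 e2 e3.
have t1 : [/\ a <= t.1, s.1 <= t.1, t.1 + p / 2 ^+ n.+1 <= s.1 + p / 2 ^+ n &
    t.1 + p / 2 ^+ n.+1 <= b].
  rewrite dbl addrA; case: e1 => ->; move: p0 h1 h2; move: (p / _) => u *; by split; lra.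
have t2 : [/\ c <= t.2, s.2 <= t.2, t.2 + q / 2 ^+ n.+1 <= s.2 + q / 2 ^+ n &
    t.2 + q / 2 ^+ n.+1 <= d].
  rewrite dbl addrA; case: e2 => ->; move: q0 h3 h4; move: (q / _) => u *; by split; lra.
by case: t1 t2 => ? ? ? ? [? ? ? ?].
Qed.

Lemma bisection_point : exists x y, in_rect a b c d x y /\
  forall n, exists a' c', [/\ in_rect a' (a' + p / 2 ^+ n) c' (c' + q / 2 ^+ n) x y,
    a <= a', a' + p / 2 ^+ n <= b, c <= c' /\ c' + q / 2 ^+ n <= d &
    eta / 4 ^+ n < cmod (rect_int A B a' (a' + p / 2 ^+ n) c' (c' + q / 2 ^+ n))].
Proof.
pose nxt n s := projT1 (cid (step_ex n s)).
pose S := fix S n := if n is m.+1 then nxt m (S m) else (a, c).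
have PS n : P n (S n).
  elim: n => [|n IH]; last by have [] := projT2 (cid (step_ex n (S n))) IH.
  by rewrite /P /= !expr0 !divr1 !(addrC _ p) !(addrC _ q) !subrK !lexx.
have SS n : [/\ (S n).1 <= (S n.+1).1, (S n).2 <= (S n.+1).2,
   (S n.+1).1 + p / 2 ^+ n.+1 <= (S n).1 + p / 2 ^+ n &
   (S n.+1).2 + q / 2 ^+ n.+1 <= (S n).2 + q / 2 ^+ n].
  by have [] := projT2 (cid (step_ex n (S n))) (PS n).
(* Nested intervals: the supremum of the left end-points lies in all of them. *)
have lim (u : nat -> R) (l : R) : 0 <= l -> (forall n, u n <= u n.+1) ->
    (forall n, u n.+1 + l / 2 ^+ n.+1 <= u n + l / 2 ^+ n) ->
    exists x, forall n, u n <= x <= u n + l / 2 ^+ n.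
  move=> l0 u1 u2.
  have um m n : (m <= n)%N -> u m <= u n.
    by elim: n => [|n IH]; [rewrite leqn0 => /eqP ->|rewrite leq_eqVlt ltnS =>
      /orP[/eqP ->//|/IH h]; exact: le_trans h (u1 n)].
  have ud m n : (m <= n)%N -> u n + l / 2 ^+ n <= u m + l / 2 ^+ m.
    by elim: n => [|n IH]; [rewrite leqn0 => /eqP ->|rewrite leq_eqVlt ltnS =>
      /orP[/eqP ->//|/IH h]; exact: le_trans (u2 n) h].
  have ul m n : u m <= u n + l / 2 ^+ n.
    have ge k : 0 <= l / 2 ^+ k by rewrite divr_ge0 // exprn_ge0.
    have [mn|nm] := leqP m n; first by rewrite (le_trans (um _ _ mn)) // lerDl.
    by apply: le_trans (ud _ _ (ltnW nm)); rewrite lerDl.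
  exists (sup (range u)) => n.
  have ne : range u !=set0 by exists (u 0%N), 0%N.
  apply/andP; split.
    apply: ub_le_sup; last by exists n.
    by exists (u 0%N + l / 2 ^+ 0) => _ [k _ <-]; exact: ul.
  by apply: ge_sup => // _ [k _ <-]; exact: ul.
have p0 : 0 <= p by rewrite subr_ge0.
have q0 : 0 <= q by rewrite subr_ge0.
have [x Hx] : exists x, forall n, (S n).1 <= x <= (S n).1 + p / 2 ^+ n.
  by apply: lim => // n; have [] := SS n.
have [y Hy] : exists x, forall n, (S n).2 <= x <= (S n).2 + q / 2 ^+ n.
  by apply: lim => // n; have [] := SS n.
exists x, y; split.
  by have := Hx 0%N; have := Hy 0%N; rewrite /= !expr0 !divr1 !(addrC _ p) !(addrC _ q) !subrK.
move=> n; exists (S n).1, (S n).2; have [h1 h2 h3 h4 h5] := PS n.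
by split; [exact: conj (Hx n) (Hy n)| | |split|].
Qed.

End Bisection.

(** At the bisection point f is close to its tangent map, and by [rect_int_affine] only the
    deviation contributes. This deviation is small compared with the side, so the integral over a
    rectangle of generation n is too small for the lower bound eta / 4^n. *)
Lemma goursat f A B a b c d : a <= b -> c <= d -> primitives f A B a b c d ->
  (forall x y, in_rect a b c d x y -> exists df, is_cderive f (Complex x y) df) ->
  rect_int A B a b c d = 0.
Proof.
move=> ab cd HP Hd; apply/eqP; rewrite -cmod_eq0 eq_le cmod_ge0 andbT leNgt; apply/negP => J0.
pose eta := cmod (rect_int A B a b c d) / 2.
have eta0 : 0 < eta by rewrite divr_gt0.
have Jb : eta < cmod (rect_int A B a b c d) by rewrite /eta; move: J0; lra.
have [x [y [xy Hn]]] := bisection_point ab cd Jb.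
have [df /is_cderiveP Hdf] := Hd x y xy.
pose L := (b - a) + (d - c) + 1.
have L0 : 0 < L by rewrite ltr_pwDr // addr_ge0 // subr_ge0.
(* With this tolerance the upper bound is eta / 4^n times (b - a + d - c) / (2 L), and the last
   factor is below 1. The summand 1 in L keeps it positive for a degenerate rectangle. *)
have [r r0 Hr] := Hdf (eta / (4 * L ^+ 2)) (divr_gt0 eta0 (mulr_gt0 (ltr0n _ 4) (exprn_gt0 2 L0))).
have [n Hn2] : exists n, L / 2 ^+ n < r.
  have [n hn] : exists n : nat, L / r < n%:R.
    by exists (Num.truncn (L / r)).+1; exact: truncnS_gt.
  exists n; rewrite ltr_pdivrMr ?exprn_gt0 // mulrC -ltr_pdivrMr //.
  apply: lt_trans hn _; rewrite -natrX ltr_nat; exact: ltn_expl.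
have [a' [c' [Hin ha hb [hc hd] HJ]]] := Hn n.
have en : 0 < (2 : R) ^+ n by rewrite exprn_gt0.
have pn : 0 <= (b - a) / 2 ^+ n by rewrite divr_ge0 ?subr_ge0 // ltW.
have qn : 0 <= (d - c) / 2 ^+ n by rewrite divr_ge0 ?subr_ge0 // ltW.
have Hsub := primitives_sub ha hb hc hd HP.
have dist x' y' : in_rect a' (a' + (b - a) / 2 ^+ n) c' (c' + (d - c) / 2 ^+ n) x' y' ->
   cmod (Complex x' y' - Complex x y : C R) <= L / 2 ^+ n.
  move=> [/andP[i1 i2] /andP[i3 i4]]; case: Hin => /andP[i5 i6] /andP[i7 i8].
  apply: le_trans (cmod_le_ReIm _) _; rewrite cReB cImB /=.
  apply: (@le_trans _ _ ((b - a) / 2 ^+ n + (d - c) / 2 ^+ n)).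
    by apply: lerD; rewrite ler_norml; apply/andP; split; lra.
  by rewrite -mulrDl ler_wpM2r ?invr_ge0 ?(ltW en) // /L lerDl.
pose s0 : C R := Complex x y.
have := @rect_int_affine f A B _ _ _ _ (f s0 - df * s0) df (eta / (4 * L ^+ 2) * (L / 2 ^+ n))
  _ _ Hsub _.
rewrite !lerDl => /(_ pn qn) H.
have {H} : cmod (rect_int A B a' (a' + (b - a) / 2 ^+ n) c' (c' + (d - c) / 2 ^+ n)) <=
   2 * (eta / (4 * L ^+ 2) * (L / 2 ^+ n)) *
   (a' + (b - a) / 2 ^+ n - a' + (c' + (d - c) / 2 ^+ n - c')).
  apply: H => x' y' Hi; have di := dist _ _ Hi.
  have := Hr (Complex x' y' - s0) (le_lt_trans di Hn2).
  rewrite (addrC s0) subrK => H2.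
  rewrite (_ : _ - _ = f (Complex x' y') - f s0 - (Complex x' y' - s0) * df); last by ring.
  apply: le_trans H2 _; rewrite ler_wpM2l // divr_ge0 ?(ltW eta0) //.
  by rewrite mulr_ge0 // exprn_ge0 // ltW.
move=> H; have := lt_le_trans HJ H; apply/negP; rewrite -leNgt.
rewrite !(addrAC _ _ (- _)) !subrr !add0r -mulrDl.
rewrite (_ : 2 * _ * _ = eta / 4 ^+ n * (2^-1 * ((b - a + (d - c)) / L))); last first.
  rewrite (_ : 4 ^+ n = 2 ^+ n * 2 ^+ n); last by rewrite -exprMn -natrM.
  by field; rewrite !gt_eqF.
have h1 : (b - a + (d - c)) / L <= 1 by rewrite ler_pdivrMr // mul1r /L lerDl.
have h2 : 2^-1 * ((b - a + (d - c)) / L) <= 1 by move: h1; move: (_ / L) => u; lra.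
by rewrite ler_piMr // divr_ge0 ?exprn_ge0 ?(ltW eta0).
Qed.

End Goursat.

Section MaximumPrinciple.
Context {R : realType}.
Implicit Types (f : C R -> C R) (a w : C R) (x y r : R).

Lemma is_cderive_lip f w d : is_cderive f w d ->
  exists2 r, 0 < r & forall h : C R, cmod h < r -> cmod (f (w + h) - f w) <= (cmod d + 1) * cmod h.
Proof.
move=> /is_cderiveP H; have [r r0 Hr] := H 1 ltr01; exists r => // h hr.
rewrite -[_ - _](subrK (h * d)); apply: le_trans (cmodD _ _) _.
have := Hr h hr; rewrite cmodM mulrDl mul1r mulrC => h1; lra.
Qed.

Lemma cexp_polar r t : 0 < r ->
  cexp (Complex (ln r) t) = Complex (r * cos t) (r * sin t) :> C R.
Proof. by move=> r0; rewrite /cexp /= lnK. Qed.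

Lemma cexp_2pi (x : R) : cexp (Complex x (pi *+ 2)) = cexp (Complex x 0) :> C R.
Proof. by rewrite /cexp /= cos2pi sin2pi cos0 sin0. Qed.

(* The integral of [f (a + e^s)] over a vertical segment of length [2 pi] does
   not depend on its abscissa, and tends to [2 pi f a] as the latter goes to
   [-oo]. *)
Lemma circle_mean f a r : 0 < r ->
  (forall w, cmod (w - a) <= 2 * r -> exists d, is_cderive f w d) ->
  exists B : R -> C R,
    (forall t, 0 <= t <= pi *+ 2 -> is_rderive B t (f (a + cexp (Complex (ln r) t)))) /\
    B (pi *+ 2) - B 0 = toC (pi *+ 2) * f a.
Proof.
move=> r0 Hf; pose h (s : C R) := f (a + cexp s); pose u := ln (2 * r); pose u0 := ln r.
have r20 : 0 < 2 * r by rewrite mulr_gt0.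
have u0u : u0 < u by rewrite ltr_ln ?posrE // ltr_pMl // ltr1n.
have pi2 : 0 < (pi *+ 2 : R) by rewrite pmulrn_lgt0 // pi_gt0.
have /choice[h1 Hh] : forall s : C R, exists d, Re s <= u -> is_cderive h s d.
  move=> s; have [su|su] := leP (Re s) u; last by exists 0.
  have [|d Hd] := Hf (a + cexp s).
    by rewrite addrAC subrr add0r cmod_cexp -(lnK (x := 2 * r)) ?posrE // ler_expR.
  exists (d * cexp s) => _; apply: (is_cderive_comp (f := fun s => a + cexp s) Hd).
  by have := is_cderiveD (is_cderive_cst a s) (is_cderive_cexp s); rewrite add0r.
(* A margin of length 1 on each side of [0, 2 pi]: antiderivatives are only available on open
   intervals. *)
have /choice[B HB] : forall x : R, exists B : R -> C R, x <= u ->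
    forall y, -1 < y < pi *+ 2 + 1 -> is_rderive B y (h (Complex x y)).
  move=> x; have [xu|xu] := leP x u; last by exists (fun=> 0).
  have [||G HG] := @antiderivative_exists R (fun y => h (Complex x y))
    (fun y => h1 (Complex x y) * iC) (-1) (pi *+ 2 + 1).
  - by move: pi2; lra.
  - by move=> y _; apply: is_rderive_vert; exact: Hh.
  - by exists G.
(* Goursat's theorem on [x1, u0] x [0, 2 pi]: the horizontal sides cancel because exp has period 2
   pi i. *)
have DE (x1 : R) : x1 < u0 -> B u0 (pi *+ 2) - B u0 0 = B x1 (pi *+ 2) - B x1 0.
  move=> xu.
  have /choice[A HA] : forall y : R, exists A : R -> C R,
      forall x, x1 - 1 < x < u -> is_rderive A x (h (Complex x y)).
    move=> y; apply: (@antiderivative_exists R (fun x => h (Complex x y))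
      (fun x => h1 (Complex x y))); first by lra.
    by move=> x /andP[_ xu']; apply: is_rderive_horiz; exact: Hh.
  have HP : primitives h (fun x y => A y x) B x1 u0 0 (pi *+ 2).
    split=> x y [/andP[p1 p2] /andP[p3 p4]]; first by apply: HA; apply/andP; split; lra.
    by apply: HB; [lra|apply/andP; split; lra].
  have := goursat (ltW xu) (ltW pi2) HP.
  have -> : rect_int (fun x y => A y x) B x1 u0 0 (pi *+ 2) =
     iC * ((B u0 (pi *+ 2) - B u0 0) - (B x1 (pi *+ 2) - B x1 0)).
    have : cmod ((A 0 u0 - A (pi *+ 2) u0) - (A 0 x1 - A (pi *+ 2) x1)) <= 0 * (u0 - x1).
      apply: (@mean_value_ineq _ (fun x => A 0 x - A (pi *+ 2) x)
        (fun x => h (Complex x 0) - h (Complex x (pi *+ 2))) _ _ 0 (ltW xu)) => x /andP[p1 p2].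
        by apply: is_rderiveB; apply: HA; apply/andP; split; lra.
      by rewrite /h cexp_2pi subrr cmod0.
    rewrite mul0r => h0; have {h0} : cmod ((A 0 u0 - A (pi *+ 2) u0) - (A 0 x1 - A (pi *+ 2) x1)) == 0.
      by rewrite eq_le h0 cmod_ge0.
    rewrite cmod_eq0 => /eqP h0.
    rewrite /rect_int -[RHS]add0r -h0; ring.
  move=> H; have {H} : iC * ((B u0 (pi *+ 2) - B u0 0) - (B x1 (pi *+ 2) - B x1 0)) = 0.
    apply: H => x y [/andP[p1 p2] _]; exists (h1 (Complex x y)).
    by apply: Hh => /=; lra.
  move/eqP; rewrite mulf_eq0 -cmod_eq0 cmod_iC oner_eq0 /= => /eqP /subr0_eq //.
exists (B u0); split.
  by move=> t /andP[t0 t1]; apply: HB; [exact: ltW|apply/andP; split; lra].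
apply/eqP; rewrite -subr_eq0 -cmod_eq0 eq_le cmod_ge0 andbT; apply/ler_addgt0Pr => e e0.
rewrite add0r.
have [|d Hd] := Hf a; first by rewrite subrr cmod0 ltW.
have [rho rho0 Hrho] := is_cderive_lip Hd.
have d1 : 0 < cmod d + 1 by rewrite ltr_wpDl ?cmod_ge0.
(* A radius on which the Lipschitz bound keeps f within e / (2 pi) of f(a); e is then the error over
   a full turn. *)
pose sg := Num.min (rho / 2) (e / ((cmod d + 1) * (pi *+ 2))).
have sg0 : 0 < sg by rewrite lt_min !divr_gt0 // mulr_gt0.
pose x1 := Num.min (u0 - 1) (ln sg).
have x1u : x1 < u0 by rewrite gt_min ltrBlDr ltrDl ltr01.
have ex1 : expR x1 <= sg by rewrite -[leRHS]lnK ?posrE // ler_expR ge_min lexx orbT.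
rewrite (DE _ x1u).
have key : cmod ((B x1 (pi *+ 2) - toC (pi *+ 2) * f a) - (B x1 0 - toC 0 * f a))
    <= (e / (pi *+ 2)) * (pi *+ 2 - 0).
  apply: (@mean_value_ineq _ (fun y => B x1 y - toC y * f a)
    (fun y => h (Complex x1 y) - f a) _ _ _ (ltW pi2)) => y /andP[y0 y1].
    apply: is_rderiveB; first by apply: HB; [lra|apply/andP; split; lra].
    have := is_rderive_toC (is_cderiveM (is_cderive_id (toC y)) (is_cderive_cst (f a) (toC y))).
    by rewrite mul1r mulr0 addr0.
  have ce : cmod (cexp (Complex x1 y) : C R) <= sg by rewrite cmod_cexp.
  apply: le_trans (Hrho _ _) _.
    apply: le_lt_trans ce _; rewrite gt_min; apply/orP; left.
    by rewrite ltr_pdivrMr // ltr_pMr // ltr1n.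
  apply: le_trans (_ : (cmod d + 1) * sg <= _); first by rewrite ler_wpM2l // ltW.
  rewrite mulrC -ler_pdivlMr // -mulrA -invfM (mulrC (pi *+ 2)).
  by rewrite ge_min lexx orbT.
move: key; rewrite subr0 divfK ?gt_eqF // toC0 mul0r subr0.
by rewrite addrAC.
Qed.

(* [|f|^2] has no smaller mean over the circle than at its centre, and the mean
   of [|w|^2] exceeds its central value by [r^2]. *)
Lemma no_interior_max f a r (eps : R) : 0 < r -> 0 < eps ->
  (forall w, cmod (w - a) <= 2 * r -> exists d, is_cderive f w d) ->
  ~ (forall w, cmod (w - a) = r ->
      cmod (f w) ^+ 2 + eps * cmod w ^+ 2 <= cmod (f a) ^+ 2 + eps * cmod a ^+ 2).
Proof.
move=> r0 eps0 Hf Hm; have [B [HB BE]] := circle_mean r0 Hf.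
have pi2 : 0 < (pi *+ 2 : R) by rewrite pmulrn_lgt0 // pi_gt0.
pose p := Re (f a); pose q := Im (f a).
pose F t := f (a + cexp (Complex (ln r) t)).
(* On the circle, chi' = 2 Re (conj f(a) * f(w)) - 2 |f(a)|^2 + eps (|w|^2 - |a|^2). By 2 Re (conj u
   * v) <= |u|^2 + |v|^2 it is at most the difference assumed nonpositive, yet over a full turn chi
   grows by 2 pi eps r^2. *)
pose chi t := 2 * (p * Re (B t) + q * Im (B t)) - 2 * (p ^+ 2 + q ^+ 2) * t
  + eps * (r ^+ 2 * t + 2 * r * (Re a * sin t - Im a * cos t)).
pose dchi t := 2 * (p * Re (F t) + q * Im (F t)) - 2 * (p ^+ 2 + q ^+ 2)
  + eps * (r ^+ 2 + 2 * r * (Re a * cos t + Im a * sin t)).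
have D t : 0 <= t <= pi *+ 2 -> is_derive t 1 chi (dchi t).
  move=> ht; have [b1 b2] := HB t ht.
  have s1 := is_derive_sin t; have c1 := is_derive_cos t.
  have k (x : R) := is_derive_cst x t 1.
  have e1 := is_derive_fmul (k 2) (is_derive_fadd (is_derive_fmul (k p) b1) (is_derive_fmul (k q) b2)).
  have e2 := is_derive_fmul (k (- (2 * (p ^+ 2 + q ^+ 2)))) (is_derive_id t 1).
  have e3 := is_derive_fmul (k eps) (is_derive_fadd (is_derive_fmul (k (r ^+ 2)) (is_derive_id t 1))
    (is_derive_fmul (k (2 * r)) (is_derive_fadd (is_derive_fmul (k (Re a)) s1) (is_derive_fmul (k (- Im a)) c1)))).
  have := is_derive_fadd (is_derive_fadd e1 e2) e3.
  rewrite (_ : (fun s => _) = chi); last by apply/funext => s; rewrite /chi /cst; ring.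
  move/is_derive_eq; apply; rewrite /dchi /F /cst; ring.
have dle t : dchi t <= 0.
  have wE : cexp (Complex (ln r) t) = Complex (r * cos t) (r * sin t) :> C R by rewrite cexp_polar.
  have cs := cos2Dsin2 t.
  have := Hm (a + cexp (Complex (ln r) t)).
  rewrite addrAC subrr add0r cmod_cexp /= lnK ?posrE // => /(_ erefl).
  rewrite -/(F t) !sqr_cmod cReD cImD wE /= -/p -/q.
  have := sqr_ge0 (p - Re (F t)); have := sqr_ge0 (q - Im (F t)).
  rewrite /dchi; move: (Re (F t)) (Im (F t)) => x y h1 h2 h3.
  have E : eps * (r ^+ 2 + 2 * r * (Re a * cos t + Im a * sin t)) =
    eps * ((Re a + r * cos t) ^+ 2 + (Im a + r * sin t) ^+ 2) - eps * (Re a ^+ 2 + Im a ^+ 2).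
    have -> : r ^+ 2 = r ^+ 2 * (cos t ^+ 2 + sin t ^+ 2) by rewrite cs mulr1.
    ring.
  rewrite E; move: h3; move: (eps * _) (eps * _) => u v; move: h1 h2; clear; rewrite !sqrrB.
  rewrite !mulrDr; lra.
have [t _] : exists2 c, c \in `]0, (pi *+ 2)[%R & chi (pi *+ 2) - chi 0 = dchi c * (pi *+ 2 - 0).
  apply: MVT; [exact: pi2| |].
    by move=> t; rewrite in_itv /= => /andP[t0 t1]; apply: D; rewrite !ltW.
  apply: derivable_within_continuous => t; rewrite in_itv /= => ht.
  by have [] := D t ht.
have bp : Re (B (pi *+ 2)) - Re (B 0) = pi *+ 2 * p.
  by rewrite -cReB BE Re_toCM.
have bq : Im (B (pi *+ 2)) - Im (B 0) = pi *+ 2 * q.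
  by rewrite -cImB BE Im_toCM.
have -> : chi (pi *+ 2) - chi 0 = eps * r ^+ 2 * (pi *+ 2).
  rewrite /chi cos2pi sin2pi cos0 sin0.
  transitivity (2 * (p * (Re (B (pi *+ 2)) - Re (B 0)) + q * (Im (B (pi *+ 2)) - Im (B 0)))
    - 2 * (p ^+ 2 + q ^+ 2) * (pi *+ 2) + eps * r ^+ 2 * (pi *+ 2)); first by ring.
  by rewrite bp bq; ring.
move=> H; have : dchi t * (pi *+ 2 - 0) <= 0 by rewrite subr0 mulr_le0_ge0 // ltW.
by rewrite -H leNgt !mulr_gt0 // exprn_gt0.
Qed.

Lemma continuous_cderive_ReIm f x y d : is_cderive f (Complex x y) d ->
  (fun p : R * R => Re (f (Complex p.1 p.2))) @ (x, y) --> Re (f (Complex x y)) /\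
  (fun p : R * R => Im (f (Complex p.1 p.2))) @ (x, y) --> Im (f (Complex x y)).
Proof.
move=> /is_cderive_lip[r r0 Hr].
have d1 : 0 < cmod d + 1 by rewrite ltr_wpDl ?cmod_ge0.
have key (e : R) : 0 < e -> \forall p \near (x, y),
    cmod (f (Complex x y) - f (Complex p.1 p.2)) <= e.
  move=> e0; apply/nbhs_ballP; pose s := Num.min r (e / (cmod d + 1)).
  have s0 : 0 < s by rewrite lt_min r0 divr_gt0.
  exists (s / 2); first by rewrite /= divr_gt0.
  move=> [p1 p2] [/= b1 b2].
  have hs : cmod (Complex p1 p2 - Complex x y : C R) < s.
    apply: le_lt_trans (cmod_le_ReIm _) _; rewrite cReB cImB /=.
    by move: b1 b2; rewrite /ball /= /ball_ ![`|_ - p1|]distrC ![`|_ - p2|]distrC => b1 b2; lra.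
  rewrite cmodBC; have hr : cmod (Complex p1 p2 - Complex x y : C R) < r.
    by apply: lt_le_trans hs _; rewrite ge_min lexx.
  have := Hr _ hr; rewrite (addrC (Complex x y)) subrK => h; apply: le_trans h _.
  by rewrite mulrC -ler_pdivlMr // ltW // (lt_le_trans hs) // ge_min lexx orbT.
split; apply/cvgrPdist_le => e e0; near=> p.
  rewrite -cReB; apply: le_trans (normRe_le _) _; near: p; exact: key.
rewrite -cImB; apply: le_trans (normIm_le _) _; near: p; exact: key.
Unshelve. all: by end_near. Qed.

Lemma rect_EVT f (eps a b c d : R) : a <= b -> c <= d ->
  (forall x y, in_rect a b c d x y -> exists df, is_cderive f (Complex x y) df) ->
  exists p q, in_rect a b c d p q /\ forall x y, in_rect a b c d x y ->
    cmod (f (Complex x y)) ^+ 2 + eps * cmod (Complex x y : C R) ^+ 2 <=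
    cmod (f (Complex p q)) ^+ 2 + eps * cmod (Complex p q : C R) ^+ 2.
Proof.
move=> ab cd Hf; pose K : set (R * R) := `[a, b] `*` `[c, d].
have KP p : K p <-> in_rect a b c d p.1 p.2 by rewrite /K /in_rect /= !in_itv.
pose u (p : R * R) := Re (f (Complex p.1 p.2)) * Re (f (Complex p.1 p.2)) +
   Im (f (Complex p.1 p.2)) * Im (f (Complex p.1 p.2)) + eps * (p.1 * p.1 + p.2 * p.2).
have uE x y : u (x, y) = cmod (f (Complex x y)) ^+ 2 + eps * cmod (Complex x y : C R) ^+ 2.
  by rewrite !sqr_cmod /u /= -!expr2.
have [|||[p1 p2] /set_mem Kp Hp] := @compact_EVT_max _ R u K.
- by exists (a, c); apply/KP; split; rewrite /= lexx.
- by apply: compact_setX; exact: segment_compact.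
- apply: continuous_in_subspaceT => -[x y] /set_mem /KP /= xy.
  have [df /continuous_cderive_ReIm[h1 h2]] := Hf x y xy.
  have f1 : (fun p : R * R => p.1) @ (x, y) --> x by exact: cvg_fst.
  have f2 : (fun p : R * R => p.2) @ (x, y) --> y by exact: cvg_snd.
  apply: cvgD; first by apply: cvgD; exact: cvgM.
  by apply: cvgM; [exact: cvg_cst|apply: cvgD; exact: cvgM].
exists p1, p2; split; first by move/KP: Kp.
by move=> x y xy; rewrite -!uE; apply/Hp/mem_set/KP.
Qed.

(** If |f| takes a value m > N, the perturbation eps |w|^2 is at most (m^2 - N^2) / 2 on the
    rectangle, so the maximum of |f|^2 + eps |w|^2 is not on the boundary. An interior maximum
    contradicts [no_interior_max]. *)
Lemma max_modulus f (a b c d N : R) : a <= b -> c <= d ->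
  (forall x y, in_rect a b c d x y -> exists df, is_cderive f (Complex x y) df) ->
  (forall x y, in_rect a b c d x y -> [\/ x = a, x = b, y = c | y = d] ->
     cmod (f (Complex x y)) <= N) ->
  forall x y, in_rect a b c d x y -> cmod (f (Complex x y)) <= N.
Proof.
move=> ab cd Hf HN x0 y0 xy0; rewrite leNgt; apply/negP => HNf.
have N0 : 0 <= N.
  apply: le_trans (HN a c _ _); [exact: cmod_ge0|by split; rewrite lexx|by constructor 1].
pose m := cmod (f (Complex x0 y0)); pose L := `|a| + `|b| + (`|c| + `|d|) + 1.
have L0 : 0 < L by rewrite ltr_wpDl // !addr_ge0.
have mN : 0 < m ^+ 2 - N ^+ 2 by rewrite subr_gt0 ltrXn2r.
pose eps := (m ^+ 2 - N ^+ 2) / (2 * L ^+ 2).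
have eps0 : 0 < eps by rewrite divr_gt0 // mulr_gt0 // exprn_gt0.
have [p1 [p2 [pin Hp]]] := rect_EVT eps ab cd Hf; have u0 := Hp _ _ xy0.
have cL x y : in_rect a b c d x y -> cmod (Complex x y : C R) <= L.
  move=> [/andP[i1 i2] /andP[i3 i4]]; apply: le_trans (cmod_le_ReIm _) _ => /=.
  have n1 : `|x| <= `|a| + `|b|.
    have := ler_norm b; have := ler_norm (- a); rewrite normrN; have := normr_ge0 a; have := normr_ge0 b.
    by move=> *; rewrite ler_norml; apply/andP; split; lra.
  have n2 : `|y| <= `|c| + `|d|.
    have := ler_norm d; have := ler_norm (- c); rewrite normrN; have := normr_ge0 c; have := normr_ge0 d.
    by move=> *; rewrite ler_norml; apply/andP; split; lra.
  by rewrite /L; lra.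
have nb : ~ [\/ p1 = a, p1 = b, p2 = c | p2 = d].
  move=> bd; have h1 := HN _ _ pin bd.
  have : m ^+ 2 <= N ^+ 2 + eps * L ^+ 2.
    apply: le_trans (le_trans _ u0) _; first by rewrite lerDl mulr_ge0 ?sqr_ge0 // ltW.
    apply: lerD.
      by rewrite lerXn2r // nnegrE cmod_ge0.
    rewrite ler_wpM2l ?(ltW eps0) // lerXn2r // ?nnegrE ?cmod_ge0 ?(ltW L0) //; exact: cL.
  rewrite /eps (_ : _ / _ * _ = (m ^+ 2 - N ^+ 2) / 2); first by move: mN; lra.
  by field; rewrite gt_eqF.
case: (pin) => /andP[i1 i2] /andP[i3 i4].
have j1 : a < p1 by rewrite lt_neqAle i1 andbT; apply/eqP => e; apply: nb; constructor 1.
have j2 : p1 < b by rewrite lt_neqAle i2 andbT; apply/eqP => e; apply: nb; constructor 2.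
have j3 : c < p2 by rewrite lt_neqAle i3 andbT; apply/eqP => e; apply: nb; constructor 3.
have j4 : p2 < d by rewrite lt_neqAle i4 andbT; apply/eqP => e; apply: nb; constructor 4.
pose r := Num.min (Num.min (p1 - a) (b - p1)) (Num.min (p2 - c) (d - p2)) / 2.
have r0 : 0 < r by rewrite divr_gt0 // !lt_min !subr_gt0 j1 j2 j3 j4.
have rin w : cmod (w - Complex p1 p2) <= 2 * r -> in_rect a b c d (Re w) (Im w).
  rewrite /r mulrCA divff // mulr1 !le_min => /andP[/andP[k1 k2] /andP[k3 k4]].
  have := normRe_le (w - Complex p1 p2); have := normIm_le (w - Complex p1 p2).
  rewrite cReB cImB /= !ler_norml => /andP[l1 l2] /andP[l3 l4].
  by split; apply/andP; split; lra.
have ew w : w = Complex (Re w) (Im w) by case: w.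
apply: (@no_interior_max f (Complex p1 p2) r eps r0 eps0).
  by move=> w /rin hw; rewrite [w]ew; exact: Hf.
move=> w hw; have := rin w; rewrite hw => /(_ _) hin.
rewrite [w]ew; apply: Hp.
by apply: hin; rewrite ler_pMl // ler1n.
Qed.

End MaximumPrinciple.

(** * Propagation of a limit from the half-line to the half-plane *)

Section Identity.
Context {R : realType}.
Implicit Types (f g : C R -> C R) (w s : C R) (x y : R).

(* Maximum principle for [f] times a power of [exp (i s - s^2 / (4 Y))], whose
   modulus is at most 1 on the bottom side and smaller at the other sides than
   at [i y0]. *)
Lemma two_constants (Y y0 M e : R) : 0 < y0 -> y0 < Y -> 0 < e -> 0 <= M ->
  exists2 delta : R, 0 < delta & forall f,
    (forall x y, in_rect (- (2 * Y)) (2 * Y) 0 Y x y -> exists d, is_cderive f (Complex x y) d) ->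
    (forall x y, in_rect (- (2 * Y)) (2 * Y) 0 Y x y -> cmod (f (Complex x y)) <= M) ->
    (forall x, - (2 * Y) <= x <= 2 * Y -> cmod (f (Complex x 0)) <= delta) ->
    cmod (f (Complex 0 y0)) <= e.
Proof.
move=> y00 yY e0 M0; have Y0 := lt_trans y00 yY.
(* The exponent of the comparison function is lam times -b at i y0, at most 0 on the bottom side and
   at most -3Y/4 on the other three. So [kap] is the gap, and [lam] is taken large enough that M
   e^(- lam kap) <= e. *)
pose eps := (4 * Y)^-1; pose b := y0 - eps * (y0 * y0); pose kap := 3 / 4 * Y - b.
have eps0 : 0 < eps by rewrite invr_gt0 mulr_gt0.
have eY : eps * (Y * Y) = Y / 4 by rewrite /eps; field; rewrite gt_eqF.
have kap0 : 0 < kap.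
  rewrite (_ : kap = (Y - y0) * (3 * Y - y0) * eps); last first.
    by rewrite /kap /b /eps; field; rewrite gt_eqF.
  by rewrite !mulr_gt0 //; move: yY y00; lra.
pose lam := M / (e * kap).
have lam0 : 0 <= lam by rewrite divr_ge0 // mulr_ge0 // ltW.
have Mle : M <= e * expR (lam * kap).
  apply: le_trans (_ : e * (lam * kap) <= _).
    by rewrite /lam -mulrA mulrCA (_ : _ * kap = e^-1) ?divff ?mulr1 ?gt_eqF //;
       field; rewrite !gt_eqF.
  rewrite ler_wpM2l ?(ltW e0) //; apply: le_trans (expR_ge1Dx _).
  by rewrite lerDr.
pose N := e * expR (- (lam * b)).
exists N; first by rewrite mulr_gt0 // expR_gt0.
move=> f Hf HM Hb.
pose phi (s : C R) := toC lam * (iC * s - toC eps * (s * s)).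
have Rphi x y : Re (phi (Complex x y)) = lam * (- y - eps * (x * x) + eps * (y * y)).
  by rewrite /phi Re_toCM !cReIm /=; ring.
have key : cmod (f (Complex 0 y0) * cexp (phi (Complex 0 y0))) <= N.
  apply: (@max_modulus _ (fun s => f s * cexp (phi s)) (- (2 * Y)) (2 * Y) 0 Y).
  - by move: Y0; lra.
  - exact: ltW.
  - move=> x y /Hf[d Hd]; set s := Complex x y.
    have dphi : is_cderive phi s (toC lam * (iC * 1 - toC eps * (1 * s + s * 1))).
      exact: is_cderiveZ (is_cderiveB (is_cderiveZ iC (is_cderive_id s))
        (is_cderiveZ (toC eps) (is_cderiveM (is_cderive_id s) (is_cderive_id s)))).
    by eexists; apply: is_cderiveM Hd (is_cderive_comp (is_cderive_cexp _) dphi).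
  - move=> x y xy bd; have hM := HM _ _ xy; rewrite cmodM cmod_cexp Rphi.
    case: (xy) => hx /andP[y0' yY']; have ey : eps * (y * y) <= y / 4.
      rewrite /eps mulrC ler_pdivrMr ?mulr_gt0 //.
      have -> : y / 4 * (4 * Y) = y * Y by field.
      exact: ler_wpM2l.
    have ex : 0 <= eps * (x * x) by rewrite mulr_ge0 ?(ltW eps0) // -expr2 sqr_ge0.
    have [yz|hexp] : y = 0 \/ - y - eps * (x * x) + eps * (y * y) <= - (3 / 4 * Y).
      case: bd => [->|->|->|->]; [right|right|by left|right].
      + rewrite (_ : eps * (- (2 * Y) * - (2 * Y)) = Y); last first.
          by rewrite /eps; field; rewrite gt_eqF.
        lra.
      + rewrite (_ : eps * (2 * Y * (2 * Y)) = Y); last first.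
          by rewrite /eps; field; rewrite gt_eqF.
        lra.
      + rewrite eY; lra.
    + have hb := Hb x hx; rewrite yz; apply: le_trans (_ : N * 1 <= _); last by rewrite mulr1.
      apply: ler_pM => //; [exact: cmod_ge0|].
      by rewrite -expR0 ler_expR mulr_ge0_le0 //; lra.
    + apply: le_trans (_ : (e * expR (lam * kap)) * expR (lam * - (3 / 4 * Y)) <= _).
        apply: ler_pM; [exact: cmod_ge0|exact: expR_ge0|exact: le_trans hM Mle|].
        by rewrite ler_expR ler_wpM2l.
      rewrite -mulrA -expRD /N (_ : lam * kap + _ = - (lam * b)) //.
      by rewrite /kap; ring.
  - by split; apply/andP; split; rewrite ?ltW //; lra.
move: key; rewrite cmodM cmod_cexp Rphi /N.
rewrite (_ : lam * _ = - (lam * b)); last by rewrite /b; ring.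
by rewrite ler_pM2r ?expR_gt0.
Qed.

(** The map s |-> exp (x0 + sg s) sends the real line onto the positive half-line and i |arg w| to
    w, with [sg] the sign of arg w. On the compact rectangle g is bounded, which gives
    [two_constants] an M that does not depend on n. *)
Lemma right_half_plane_vanishing (f : nat -> C R -> C R) g (K : R) : 0 <= K ->
  (forall n w, Cgt0 w -> exists d, is_cderive (f n) w d) ->
  (forall w, Cgt0 w -> exists d, is_cderive g w d) ->
  (forall n w, Cgt0 w -> cmod (f n w) <= K * (cmod (g w) + 1)) ->
  (forall e : R, 0 < e -> exists N, forall n, (N <= n)%N -> forall q : R, 0 < q ->
     cmod (f n (toC q)) <= e) ->
  forall w, Cgt0 w -> forall e : R, 0 < e -> exists N, forall n, (N <= n)%N -> cmod (f n w) <= e.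
Proof.
move=> K0 Hf Hg Hfg Hq w w0 e e0.
have wn := neq0_Re_gt0 w0; have wE := log0K wn; have yb := Arg0_Re_gt0 w0.
pose x0 := ln (cmod w); pose y0 := Arg0 w; pose sg := Num.sg y0.
have LE : log0 w = Complex x0 y0 by [].
have [y00|ny0] := eqVneq y0 0.
  have -> : w = toC (expR x0).
    by rewrite -wE LE y00 -cexpC; congr cexp; apply: eq_ReIm.
  have [N HN] := Hq e e0; exists N => n nN; apply: HN => //; exact: expR_gt0.
have ay0 : 0 < `|y0| by rewrite normr_gt0.
(* Halfway between |arg w| and pi / 2: the rectangle contains i |arg w| in its interior and is
   mapped into the open half-plane. *)
pose Y := (`|y0| + pi / 2) / 2.
have yY : `|y0| < Y by rewrite /Y; move: yb; rewrite -/y0; lra.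
have Yp : Y < pi / 2 by rewrite /Y; move: yb; rewrite -/y0; lra.
have Y0 := lt_trans ay0 yY.
pose psi (s : C R) : C R := cexp (toC x0 + toC sg * s).
have psi0 x y : 0 <= y -> y <= Y -> Cgt0 (psi (Complex x y)).
  move=> h1 h2; rewrite /Cgt0 /= mulr_gt0 ?expR_gt0 // cos_gt0_pihalf //.
  rewrite mul0r addr0 add0r.
  have n1 : `|sg| <= 1 by rewrite /sg normr_sg lern1 leq_b1.
  have : `|sg * y| <= Y.
    rewrite normrM (ger0_norm h1); apply: le_trans h2; exact: ler_piMl.
  by rewrite ler_norml => /andP[h3 h4]; apply/andP; split; lra.
have dpsi s : is_cderive psi s (psi s * (0 + toC sg * 1)).
  exact: (is_cderive_comp (f := fun s => toC x0 + toC sg * s) (is_cderive_cexp _)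
    (is_cderiveD (is_cderive_cst (toC x0) s) (is_cderiveZ (toC sg) (is_cderive_id s)))).
have dcomp (h : C R -> C R) x y : (forall w, Cgt0 w -> exists d, is_cderive h w d) ->
    in_rect (- (2 * Y)) (2 * Y) 0 Y x y -> exists d, is_cderive (fun s => h (psi s)) (Complex x y) d.
  move=> Hh [_ /andP[h1 h2]]; have [d Hd] := Hh _ (psi0 x y h1 h2).
  by eexists; apply: is_cderive_comp Hd (dpsi _).
have YY : - (2 * Y) <= 2 * Y by move: Y0; lra.
have [p [q [_ Hpq]]] := rect_EVT (f := fun s => g (psi s)) 0 YY (ltW Y0)
  (fun x y => dcomp g x y Hg).
pose M0 := cmod (g (psi (Complex p q))).
have HM x y : in_rect (- (2 * Y)) (2 * Y) 0 Y x y -> cmod (g (psi (Complex x y))) <= M0.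
  move=> /Hpq; rewrite !mul0r !addr0 => h; rewrite -(@ler_pXn2r _ 2) ?nnegrE ?cmod_ge0 //.
have M0' : 0 <= K * (M0 + 1) by rewrite mulr_ge0 // addr_ge0 // cmod_ge0.
have [dl dl0 Hdl] := two_constants ay0 yY e0 M0'.
have [N HN] := Hq dl dl0; exists N => n nN.
have -> : w = psi (Complex 0 `|y0|).
  rewrite -[LHS]wE LE; congr cexp; apply: eq_ReIm.
    by rewrite cReD cReC Re_toCM (_ : Re (Complex 0 _ : C R) = 0) // mulr0 addr0.
  by rewrite cImD cImC Im_toCM add0r (_ : Im (Complex 0 `|y0| : C R) = `|y0|) // -numEsg.
apply: (Hdl (fun s => f n (psi s))).
- by move=> x y; apply: dcomp; exact: Hf.
- move=> x y xy; case: (xy) => _ /andP[h1 h2].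
  apply: le_trans (Hfg n _ (psi0 x y h1 h2)) _.
  by rewrite ler_wpM2l // lerD2r HM.
- move=> x _; rewrite (_ : psi (Complex x 0) = toC (expR (x0 + sg * x))); last first.
    rewrite -cexpC; congr cexp; apply: eq_ReIm.
      by rewrite cReD Re_toCM !cReC.
    by rewrite cImD Im_toCM !cImC mulr0 addr0.
  by apply: HN => //; exact: expR_gt0.
Qed.

End Identity.

(** * Mellin transforms *)

Section PowerBound.
Context {R : realType}.
Implicit Types (z w : C R) (t u x : R).

Lemma log0_toC x : 0 < x -> log0 (toC x) = toC (ln x).
Proof.
move=> x0; rewrite -[in LHS](lnK x0) -cexpC log0_cexp // cImC normr0.
by rewrite divr_gt0 // pi_gt0.
Qed.

Lemma is_rderive_cpow z u : 0 < u ->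
  is_rderive (fun x => cexp (z * log0 (toC x))) u (cexp (z * log0 (toC u)) * (z * (toC u)^-1)).
Proof.
move=> u0; apply: (@is_rderive_toC _ (fun w => cexp (z * log0 w))).
have h : is_cderive (@log0 R) (toC u) (toC u)^-1 by apply: is_cderive_log0; rewrite cReC.
exact: (is_cderive_comp (f := fun w => z * log0 w) (is_cderive_cexp _) (is_cderiveZ z h)).
Qed.

(** For t < 1/2, |t^z| <= 1 and |t - 1| >= 1/2 account for the constant 4. For t >= 1/2 the
    derivative z t^(z-1) is at most 2 |z|, where Re z <= 1 controls large t. *)
Lemma cpow_sub1_le z t : 0 < t -> 0 <= Re z <= 1 ->
  cmod (cexp (z * toC (ln t)) - 1) <= (2 * cmod z + 4) * `|t - 1|.
Proof.
move=> t0 /andP[z0 z1]; have c0 := cmod_ge0 z.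
have Rz x : Re (z * toC x) = Re z * x by rewrite mulrC Re_toCM mulrC.
have [t2|t2] := ltP t (2^-1).
  have l0 : ln t <= 0 by apply: ln_le0; lra.
  have h1 : cmod (cexp (z * toC (ln t))) <= 1.
    by rewrite cmod_cexp Rz -expR0 ler_expR mulr_ge0_le0.
  have h2 : 2^-1 <= `|t - 1| by rewrite distrC ger0_norm; lra.
  apply: le_trans (cmodB _ _) _; rewrite cmod1.
  apply: le_trans (_ : 4 * 2^-1 <= _); first by lra.
  apply: ler_pM => //; lra.
have bd u : 2^-1 <= u -> cmod (cexp (z * log0 (toC u)) * (z * (toC u)^-1)) <= 2 * cmod z.
  move=> u2; have u0 : 0 < u by lra.
  rewrite log0_toC // !cmodM cmod_cexp Rz cmodV cmodC gtr0_norm // mulrCA mulrC.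
  apply: ler_wpM2r => //; have [l0|l0] := leP (ln u) 0.
    rewrite -[leRHS]mul1r; apply: ler_pM; rewrite ?expR_ge0 ?invr_ge0 ?(ltW u0) //.
      by rewrite -expR0 ler_expR mulr_ge0_le0.
    by rewrite -[2]invrK lef_pV2 ?posrE // invr_gt0.
  apply: le_trans (_ : u / u <= _); last by rewrite divff ?gt_eqF // ler1n.
  rewrite ler_wpM2r ?invr_ge0 ?(ltW u0) //.
  by rewrite -[leRHS]lnK ?posrE // ler_expR ler_piMl // ltW.
have e1 : cexp (z * log0 (toC 1)) = 1 by rewrite log0_toC // ln1 toC0 mulr0 cexp0.
rewrite -e1 -log0_toC //.
apply: le_trans (_ : 2 * cmod z * `|t - 1| <= _); last first.
  by rewrite ler_wpM2r // lerDl.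
have [t1|t1] := leP 1 t.
  rewrite ger0_norm ?subr_ge0 //.
  apply: (@mean_value_ineq _ (fun x => cexp (z * log0 (toC x))) _ _ _ _ t1).
    by move=> u /andP[u1 _]; apply: is_rderive_cpow; lra.
  by move=> u /andP[u1 _]; apply: bd; lra.
rewrite cmodBC distrC ger0_norm ?subr_ge0 ?(ltW t1) //.
apply: (@mean_value_ineq _ (fun x => cexp (z * log0 (toC x))) _ _ _ _ (ltW t1)).
  by move=> u /andP[u1 _]; apply: is_rderive_cpow; lra.
by move=> u /andP[u1 _]; apply: bd; lra.
Qed.

End PowerBound.

Section MellinMoments.
Context d (T : measurableType d) {R : realType} (P : probability T R).
Variables (Y : T -> R) (W : C R -> C R).
Hypothesis Y0 : forall t, 0 < Y t.
Hypothesis WE : forall z, Cgt0 z ->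
  cintegrable P setT (fun t => cexp ((z - 1) * toC (ln (Y t)))) /\
  W z = cintegral P setT (fun t => cexp ((z - 1) * toC (ln (Y t)))).

Definition moment n := Rintegral P setT (fun t => Y t ^+ n).

Lemma cexp_ln_nat (n : nat) (y : R) : 0 < y ->
  cexp ((toC n.+1%:R - 1) * toC (ln y)) = toC (y ^+ n).
Proof.
move=> y0; rewrite -toC1 -toCB -toCM cexpC -natr1 addrK.
by rewrite -[in RHS](lnK y0) -expRM_natl mulrC.
Qed.

Lemma moment_integrable n : P.-integrable setT (EFin \o (fun t => Y t ^+ n)).
Proof.
have [|[h _] _] := WE (z := toC n.+1%:R); first by rewrite /Cgt0 /= ltr0n.
rewrite (_ : (fun t => Y t ^+ n) = (fun t => Re (cexp ((toC n.+1%:R - 1) * toC (ln (Y t)))))) //.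
by apply/funext => t; rewrite cexp_ln_nat.
Qed.

Lemma mellin_nat n : W (toC n.+1%:R) = toC (moment n).
Proof.
have [|_ ->] := WE (z := toC n.+1%:R); first by rewrite /Cgt0 /= ltr0n.
transitivity (cintegral P setT (fun t => toC (Y t ^+ n))).
  by apply: eq_cintegral => t _; exact: cexp_ln_nat.
by apply: eq_ReIm; rewrite ?cReC ?cImC //= Rintegral_cst // mul0r.
Qed.

(** A zero mean would make Y vanish almost surely, so the exceptional null set would be the whole
    probability space. *)
Lemma moment1_gt0 : 0 < moment 1.
Proof.
have i1 := moment_integrable 1; have mi := measurable_int _ i1.
have m0 : 0 <= moment 1 by apply: Rintegral_ge0 => t _; rewrite expr1 ltW.
rewrite lt_neqAle m0 andbT eq_sym; apply/eqP => mz.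
have : (\int[P]_(t in setT) `|(EFin \o (fun t => Y t ^+ 1)%R) t| = 0)%E.
  transitivity (\int[P]_t (EFin \o (fun t => Y t ^+ 1)%R) t)%E.
    by apply: eq_integral => t _ /=; rewrite ger0_norm // expr1 ltW.
  have := integrable_fin_num measurableT i1 => /fineK <-.
  by rewrite -[fine _]/(moment 1) mz.
move/(ae_eq_integral_abs P measurableT mi).
move=> [A [mA PA0 sub]].
have AT : A = setT.
  apply/seteqP; split => // t _; apply: sub => /= /(_ I) [] h.
  by have := Y0 t; rewrite -(expr1 (Y t)) h ltxx.
have := probability_setT P; rewrite -AT.
by move=> h; have : (0 = 1 :> \bar R)%E := etrans (esym PA0) h; move/eqP; rewrite eq_sym onee_eq0.
Qed.

(* AM-GM: |x| <= (dl + x^2 / dl) / 2, with x = Y / kap - 1. *)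
Lemma mellin_tilt_le n (z : C R) (kap dl : R) : 0 < Re z <= 1 -> 0 < kap -> 0 < dl ->
  cmod (W (z + toC n.+1%:R) * cexp (- (z * toC (ln kap))) - W (toC n.+1%:R)) <=
  (2 * cmod z + 4) * ((dl / 2 + (2 * dl)^-1) * moment n
     - (dl * kap)^-1 * moment n.+1 + (2 * dl * kap ^+ 2)^-1 * moment n.+2).
Proof.
move=> /andP[z0 z1] k0 dl0; set c := 2 * cmod z + 4.
have c0 : 0 <= c by rewrite /c addr_ge0 // mulr_ge0 // cmod_ge0.
have wz : Cgt0 (z + toC n.+1%:R) by rewrite /Cgt0 /= cReD cReC ltr_pwDl // ler0n.
have [i1 ->] := WE wz; have [|i2 ->] := WE (z := toC n.+1%:R); first by rewrite /Cgt0 /= ltr0n.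
rewrite mulrC -(cintegralZ measurableT) //.
rewrite -(cintegralB measurableT) //; last exact: cintegrableZ.
set g := fun t => _.
have gE t : g t = toC (Y t ^+ n) * (cexp (z * toC (ln (Y t / kap))) - 1).
  rewrite /g mulrBr mulr1 -!cexp_ln_nat // -!cexpD; congr (cexp _ - _).
  by rewrite lnM ?posrE ?invr_gt0 // lnV ?posrE // toCD toCN; ring.
pose q t := (c * (dl / 2 + (2 * dl)^-1)) * Y t ^+ n + (- (c * (dl * kap)^-1)) * Y t ^+ n.+1
   + (c * (2 * dl * kap ^+ 2)^-1) * Y t ^+ n.+2.
have iZ (a : R) m : P.-integrable setT (EFin \o (fun t => a * Y t ^+ m)).
  by apply: rintegrableZ => //; exact: moment_integrable.
have iD (p1 p2 : T -> R) := @rintegrableD _ _ _ P _ measurableT p1 p2.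
apply: le_trans (_ : Rintegral P setT q <= _).
  apply: cmod_cintegral_le => //.
  - by apply: cintegrableB => //; exact: cintegrableZ.
  - by apply: (iD) => //; exact: iD.
  move=> t _; rewrite gE cmodM cmodC ger0_norm ?exprn_ge0 ?(ltW (Y0 t)) //.
  have t0 : 0 < Y t / kap by rewrite divr_gt0.
  have zz : 0 <= Re z <= 1 by rewrite (ltW z0).
  apply: le_trans (ler_wpM2l _ (cpow_sub1_le t0 zz)) _; first by rewrite exprn_ge0 // ltW.
  rewrite -/c (_ : q t = Y t ^+ n * (c * ((dl + (Y t / kap - 1) ^+ 2 / dl) / 2))); last first.
    by rewrite /q !exprS; field; rewrite !gt_eqF.
  rewrite ler_wpM2l ?exprn_ge0 ?(ltW (Y0 t)) // ler_wpM2l //.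
  set x := _ - 1; have := sqr_ge0 (`|x| - dl); rewrite sqrrB real_normK ?num_real // => h.
  rewrite -subr_ge0 (_ : _ - _ = (x ^+ 2 - `|x| * dl *+ 2 + dl ^+ 2) / (2 * dl)).
    by rewrite divr_ge0 // mulr_ge0 // ltW.
  by field; rewrite gt_eqF.
rewrite /q RintegralD //; [|exact: iD].
rewrite RintegralD // !RintegralZl //; try exact: moment_integrable.
by rewrite le_eqVlt /moment; apply/orP; left; apply/eqP; ring.
Qed.

End MellinMoments.

Section MellinStirling.
Context {R : realType}.
Variables (l l1 l2 l3 : C R -> C R).
Hypothesis dl : forall w, Cgt0 w -> is_cderive l w (l1 w).
Hypothesis dl1 : forall w, Cgt0 w -> is_cderive l1 w (l2 w).
Hypothesis dl2 : forall w, Cgt0 w -> is_cderive l2 w (l3 w).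
Hypothesis bl1 : forall w, Cgt0 w -> cmod (l1 w) <= (Re w)^-1.
Hypothesis bl2 : forall w, Cgt0 w -> cmod (l2 w) <= 5 * (Re w) ^- 2.

(** A logarithm of the right-hand side of the representation: the halves come from the square roots,
    [seg_int] is L and [saw_diff] is E. *)
Definition stirling_exponent (z : C R) : C R :=
  2^-1 * l 1 - l z - 2^-1 * l (1 + z) + seg_int l z 1 - saw_diff l2 z 1.

Lemma cexp_near1 (K e : R) : 0 <= K -> 0 < e -> exists N, forall n, (N <= n)%N ->
  forall h : C R, cmod h <= K / n.+1%:R -> cmod (cexp h - 1) <= e.
Proof.
move=> K0 e0; pose b := expR K * K; have b0 : 0 <= b by rewrite mulr_ge0 // expR_ge0.
exists (Num.truncn (b / e)) => n nN h hK; apply: le_trans (cexp_sub1_le _) _.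
have n0 : 0 < n.+1%:R :> R by rewrite ltr0n.
apply: le_trans (_ : expR K * (K / n.+1%:R) <= _).
  apply: ler_pM => //; [exact: cmod_ge0|].
  rewrite ler_expR; apply: le_trans hK _.
  by rewrite ler_pdivrMr // ler_peMr // ler1n.
rewrite mulrA ler_pdivrMr // -/b mulrC -ler_pdivrMr //.
have := truncnS_gt (b / e); move/ltW/le_trans; apply.
by rewrite ler_nat ltnS.
Qed.

Lemma cmod_mulB1_le (x y : C R) (e : R) : cmod (x - 1) <= Num.min (e / 4) 1 ->
  cmod (y - 1) <= Num.min (e / 4) 1 -> cmod (x * y - 1) <= e.
Proof.
rewrite !le_min => /andP[h1 h1'] /andP[h2 _].
rewrite (_ : x * y - 1 = (x - 1) * (y - 1) + (x - 1) + (y - 1)); last by ring.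
apply: le_trans (cmodD _ _) _.
apply: le_trans (lerD (cmodD _ _) (lexx _)) _; rewrite cmodM.
have : cmod (x - 1) * cmod (y - 1) <= 1 * cmod (y - 1) by rewrite ler_wpM2r ?cmod_ge0.
have := cmod_ge0 (x - 1); rewrite mul1r; lra.
Qed.

Definition stirling_bound (z : C R) : R := cmod z ^+ 2 + 2 * cmod z + 2.

Lemma stirling_bound_ge0 z : 0 <= stirling_bound z.
Proof. by rewrite /stirling_bound !addr_ge0 ?mulr_ge0 ?exprn_ge0 ?cmod_ge0. Qed.

Lemma cmod_stirling_sumB z n : Cgt0 z ->
  cmod (stirling_sum l z n - stirling_exponent z) <= stirling_bound z / n.+1%:R.
Proof. by rewrite cmodBC => z0; exact: (stirling dl dl1 dl2 bl1 bl2). Qed.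

(** The Stirling sums converge to the exponent, so w cexp (- S_n) -> 1 determines w. This criterion
    serves for real zeta, for the open half-plane and for the imaginary axis. *)
Lemma stirling_unique z (w : C R) : Cgt0 z ->
  (forall e : R, 0 < e -> exists N, forall n, (N <= n)%N ->
     cmod (w * cexp (- stirling_sum l z n) - 1) <= e) ->
  w = cexp (stirling_exponent z).
Proof.
move=> z0 Hw; set G := stirling_exponent z.
suff H : w * cexp (- G) = 1 by apply: (mulIf (cexp_neq0 (- G))); rewrite H -cexpD subrr cexp0.
apply/eqP; rewrite -subr_eq0 -cmod_eq0 eq_le cmod_ge0 andbT; apply/ler_addgt0Pr => e e0.
rewrite add0r.
have e3 : 0 < Num.min (e / 4) 1 by rewrite lt_min ltr01 andbT; apply: divr_gt0.
have [N1 HN1] := Hw _ e3; have [N2 HN2] := cexp_near1 (stirling_bound_ge0 z) e3.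
pose n := maxn N1 N2; have h1 := HN1 n (leq_maxl _ _).
have h2 := HN2 n (leq_maxr _ _) _ (cmod_stirling_sumB n z0).
have := cmod_mulB1_le h1 h2; rewrite -mulrA -cexpD addrA addNr sub0r; exact.
Qed.

Variables (W : C R -> C R).
Hypothesis W1 : W 1 = 1.
Hypothesis WS : forall z, Cgt0 z -> W (z + 1) = cexp (l z) * W z.

Lemma natC1 n : toC n.+2%:R = toC n.+1%:R + 1 :> C R.
Proof. by rewrite -toC1 -toCD natr1. Qed.

Lemma Cgt0_nat n : Cgt0 (toC n.+1%:R : C R).
Proof. by rewrite /Cgt0 /= ltr0n. Qed.

Lemma Cgt0D (z w : C R) : Cgt0 z -> Cgt0 w -> Cgt0 (z + w).
Proof. by rewrite /Cgt0 /= !cReD; exact: addr_gt0. Qed.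

Lemma WS_nat z n : Cgt0 z ->
  W (z + toC n.+2%:R) = cexp (l (z + toC n.+1%:R)) * W (z + toC n.+1%:R).
Proof. by move=> z0; rewrite natC1 addrA WS //; apply: Cgt0D => //; exact: Cgt0_nat. Qed.

Lemma W_nat_neq0 n : W (toC n.+1%:R) != 0.
Proof.
elim: n => [|n IH]; first by rewrite toC1 W1 oner_eq0.
by rewrite natC1 WS ?mulf_neq0 ?cexp_neq0 //; exact: Cgt0_nat.
Qed.

(* The expectation of [(Y / kap) ^ z] under the law of [Y] tilted by [Y ^ n],
   where [kap = cexp (l n.+1)] is the tilted mean of [Y]. *)
Definition gamma_ratio (z : C R) n : C R :=
  W (z + toC n.+1%:R) * cexp (- (z * l (toC n.+1%:R))) / W (toC n.+1%:R).

(** The functional equation, iterated from z and from 1, writes W(z + n + 2) / W(n + 2) as W(z)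
    times a quotient of products of values of kappa; that quotient is the inverse of the
    exponentiated sum. *)
Lemma cexp_stirling_sum z n : Cgt0 z ->
  cexp (stirling_sum l z n) * gamma_ratio z n.+1 = W z.
Proof.
move=> z0; pose S n := - l z + \sum_(j < n.+1) (l (toC j.+1%:R) - l (toC j.+1%:R + z)).
have key : cexp (S n) * W (z + toC n.+2%:R) = W z * W (toC n.+2%:R).
  elim: n => [|n IH].
    have W2 : W (toC 2%:R) = cexp (l 1).
      by rewrite natC1 WS ?toC1 ?W1 ?mulr1 //; have := Cgt0_nat 0; rewrite toC1.
    rewrite /S big_ord1 WS_nat // W2 toC1 WS // (addrC z) !cexpD !mulrA.
    rewrite [LHS](_ : _ = (cexp (- l z) * cexp (l z)) * (cexp (- l (1 + z)) * cexp (l (1 + z))) *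
      cexp (l 1) * W z); last by ring.
    have cN (u : C R) : cexp (- u) * cexp u = 1 by rewrite -cexpD addNr cexp0.
    by rewrite !cN !mul1r mulrC.
  have -> : cexp (S n.+1) = cexp (S n) * (cexp (l (toC n.+2%:R)) * cexp (- l (toC n.+2%:R + z))).
    by rewrite /S big_ord_recr /= addrA !cexpD.
  rewrite WS_nat // [in RHS]natC1 WS; last exact: Cgt0_nat.
  rewrite (addrC z).
  rewrite [LHS](_ : _ = (cexp (- l (toC n.+2%:R + z)) * cexp (l (toC n.+2%:R + z))) *
    cexp (l (toC n.+2%:R)) * (cexp (S n) * W (z + toC n.+2%:R))); last first.
    by rewrite (addrC z); ring.
  by rewrite -cexpD addNr cexp0 mul1r IH; ring.
rewrite /gamma_ratio /stirling_sum -/(S n) cexpD.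
rewrite [LHS](_ : _ = (cexp (S n) * W (z + toC n.+2%:R)) *
   (cexp (z * l (toC n.+2%:R)) * cexp (- (z * l (toC n.+2%:R)))) / W (toC n.+2%:R)); last first.
  by ring.
by rewrite key -cexpD subrr cexp0 mulr1 mulfK // W_nat_neq0.
Qed.

Lemma gamma_ratioS z n : Cgt0 z ->
  gamma_ratio (z + 1) n =
  gamma_ratio z n * cexp (l (toC n.+1%:R + z) - l (toC n.+1%:R)).
Proof.
move=> z0; rewrite /gamma_ratio addrAC WS; last by apply: Cgt0D => //; exact: Cgt0_nat.
rewrite mulrDl mul1r opprD !cexpD (addrC z); ring.
Qed.

Hypothesis l_real : forall x : R, 0 < x -> Im (l (toC x)) = 0.
Hypothesis W_mellin : mellin_transform W.

(** For 0 < Re z <= 1, [mellin_tilt_le] bounds the deviation by the relative variance of the tilted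
    law. That variance is kr (n+1) / kr n - 1, which tends to 0 because |l'| <= 1 / Re. Unit steps
    in z then reach larger real parts. *)
Lemma gamma_ratio_cvg1 z : Cgt0 z ->
  forall e : R, 0 < e -> exists N, forall n, (N <= n)%N -> cmod (gamma_ratio z n - 1) <= e.
Proof.
case: W_mellin => d [T [P [Y [Y0 WE]]]].
pose kr n := expR (Re (l (toC n.+1%:R))).
have lE n : l (toC n.+1%:R) = toC (ln (kr n)).
  by rewrite /kr expRK; apply: eq_ReIm; rewrite ?cReC ?cImC ?l_real.
have kr0 n : 0 < kr n by exact: expR_gt0.
have kE n : cexp (l (toC n.+1%:R)) = toC (kr n) by rewrite lE cexpC lnK ?posrE.
pose m := moment P Y.
have mE n : W (toC n.+1%:R) = toC (m n) := mellin_nat Y0 WE n.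
have mS n : m n.+1 = kr n * m n.
  have : toC (m n.+1) = toC (kr n * m n).
    by rewrite toCM -kE -!mE natC1 WS //; exact: Cgt0_nat.
  by move/(congr1 (fun w => Re w)); rewrite !cReC.
have m0 n : 0 < m n.
  elim: n => [|n IH]; last by rewrite mS mulr_gt0.
  have : toC (m 0%N) = toC 1 by rewrite -mE toC1 W1.
  by move/(congr1 (fun w => Re w)); rewrite !cReC => ->.
have strip (w : C R) : 0 < Re w <= 1 -> forall e : R, 0 < e ->
    exists N, forall n, (N <= n)%N -> cmod (gamma_ratio w n - 1) <= e.
  move=> w01 e e0; pose c := 2 * cmod w + 4.
  have c0 : 0 < c by rewrite ltr_wpDl // mulr_ge0 // cmod_ge0.
  (* Once the relative variance is below del^2, both halves of the arithmetic-geometric mean bound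
     are at most del / 2. *)
  pose del := e / c; have del0 : 0 < del by rewrite divr_gt0.
  have [N HN] := cexp_near1 (@ler01 R) (exprn_gt0 2 del0).
  exists N => n nN; have := HN n nN (l (toC n.+1%:R + 1) - l (toC n.+1%:R)).
  have -> : cexp (l (toC n.+1%:R + 1) - l (toC n.+1%:R)) - 1 = toC (kr n.+1 / kr n - 1).
    by rewrite -natC1 cexpD cexpN !kE -toCV -toCM -toC1 -toCB.
  rewrite cmodC => hr; have {hr} : `|kr n.+1 / kr n - 1| <= del ^+ 2.
    by apply: hr; apply: le_trans (cmod_l_shift dl bl1 _ _) _; rewrite ?ltr0n ?cmod1.
  move/(le_trans (ler_norm _)) => hr.
  have -> : gamma_ratio w n - 1 =
     (W (w + toC n.+1%:R) * cexp (- (w * toC (ln (kr n)))) - W (toC n.+1%:R)) / W (toC n.+1%:R).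
    by rewrite /gamma_ratio -lE mulrBl divff // W_nat_neq0.
  rewrite cmodM cmodV {2}mE cmodC gtr0_norm // ler_pdivrMr //.
  apply: le_trans (mellin_tilt_le Y0 WE n w01 (kr0 n) del0) _; rewrite -/m -/c !mS.
  rewrite (_ : c * _ = c * m n * (del / 2 + (kr n.+1 / kr n - 1) / (2 * del))); last first.
    by field; rewrite !gt_eqF.
  rewrite (_ : e * m n = c * m n * del); last by rewrite /del; field; rewrite gt_eqF.
  rewrite ler_wpM2l ?mulr_ge0 ?(ltW c0) ?(ltW (m0 n)) //.
  have : (kr n.+1 / kr n - 1) / (2 * del) <= del / 2.
    rewrite [leRHS](_ : _ = del ^+ 2 / (2 * del)); last by field; rewrite gt_eqF.
    by rewrite ler_wpM2r // invr_ge0 mulr_ge0 // ltW.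
  move: (_ / (2 * del)) => x; lra.
move=> z0; have [N zN] : exists N : nat, Re z <= N.+1%:R.
  exists (Num.truncn (Re z)); exact: ltW (truncnS_gt _).
elim: N z z0 zN => [|N IH] z z0 zN; first by apply: strip; rewrite z0.
have [z1|z1] := leP (Re z) 1; first by apply: strip; rewrite z0.
have w0 : Cgt0 (z - 1) by rewrite /Cgt0 /= cReB cRe1 subr_gt0.
have {IH} Hw := IH (z - 1) w0 _; move=> e e0.
have e4 : 0 < Num.min (e / 4) 1 by rewrite lt_min ltr01 andbT; apply: divr_gt0.
have [|N1 HN1] := Hw _ _ e4; first by rewrite cReB cRe1 lerBlDr natr1.
have [N2 HN2] := cexp_near1 (cmod_ge0 (z - 1)) e4.
exists (maxn N1 N2) => n; rewrite geq_max => /andP[/HN1 h1 /HN2 h2].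
have -> : gamma_ratio z n = gamma_ratio (z - 1) n * cexp (l (toC n.+1%:R + (z - 1)) - l (toC n.+1%:R)).
  by rewrite -gamma_ratioS // subrK.
apply: cmod_mulB1_le h1 (h2 _ _).
by apply: (cmod_l_shift dl bl1); rewrite ?ltr0n //; exact: ltW.
Qed.

Lemma mellin_stirling z : Cgt0 z -> W z = cexp (stirling_exponent z).
Proof.
move=> z0; apply: stirling_unique => // e e0.
have [N HN] := gamma_ratio_cvg1 z0 e0; exists N => n nN.
by rewrite -(cexp_stirling_sum n z0) mulrAC -cexpD subrr cexp0 mul1r; apply/HN/leqW.
Qed.

End MellinStirling.

(** * Bivariate Bernstein-gamma functions *)

Section ComplexSequences.
Context {R : realType}.
Implicit Types (u v : nat -> C R) (a b : C R).

Definition ccvg u a := forall e : R, 0 < e ->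
  exists N, forall n, (N <= n)%N -> cmod (u n - a) <= e.

Lemma ccvg_cst a : ccvg (fun=> a) a.
Proof. by move=> e e0; exists 0%N => n _; rewrite subrr cmod0 ltW. Qed.

Lemma ccvg_comp (f : C R -> C R) u a d : is_cderive f a d -> ccvg u a ->
  ccvg (fun n => f (u n)) (f a).
Proof.
move=> /is_cderive_lip[r r0 Hr] Hu e e0.
have d1 : 0 < cmod d + 1 by rewrite ltr_wpDl ?cmod_ge0.
have s0 : 0 < Num.min (r / 2) (e / (cmod d + 1)) by rewrite lt_min !divr_gt0.
have [N HN] := Hu _ s0; exists N => n /HN; rewrite le_min => /andP[h1 h2].
have hr : cmod (u n - a) < r.
  by apply: le_lt_trans h1 _; rewrite ltr_pdivrMr // ltr_pMr // ltr1n.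
have := Hr _ hr; rewrite (addrC a) subrK => h; apply: le_trans h _.
by rewrite mulrC -ler_pdivlMr.
Qed.

Lemma ccvgD u v a b : ccvg u a -> ccvg v b -> ccvg (fun n => u n + v n) (a + b).
Proof.
move=> Hu Hv e e0; have e2 : 0 < e / 2 by rewrite divr_gt0.
have [N1 H1] := Hu _ e2; have [N2 H2] := Hv _ e2.
exists (maxn N1 N2) => n; rewrite geq_max => /andP[/H1 h1 /H2 h2].
rewrite opprD addrACA; apply: le_trans (cmodD _ _) _; lra.
Qed.

Lemma ccvgZ c u a : ccvg u a -> ccvg (fun n => c * u n) (c * a).
Proof. exact: ccvg_comp (is_cderiveZ c (is_cderive_id a)). Qed.

Lemma ccvgN u a : ccvg u a -> ccvg (fun n => - u n) (- a).
Proof. exact: ccvg_comp (is_cderiveN (is_cderive_id a)). Qed.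

Lemma ccvg_sum (n : nat) (F : nat -> nat -> C R) (G : nat -> C R) :
  (forall j, ccvg (F j) (G j)) ->
  ccvg (fun m => \sum_(j < n) F j m) (\sum_(j < n) G j).
Proof.
move=> H; elim: n => [|n IH].
  rewrite big_ord0 (_ : (fun m => _) = (fun=> 0)); first exact: ccvg_cst.
  by apply/funext => m; rewrite big_ord0.
rewrite big_ord_recr (_ : (fun m => _) = (fun m => \sum_(j < n) F j m + F n m)); last first.
  by apply/funext => m; rewrite big_ord_recr.
exact: ccvgD.
Qed.

(** By polarisation, products reduce to squares, which are covered by [ccvg_comp]. *)
Lemma ccvgM u v a b : ccvg u a -> ccvg v b -> ccvg (fun n => u n * v n) (a * b).
Proof.
move=> Hu Hv.
have sq w c : ccvg w c -> ccvg (fun n => w n * w n) (c * c).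
  exact: (ccvg_comp (f := fun w => w * w) (is_cderiveM (is_cderive_id c) (is_cderive_id c))).
have E (x y : C R) : x * y = 4^-1 * ((x + y) * (x + y) + - ((x + - y) * (x + - y))) by field.
rewrite E (_ : (fun n => _) = fun n =>
  4^-1 * ((u n + v n) * (u n + v n) + - ((u n + - v n) * (u n + - v n)))); last first.
  by apply/funext => n; rewrite E.
by apply/ccvgZ/ccvgD; [exact/sq/ccvgD|exact/ccvgN/sq/ccvgD/ccvgN].
Qed.

Lemma ccvg_cmod_le u a b (e : R) : ccvg u a -> (forall n, cmod (u n - b) <= e) ->
  cmod (a - b) <= e.
Proof.
move=> Hu H; apply/ler_addgt0Pr => s s0; have [N HN] := Hu _ s0.
rewrite -(subrK (u N) a) -addrA; apply: le_trans (cmodD _ _) _.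
rewrite [leRHS]addrC; apply: lerD; [by rewrite cmodBC; exact: HN|exact: H].
Qed.

Lemma cmod_nbhs_ball a (A : set (C R)) : nbhs a A ->
  exists2 r : R, 0 < r & forall w, cmod (w - a) < r -> A w.
Proof.
move=> /nbhs_ballP[e /= e0 hA].
have eR : e = toC (cmod e) by rewrite -normCE gtr0_norm.
exists (cmod e); first by move: e0; rewrite {1}eR -toC0 ltr_toC.
move=> w hw; apply: hA; rewrite /ball /= /ball_ normCE eR ltr_toC cmodBC //.
Qed.

Lemma ccvg_within (f : C R -> C R) (D : set (C R)) a u :
  f w @[w --> within D (nbhs a)] --> f a -> ccvg u a -> (forall n, D (u n)) ->
  ccvg (fun n => f (u n)) (f a).
Proof.
move=> Hf Hu Du e e0.
have : nbhs (f a) [set w | cmod (w - f a) <= e].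
  apply/nbhs_ballP; exists (toC e); first by rewrite /= -toC0 ltr_toC.
  by move=> w; rewrite /ball /= /ball_ normCE ltr_toC cmodBC => /ltW.
move/Hf; rewrite nbhs_simpl /within /= => /cmod_nbhs_ball[r r0 Hr].
have r2 : 0 < r / 2 by rewrite divr_gt0.
have [N HN] := Hu _ r2; exists N => n nN; apply: (Hr (u n)) => //.
by apply: le_lt_trans (HN _ nN) _; rewrite ltr_pdivrMr // ltr_pMr // ltr1n.
Qed.

End ComplexSequences.

Section ZetaDependence.
Context {R : realType}.
Implicit Types (F : nat -> C R -> C R) (W : C R -> C R -> C R) (zeta z : C R).

Lemma ex_cderive_sum n F zeta : (forall j, exists d, is_cderive (F j) zeta d) ->
  exists d, is_cderive (fun w => \sum_(j < n) F j w) zeta d.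
Proof.
move=> H; elim: n => [|n [d Hd]].
  exists 0; rewrite (_ : (fun w => _) = (fun=> 0)); first exact: is_cderive_cst.
  by apply/funext => m; rewrite big_ord0.
have [d' Hd'] := H n; exists (d + d').
rewrite (_ : (fun w => _) = (fun w => \sum_(j < n) F j w + F n w)); last first.
  by apply/funext => m; rewrite big_ord_recr.
exact: is_cderiveD.
Qed.

Lemma ex_cderive_pair W zeta z : differentiable (fun p : C R * C R => W p.1 p.2) (zeta, z) ->
  exists d, is_cderive (W^~ z) zeta d.
Proof.
move=> dW; have dp : differentiable (fun w : C R => (w, z)) zeta.
  by apply: differentiable_pair; apply/derivable1_diffP; [exact: derivable_id|exact: derivable_cst].
have H := differentiable_comp dp dW; eexists.
by apply: derivableP; apply/derivable1_diffP.
Qed.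

End ZetaDependence.

Section SawSplit.
Context {R : realType}.
Local Notation leb := (@lebesgue_measure R).
Variables (l2 l3 : C R -> C R).
Hypothesis dl2 : forall w, Cgt0 w -> is_cderive l2 w (l3 w).
Hypothesis bl2 : forall w, Cgt0 w -> cmod (l2 w) <= 5 * (Re w) ^- 2.

(** A uniform bound e on l'' cannot be integrated over a half-line: it is used on [1, b] only, and
    the universal tail bound takes over beyond b. *)
Lemma cmod_saw_tail_split (z : C R) (b e : R) : 1 <= b -> 0 <= Re z -> 0 <= e ->
  (forall w, 1 <= Re w -> cmod (l2 w) <= e) ->
  cmod (saw_tail l2 z 1) <= e * b + b^-1.
Proof.
move=> b1 z0 e0 He; have b0 : 0 < b by exact: lt_le_trans b1.
have q1 : 0 < 1 :> R by [].
have i1 := Psaw_l2_integrable dl2 bl2 q1 z0.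
rewrite /saw_tail (cintegral_split b1 i1) mulrDr; apply: le_trans (cmodD _ _) _.
apply: lerD; last first.
  apply: le_trans (cmod_saw_tail dl2 bl2 b0 z0) _.
  by rewrite lef_pV2 ?posrE ?ltr_wpDr // lerDl.
have mb : leb `[1, b] = (b - 1)%:E.
  rewrite /= lebesgue_measure_itv /= lte_fin; case: ltP => [//|h].
  by rewrite (_ : b = 1) ?subrr //; apply/eqP; rewrite eq_le b1 h.
have ib : leb.-integrable `[1, b] (EFin \o (fun=> e)).
  apply: measurable_bounded_integrable => //; last exact: bounded_cst.
  by rewrite [X in (X < _)%E]mb ltry.
have h : cmod (cintegral leb `[1, b] (fun u => toC (Psaw u) * l2 (toC u + z))) <= e * (b - 1).
  rewrite (_ : e * (b - 1) = Rintegral leb `[1, b] (fun=> e)); last first.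
    by rewrite Rintegral_cst // [X in fine X]mb.
  apply: cmod_cintegral_le => //.
    case: i1 => [i1 i2]; split; [apply: integrableS i1 => //|apply: integrableS i2 => //];
      by move=> x /=; rewrite !in_itv /= andbT => /andP[].
  move=> u; rewrite /= in_itv /= => /andP[u1 _]; have /andP[p0 p1] := Psaw_ge0_le u.
  rewrite cmodM cmodC ger0_norm // -[leRHS]mul1r.
  apply: ler_pM; rewrite ?cmod_ge0 //; first by apply: le_trans p1 _; rewrite invf_le1 ?ler1n.
  by apply: He; rewrite cReD cReC ler_wpDr.
rewrite cmodM (_ : cmod (2^-1 : C R) = 2^-1); last first.
  by rewrite cmodV -(toC_nat 2) cmodC ger0_norm.
move: h; set X := cmod _ => h; have : 0 <= X by exact: cmod_ge0.
have : 0 <= e * b by rewrite mulr_ge0 // ltW.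
by move: h e0; rewrite mulrBr mulr1; move: (e * b) => y; lra.
Qed.

End SawSplit.

Section BernsteinGamma.
Context {R : realType}.
Variables (kappa : C R -> C R -> C R) (k00 d1 d2 : R).
Variables (mu : {measure set (R * R)%type -> \bar R}).
Hypothesis rep : bernstein2_rep kappa k00 d1 d2 mu.
Hypothesis nondeg : 0 < Re (kappa 0 1).

Definition lk zeta := logk (kappa zeta).
Definition lk1 zeta := logk1 (kappa zeta) (kappa1 d2 mu zeta).
Definition lk2 zeta := logk2 (kappa zeta) (kappa1 d2 mu zeta) (kappa2 mu zeta).
Definition lk3 zeta := logk3 (kappa zeta) (kappa1 d2 mu zeta) (kappa2 mu zeta) (kappa3 mu zeta).

Section FixedZeta.
Variable zeta : C R.
Hypothesis hz : Cge0 zeta.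

Let dk := is_cderive_kappa rep hz.
Let dk1 := is_cderive_kappa1 rep hz.
Let dk2 := is_cderive_kappa2 rep hz.
Let kp w (w0 : Cgt0 w) := Re_kappa_gt0 rep nondeg hz w0.
Let bk1 := cmod_kappa1 rep hz.
Let bk2 := cmod_kappa2 rep hz.

Lemma is_cderive_lk w : Cgt0 w -> is_cderive (lk zeta) w (lk1 zeta w).
Proof. exact: is_cderive_logk. Qed.
Lemma is_cderive_lk1 w : Cgt0 w -> is_cderive (lk1 zeta) w (lk2 zeta w).
Proof. exact: is_cderive_logk1. Qed.
Lemma is_cderive_lk2 w : Cgt0 w -> is_cderive (lk2 zeta) w (lk3 zeta w).
Proof. exact: is_cderive_logk2. Qed.
Lemma cmod_lk1 w : Cgt0 w -> cmod (lk1 zeta w) <= (Re w)^-1.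
Proof. exact: cmod_logk1. Qed.
Lemma cmod_lk2 w : Cgt0 w -> cmod (lk2 zeta w) <= 5 * (Re w) ^- 2.
Proof. exact: cmod_logk2. Qed.

Lemma cexp_lk w : Cgt0 w -> cexp (lk zeta w) = kappa zeta w.
Proof. by move=> w0; rewrite /lk /logk log0K // neq0_Re_gt0 // kp. Qed.

Lemma E_saw_diff z : 0 <= Re z -> E_ kappa zeta z = saw_diff (lk2 zeta) z 1.
Proof. by move=> z0; exact: (E_logk dk dk1 dk2 kp bk1 bk2 z0). Qed.

Lemma T_saw_tail : T_ kappa zeta = - saw_tail (lk2 zeta) 0 1.
Proof. exact: (T_logk dk dk1 dk2 kp bk1 bk2). Qed.

Lemma cmod_E_le2 z : 0 <= Re z -> cmod (E_ kappa zeta z) <= 2.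
Proof.
move=> z0; rewrite E_saw_diff //.
by have := cmod_saw_diff is_cderive_lk2 cmod_lk2 (ltr01) z0; rewrite divr1.
Qed.

(** The tails at 0 cancel, and the tail at z remains. *)
Lemma cmod_E_sub_T z : 0 <= Re z -> cmod (E_ kappa zeta z - T_ kappa zeta) <= (1 + Re z)^-1.
Proof.
move=> z0; rewrite E_saw_diff // T_saw_tail opprK /saw_diff subrK.
exact: (cmod_saw_tail is_cderive_lk2 cmod_lk2).
Qed.

Lemma stirling_exponentE z : Cgt0 z ->
  csqrt (kappa zeta 1) / (kappa zeta z * csqrt (kappa zeta (1 + z)))
    * cexp (L_ kappa zeta z) * cexp (- E_ kappa zeta z) =
  cexp (stirling_exponent (lk zeta) (lk2 zeta) z).
Proof.
move=> z0; rewrite E_saw_diff; last exact: ltW.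
rewrite /stirling_exponent -(cexp_lk z0) invfM -!cexpN -!cexpD -/(lk zeta _).
by congr cexp; rewrite [in LHS]addrA.
Qed.

End FixedZeta.

Variable W : C R -> C R -> C R.
Hypothesis WG : bernstein_gamma2 kappa W.

Lemma W_lkS zeta z : Cge0 zeta -> Cgt0 z ->
  W zeta (z + 1) = cexp (lk zeta z) * W zeta z.
Proof. by case: WG => WS _ _ _ hz z0; rewrite cexp_lk // WS. Qed.

Lemma W_real (q : R) z : 0 <= q -> Cgt0 z ->
  W (toC q) z = cexp (stirling_exponent (lk (toC q)) (lk2 (toC q)) z).
Proof.
case: (WG) => _ W1 _ Wm q0 z0; have hq : Cge0 (toC q : C R) by [].
apply: (mellin_stirling (is_cderive_lk hq) (is_cderive_lk1 hq) (is_cderive_lk2 hq)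
  (cmod_lk1 hq) (cmod_lk2 hq)) => //.
- exact: W1.
- by move=> w; exact: W_lkS.
- move=> x x0; rewrite /lk /logk.
  have -> : kappa (toC q) (toC x) = toC (Re (kappa (toC q) (toC x))).
    by apply: eq_ReIm; rewrite ?cReC ?cImC // (Im_kappa_real rep) // ltW.
  rewrite log0_toC ?cImC //; exact: (Re_kappa_gt0 rep nondeg hq).
- exact: Wm.
Qed.

Let S n z (zeta : C R) := stirling_sum (lk zeta) z n.

Lemma ex_cderive_lk zeta w : Cgt0 zeta -> Cgt0 w -> exists d, is_cderive (fun s => lk s w) zeta d.
Proof.
move=> hz w0; have [d Hd] := is_cderive_kappa_zeta rep hz (ltW w0 : Cge0 w).
eexists; apply: is_cderive_comp Hd; apply: is_cderive_log0.
exact: (Re_kappa_gt0 rep nondeg (ltW hz : Cge0 zeta)).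
Qed.

Lemma ex_cderive_S n z zeta : Cgt0 z -> Cgt0 zeta -> exists d, is_cderive (S n z) zeta d.
Proof.
move=> z0 hz; have D w (w0 : Cgt0 w) := ex_cderive_lk hz w0.
have [a Ha] := D z z0; have [b Hb] := D _ (Cgt0_nat n.+1).
have [|c Hc] := @ex_cderive_sum _ n.+1
  (fun j s => lk s (toC j.+1%:R) - lk s (toC j.+1%:R + z)) zeta.
  move=> j; have [a' Ha'] := D _ (Cgt0_nat j).
  have [b' Hb'] := D _ (Cgt0D (Cgt0_nat j) z0).
  by eexists; exact: is_cderiveB Ha' Hb'.
by eexists; exact: is_cderiveD (is_cderiveD (is_cderiveN Ha) Hc) (is_cderiveZ z Hb).
Qed.

(** All S_n are within B of the same G zeta, so f n is f 0 times the exponential of a quantity of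
    modulus at most 2 B: hence the constant e^(2B) and the dominating function f 0. *)
Lemma W_Cgt0_approx z : Cgt0 z -> forall zeta, Cgt0 zeta -> forall e : R, 0 < e ->
  exists N, forall n, (N <= n)%N -> cmod (W zeta z * cexp (- S n z zeta) - 1) <= e.
Proof.
move=> z0; case: (WG) => _ _ dW _.
pose f n zeta := W zeta z * cexp (- S n z zeta).
have df n zeta : Cgt0 zeta -> exists d, is_cderive (f n) zeta d.
  move=> hz; have [a Ha] := ex_cderive_pair (dW zeta z hz z0).
  have [b Hb] := ex_cderive_S n z0 hz; eexists.
  exact: is_cderiveM Ha (is_cderive_comp (is_cderive_cexp _) (is_cderiveN Hb)).
pose G zeta := stirling_exponent (lk zeta) (lk2 zeta) z.
have SG n zeta : Cge0 zeta -> cmod (S n z zeta - G zeta) <= stirling_bound z / n.+1%:R.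
  move=> hz; exact: (cmod_stirling_sumB (is_cderive_lk hz) (is_cderive_lk1 hz)
    (is_cderive_lk2 hz) (cmod_lk1 hz) (cmod_lk2 hz)).
pose B := stirling_bound z; have B0 : 0 <= B by exact: stirling_bound_ge0.
apply: (@right_half_plane_vanishing _ (fun n w => f n w - 1) (f 0%N) (expR (2 * B))).
- exact: expR_ge0.
- move=> n w hw; have [d Hd] := df n w hw.
  by eexists; exact: is_cderiveB Hd (is_cderive_cst 1 w).
- exact: df.
- move=> n w hw; have hw' : Cge0 w by exact: ltW.
  have -> : f n w = f 0%N w * cexp ((S 0%N z w - G w) - (S n z w - G w)).
    by rewrite /f -mulrA -cexpD; congr (_ * cexp _); ring.
  apply: le_trans (cmodB _ _) _; rewrite cmod1 mulrDr mulr1 cmodM.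
  apply: lerD.
    rewrite mulrC ler_wpM2r ?cmod_ge0 // cmod_cexp ler_expR.
    apply: le_trans (Re_le_cmod _) _; apply: le_trans (cmodB _ _) _.
    rewrite mulr_natl mulr2n; apply: lerD; apply: le_trans (SG _ _ hw') _.
      by rewrite divr1.
    by rewrite ler_pdivrMr // ler_peMr // ler1n.
  by rewrite -expR0 ler_expR mulr_ge0.
- move=> e e0; have [N HN] := cexp_near1 B0 e0; exists N => n nN q q0.
  rewrite /f W_real ?(ltW q0) // -cexpD; apply: (HN n nN).
  by rewrite cmodBC; apply: SG; exact: ltW.
Qed.

Lemma W_Cgt0 zeta z : Cgt0 zeta -> Cgt0 z ->
  W zeta z = cexp (stirling_exponent (lk zeta) (lk2 zeta) z).
Proof.
move=> hz z0; have hz' : Cge0 zeta by exact: ltW.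
apply: (stirling_unique (is_cderive_lk hz') (is_cderive_lk1 hz') (is_cderive_lk2 hz')
  (cmod_lk1 hz') (cmod_lk2 hz') z0) => e e0; exact: W_Cgt0_approx.
Qed.

Lemma ccvg_lk zeta w : Cge0 zeta -> Cgt0 w ->
  ccvg (fun n => lk (zeta + toC n.+1%:R^-1) w) (lk zeta w).
Proof.
move=> hz w0; have Rk := Re_kappa_gt0 rep nondeg hz w0.
apply: (ccvg_comp (is_cderive_log0 Rk)) => e e0.
exact: (kappa_zeta_right_cvg rep hz (ltW w0 : Cge0 w) e0).
Qed.

(** Along zeta + 1 / (m + 1) the bound on W cexp (- S_n) - 1 holds from an N independent of m, so it
    survives the limit in m for each fixed n. *)
Lemma W_Cge0 zeta z : Cge0 zeta -> Cgt0 z ->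
  W xi z @[xi --> within Cgt0 (nbhs zeta)] --> W zeta z ->
  W zeta z = cexp (stirling_exponent (lk zeta) (lk2 zeta) z).
Proof.
move=> hz z0 HW; apply: (stirling_unique (is_cderive_lk hz) (is_cderive_lk1 hz) (is_cderive_lk2 hz)
  (cmod_lk1 hz) (cmod_lk2 hz) z0) => e e0.
have [N HN] := cexp_near1 (stirling_bound_ge0 z) e0; exists N => n nN.
pose x m := zeta + toC m.+1%:R^-1.
have m0 m : 0 < m.+1%:R^-1 :> R by rewrite invr_gt0 ltr0n.
have x0 m : Cgt0 (x m) by rewrite /Cgt0 /= cReD cReC ltr_wpDl.
have xz : ccvg x zeta.
  move=> s s0; exists (Num.truncn s^-1) => m hm; rewrite /x addrAC subrr add0r cmodC gtr0_norm //.
  rewrite -[leRHS]invrK lef_pV2 ?posrE ?invr_gt0 ?ltr0n //.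
  by apply: le_trans (ltW (truncnS_gt _)) _; rewrite ler_nat ltnS.
have cS : ccvg (fun m => S n z (x m)) (S n z zeta).
  apply: ccvgD; last by apply/ccvgZ/ccvg_lk => //; exact: Cgt0_nat.
  apply: ccvgD; first by apply/ccvgN/ccvg_lk.
  apply: (@ccvg_sum _ n.+1 (fun j m => lk (x m) (toC j.+1%:R) - lk (x m) (toC j.+1%:R + z))
    (fun j => lk zeta (toC j.+1%:R) - lk zeta (toC j.+1%:R + z))) => j.
  apply: ccvgD; first by apply: ccvg_lk => //; exact: Cgt0_nat.
  by apply/ccvgN/ccvg_lk => //; apply: Cgt0D => //; exact: Cgt0_nat.
have cW : ccvg (fun m => W (x m) z) (W zeta z) := ccvg_within HW xz x0.
apply: (ccvg_cmod_le (ccvgM cW (ccvg_comp (is_cderive_cexp _) (ccvgN cS)))) => m.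
have hx : Cge0 (x m) := ltW (x0 m).
rewrite W_Cgt0 // -cexpD; apply: (HN n nN); rewrite cmodBC.
exact: (cmod_stirling_sumB (is_cderive_lk hx) (is_cderive_lk1 hx)
    (is_cderive_lk2 hx) (cmod_lk1 hx) (cmod_lk2 hx)).
Qed.

Lemma W_formula zeta z : Cge0 zeta -> Cgt0 z ->
  (Re zeta = 0 -> Im zeta <> 0 -> W xi z @[xi --> within Cgt0 (nbhs zeta)] --> W zeta z) ->
  W zeta z = cexp (stirling_exponent (lk zeta) (lk2 zeta) z).
Proof.
move=> hz z0 HW; have [r0|rn] := eqVneq (Re zeta) 0; last first.
  by apply: W_Cgt0 => //; rewrite /Cgt0 /= lt_neqAle eq_sym rn.
have [i0|iN] := eqVneq (Im zeta) 0; last by apply: W_Cge0 => //; apply: HW => //; exact/eqP.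
have -> : zeta = toC 0 by apply: eq_ReIm; rewrite ?cReC ?cImC.
exact: W_real.
Qed.

End BernsteinGamma.

(** * The error term in general, and its limits *)

Section ErrorTerm.
Context {R : realType}.
Variables (kappa : C R -> C R -> C R) (k00 d1 d2 : R).
Variables (mu : {measure set (R * R)%type -> \bar R}).
Hypothesis rep : bernstein2_rep kappa k00 d1 d2 mu.

Lemma kappa01_dichotomy : 0 < Re (kappa 0 1) \/ Re (kappa 0 1) = 0.
Proof.
by have := Re_kappa01_ge0 rep; rewrite le_eqVlt => /orP[/eqP <-|]; [right|left].
Qed.

Lemma E_degenerate zeta z : Re (kappa 0 1) = 0 -> Cge0 zeta -> 0 <= Re z ->
  E_ kappa zeta z = 0.
Proof.
move=> k0 hz z0; exact: (E_cst (fun w => kappa_degenerate rep k0 hz (z := w)) z0).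
Qed.

Lemma T_degenerate zeta : Re (kappa 0 1) = 0 -> Cge0 zeta -> T_ kappa zeta = 0.
Proof.
move=> k0 hz; exact: (T_cst (fun w => kappa_degenerate rep k0 hz (z := w))).
Qed.

Lemma cmod_E_le zeta z : Cge0 zeta -> 0 <= Re z -> cmod (E_ kappa zeta z) <= 2.
Proof.
move=> hz z0; case: kappa01_dichotomy => k0; first exact: (cmod_E_le2 rep).
by rewrite E_degenerate // cmod0.
Qed.

Lemma cmod_E_sub_T_le zeta z : Cge0 zeta -> 0 <= Re z ->
  cmod (E_ kappa zeta z - T_ kappa zeta) <= (1 + Re z)^-1.
Proof.
move=> hz z0; case: kappa01_dichotomy => k0; first exact: (cmod_E_sub_T rep).
by rewrite E_degenerate // T_degenerate // subrr cmod0 invr_ge0 addr_ge0.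
Qed.

Lemma E_zeta_small : [\/ d2 = 0, 0 < d1 | mu quadrant = +oo%E] ->
  forall e : R, 0 < e -> exists2 q0 : R, 0 <= q0 &
    forall (q : R) z, q0 <= q -> 0 <= Re z -> cmod (E_ kappa (toC q) z) <= e.
Proof.
move=> hd e e0; case: kappa01_dichotomy => k0; last first.
  exists 0 => // q z q0 z0; rewrite E_degenerate ?cmod0 ?(ltW e0) //.
(* Each tail is at most e / (4 b) * b + b^-1 <= e / 2, and E consists of two tails. *)
pose b := 4 / e + 1; have b1 : 1 <= b by rewrite lerDr divr_ge0 // ltW.
have b0 : 0 < b by exact: lt_le_trans b1.
have del0 : 0 < e / (4 * b) by rewrite divr_gt0 // mulr_gt0.
have [q0 q00 Hq] := log_curvature_cvg0 rep k0 hd del0.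
exists q0 => // q z qq z0; have hq : Cge0 (toC q : C R) by exact: le_trans qq.
have He w : 1 <= Re w -> cmod (lk2 kappa d2 mu (toC q) w) <= e / (4 * b) by exact: Hq.
have split w (w0 : 0 <= Re w) := cmod_saw_tail_split (is_cderive_lk2 rep k0 hq)
  (cmod_lk2 rep k0 hq) b1 w0 (ltW del0) He.
rewrite (E_saw_diff rep k0 hq z0) /saw_diff.
have r0 : 0 <= Re (0 : C R) by rewrite cRe0.
apply: le_trans (cmodB _ _) _; have := lerD (split z z0) (split 0 r0).
have -> : e / (4 * b) * b = e / 4 by field; rewrite gt_eqF.
have bV : b^-1 <= e / 4.
  rewrite -[leRHS]invrK invf_div lef_pV2 ?posrE ?divr_gt0 //.
  by rewrite /b lerDl.
move=> h; apply: le_trans h _; lra.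
Qed.

(** At zeta = 0, W(0, 2) = kappa(0, 1) is the mean of a positive random variable. *)
Lemma bernstein_gamma_nondegenerate W : bernstein_gamma2 kappa W -> 0 < Re (kappa 0 1).
Proof.
case=> WS W1 _ Wm; case: kappa01_dichotomy => // k0; exfalso.
have [d [T [P [Y [Y0 WE]]]]] := Wm 0 (lexx 0).
have hz : Cge0 (0 : C R) by rewrite /Cge0 /= lexx.
have := moment1_gt0 Y0 WE; have := mellin_nat Y0 WE 1.
have h1 : Cgt0 (1 : C R) by rewrite /Cgt0 /= ltr01.
rewrite (natC1 0) toC1 toC0 (WS _ _ hz h1) (W1 _ hz) mulr1.
by move=> /(congr1 (fun w : C R => Re w)); rewrite cReC k0 => <-; rewrite ltxx.
Qed.

End ErrorTerm.

(** The trichotomy in the last clause excludes cases such as kappa(zeta, z) = z, where E does not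
    depend on zeta and is positive for real z > 0. *)
Theorem theorem2p9 (R : realType) (kappa : C R -> C R -> C R)
    (hkappa : bernstein2 kappa) :
  [/\ forall W : C R -> C R -> C R, bernstein_gamma2 kappa W ->
        forall zeta z : C R, Cge0 zeta -> Cgt0 z ->
        (complex.Re zeta = 0 -> complex.Im zeta <> 0 ->
           W xi z @[xi --> within Cgt0 (nbhs zeta)] --> W zeta z) ->
        W zeta z = csqrt (kappa zeta 1)
                   / (kappa zeta z * csqrt (kappa zeta (1 + z)))
                   * cexp (L_ kappa zeta z) * cexp (- E_ kappa zeta z),
      (ereal_sup [set ereal_sup [set (cmod (E_ k p.1 p.2))%:E
                                | p in Cge0 `*` Cgt0]
                 | k in (@bernstein2 R)] <= 2%:E)%E,
      forall zeta : C R, Cge0 zeta ->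
        E_ kappa zeta z @[z --> Re_pinfty] --> T_ kappa zeta &
      forall (k00 d1 d2 : R) (mu : {measure set (R * R)%type -> \bar R}),
        bernstein2_rep kappa k00 d1 d2 mu ->
        [\/ d2 = 0, 0 < d1 | mu quadrant = +oo%E] ->
        forall z : C R, Cgt0 z ->
          E_ kappa (toC q) z @[q --> +oo] --> (0 : C R)].
Proof.
case: hkappa => k00 [d1 [d2 [mu rep]]]; split.
- move=> W WG zeta z hz z0 HW.
  have nd := bernstein_gamma_nondegenerate rep WG.
  by rewrite (stirling_exponentE rep nd hz z0) (W_formula rep nd WG hz z0 HW).
- apply: ge_ereal_sup => _ [k [k00' [d1' [d2' [mu' rep']]]] <-].
  apply: ge_ereal_sup => _ [[zeta z] [/= hz z0] <-].
  by rewrite lee_fin; apply: (cmod_E_le rep' hz); exact: ltW.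
- move=> zeta hz A /cmod_nbhs_ball[r r0 Hr]; exists (r^-1) => z hr.
  have rV : 0 < r^-1 by rewrite invr_gt0.
  have z0 : 0 < Re z by exact: lt_trans hr.
  apply: Hr; apply: le_lt_trans (cmod_E_sub_T_le rep hz (ltW z0)) _.
  rewrite -[ltRHS]invrK ltf_pV2 ?posrE ?addr_gt0 //.
  by rewrite (lt_trans hr) // ltrDr.
- move=> k00' d1' d2' mu' rep' hd z z0 A /cmod_nbhs_ball[r r0 Hr].
  have r2 : 0 < r / 2 by rewrite divr_gt0.
  have [q0 q00 Hq] := E_zeta_small rep' hd r2.
  exists q0; split; first exact: num_real.
  move=> q hq; apply: Hr; rewrite subr0.
  apply: le_lt_trans (Hq q z (ltW hq) (ltW z0)) _.
  by rewrite ltr_pdivrMr // ltr_pMr // ltr1n.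
Qed.
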